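(* Let $\mathcal O\subset\mathbb R^d$ be a bounded smooth domain. Let $\psi:\mathbb R\to[0,\infty)$ be convex and lower-semicontinuous with $\psi(0)=0$ and $\psi(x)=\psi(-x)$ for all $x\in\mathbb R$, such that $\psi(x)\le C(1+|x|)$ for all $x\in\mathbb R$ and some $C>0$, and such that there exists $y>0$ with $\psi(y)>0$. Let $\varphi:H^{-1}\to[0,\infty]$ be given by $\varphi(u)=\|\psi(u)\|_{TV}$ if $u\in\mathcal M(\mathcal O)\cap H^{-1}$ and $\varphi(u)=+\infty$ otherwise. Then $\varphi$ is the lower-semicontinuous hull of $\varphi|_{L^2(\mathcal O)}$ in $H^{-1}$, i.e. $$\varphi=\sup\left\{\beta:H^{-1}\to[0,\infty]\ \big|\ \beta\text{ convex and lower-semicontinuous},\ \beta|_{L^2(\mathcal O)}\le\varphi|_{L^2(\mathcal O)}\right\},$$ where $\sup$ denotes the pointwise supremum.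
   Context: $H^{-1}$ is the dual of $H^1_0(\mathcal O)$ (with norm $\|\nabla u\|_{L^2}$). $\mathcal M(\mathcal O)$: signed Radon measures on $\mathcal O$ with finite total variation, identified with the dual of $\mathcal C_0^0(\mathcal O)$ (continuous functions vanishing at the boundary); $\|\mu\|_{TV}=|\mu|(\mathcal O)$. $\mathcal M(\mathcal O)\cap H^{-1}$ is the set of $\mu\in\mathcal M(\mathcal O)$ for which there is $C\ge0$ with $\int\eta\,\mathrm d\mu\le C\|\eta\|_{H^1_0}$ for all $\eta\in \mathcal C_c^1(\mathcal O)$; such $\mu$ is identified with the element of $H^{-1}$ obtained by continuous extension of $\eta\mapsto\int\eta\,\mathrm d\mu$ from $\mathcal C^1_c(\mathcal O)$ to $H^1_0(\mathcal O)$. Functions in $L^2(\mathcal O)$ are identified with the measures having them as Lebesgue densities. Convex function of a measure: let $\psi^*(x)=\sup_{y\in\mathbb R}(xy-\psi(y))$ and $\mathcal D_\psi=\{v\in \mathcal C^0_c(\mathcal O):\psi^*(v)\in L^1(\mathcal O)\}$. For $\mu\in\mathcal M(\mathcal O)$, $\psi(\mu)\in\mathcal M(\mathcal O)$ is the positive measure given by $\int_{\mathcal O}\eta\,\psi(\mu)=\sup\{\int v\eta\,\mathrm d\mu-\int\psi^*(v)\eta\,\mathrm dx: v\in\mathcal D_\psi\}$ for $0\le\eta\in \mathcal C_0^0(\mathcal O)$, extended to general $\eta$ by $\eta=(\eta\vee0)-((-\eta)\vee 0)$. One has $\|\psi(\mu)\|_{TV}=\sup\{\int v\,\mathrm d\mu-\int\psi^*(v)\,\mathrm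 dx:v\in\mathcal D_\psi\}$. *)

(* Defs.v *)
From HB Require Import structures.
From mathcomp Require Import all_boot all_order all_algebra.
From mathcomp Require Import interval_inference.
From mathcomp Require Import all_classical all_reals all_analysis.

Set Implicit Arguments.
Unset Strict Implicit.
Unset Printing Implicit Defensive.

Import Order.TTheory GRing.Theory Num.Theory.
Import numFieldTopology.Exports numFieldNormedType.Exports.

Local Open Scope classical_set_scope.
Local Open Scope ring_scope.

Section borel_matrix.
Context (R : realType) (m n : nat).
Let G : set (set 'M[R]_(m, n)) := open.

HB.instance Definition _ := @isMeasurable.Build (sigma_display G) 'M[R]_(m, n)
  <<s G >> (@sigma_algebra0 _ setT G) (@sigma_algebraC _ G)
  (@sigma_algebra_bigcup _ setT G).

Lemma open_measurable_mx (A : set 'M[R]_(m, n)) : open A -> measurable A.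
Proof. exact: sub_sigma_algebra. Qed.

End borel_matrix.

Section lebesgue_rV.
Context (R : realType).

Lemma measurable_coord d (i : 'I_d) :
  measurable_fun [set: 'rV[R]_d] (fun x : 'rV[R]_d => x ord0 i).
Proof.
apply: (measurability _ (measurable_realfun.RGenOpens.measurableE R)).
move=> _ [_ [a [b ->]] <-]; rewrite setTI; apply: open_measurable_mx.
apply: open_comp; first by move=> x _; exact: coord_continuous.
exact: interval_open.
Qed.

Let rat_box d (c : 'rV[rat]_d * rat) : set 'rV[R]_d :=
  [set x | forall i, `|x ord0 i - ratr (c.1 ord0 i)| < ratr c.2].

Let open_rV_rat_box d (U : set 'rV[R]_d) : open U ->
  U = \bigcup_(c in [set c | rat_box c `<=` U]) rat_box c.
Proof.
move=> oU; apply/seteqP; split=> [x Ux|x [c /= cU /cU//]].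
have /nbhs_ballP[e /= e0 xeU] : nbhs x U by exact: open_nbhs_nbhs.
have /rat_in_itvoo[r] : 0 < e / 2 by rewrite divr_gt0.
rewrite in_itv/= => /andP[r0 re].
have /choice[q xq] : forall i, exists q : rat, `|x ord0 i - ratr q| < ratr r.
  move=> i; have /rat_in_itvoo[q] : x ord0 i - ratr r < x ord0 i + ratr r.
    by rewrite ltrBlDr -addrA ltrDl addr_gt0.
  by rewrite in_itv/= => /andP[h1 h2]; exists q; rewrite distrC ltr_distl h1.
exists (\row_i q i, r) => /=; last by move=> i /=; rewrite mxE.
move=> y /= xy; apply: xeU; split=> // i j; rewrite !ord1 /ball/=.
have := xy j; rewrite mxE => yq.
rewrite -(subrKA (ratr (q j))) (le_lt_trans (ler_normD _ _))//.
by rewrite [e]splitr ltrD// ?(lt_trans (xq j))// distrC (lt_trans yq).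
Qed.

Definition row_cons d (p : 'rV[R]_d * R) : 'rV[R]_d.+1 :=
  \row_i (if unlift ord0 i is Some j then p.1 ord0 j else p.2).

Lemma measurable_row_cons d :
  measurable_fun [set: 'rV[R]_d * R] (@row_cons d).
Proof.
have mcoord i :
    measurable_fun [set: 'rV[R]_d * R] (fun p => row_cons p ord0 i).
  under eq_fun do rewrite mxE; case: unlift => [j|]; last exact: measurable_snd.
  exact: measurableT_comp (measurable_coord j) measurable_fst.
apply: (@measurability _ _ _ 'rV[R]_d.+1 _ _ (@open 'rV[R]_d.+1)).
  by [].
move=> _ [U oU <-].
rewrite setTI (open_rV_rat_box oU) preimage_bigcup bigcup_mkcond.
apply: countable_bigcupT_measurable => [|c]; first exact: countableP.
case: ifPn => _; last exact: measurable0.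
rewrite (_ : _ @^-1` _ = \bigcap_(i in [set: 'I_d.+1])
  (fun p => row_cons p ord0 i) @^-1`
    `](ratr (c.1 ord0 i) - ratr c.2), (ratr (c.1 ord0 i) + ratr c.2)[%classic).
  apply: fin_bigcap_measurable => // i _; rewrite -[X in measurable X]setTI.
  by apply: mcoord => //; exact: measurable_itv.
apply/seteqP; split=> p /= h i; first by move=> _ /=; rewrite in_itv/= -ltr_distl.
by have := h i I; rewrite /= in_itv/= -ltr_distl.
Qed.

Section step.
Local Open Scope ereal_scope.
Context (d : nat) (mu : {measure set 'rV[R]_d -> \bar R}).

Definition lebesgue_step : set 'rV[R]_d.+1 -> \bar R :=
  pushforward (mu \x @lebesgue_measure R) (@row_cons d).

Let step0 : lebesgue_step set0 = 0.
Proof. by rewrite /lebesgue_step /pushforward preimage_set0 measure0. Qed.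

Let step_ge0 A : 0 <= lebesgue_step A.
Proof. by apply: integral_ge0. Qed.

Let step_sigma_additive : semi_sigma_additive lebesgue_step.
Proof.
move=> F mF tF mUF; rewrite /lebesgue_step /pushforward preimage_bigcup.
have mpre A : measurable A -> measurable (@row_cons d @^-1` A).
  by move=> mA; rewrite -[X in measurable X]setTI; exact: measurable_row_cons.
apply: measure_semi_sigma_additive => [n||]; first exact: mpre.
- apply/trivIsetP => /= i j _ _ ij; rewrite -preimage_setI.
  by move/trivIsetP : tF => /(_ _ _ _ _ ij) ->//; rewrite preimage_set0.
- by rewrite -preimage_bigcup; exact: mpre.
Qed.

HB.instance Definition _ := isMeasure.Build _ _ _ lebesgue_step
  step0 step_ge0 step_sigma_additive.

End step.

(* Iterated product of the Lebesgue measure on R; see lebesgue_rV_box. *)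
Fixpoint lebesgue_rV (d : nat) : {measure set 'rV[R]_d -> \bar R} :=
  match d with
  | 0 => \d_(0 : 'rV[R]_0)
  | d.+1 => lebesgue_step (lebesgue_rV d)
  end.

Lemma lebesgue_rV_box d (A : 'I_d -> set R) : (forall i, measurable (A i)) ->
  lebesgue_rV d [set x | forall i, A i (x ord0 i)] =
  (\prod_i lebesgue_measure (A i))%E.
Proof.
elim: d A => [|d IH] A mA.
  by rewrite big_ord0 /= diracE mem_set// => -[].
have mB : measurable
    [set x : 'rV[R]_d | forall i, A (lift ord0 i) (x ord0 i)].
  rewrite (_ : [set _ | _] = \bigcap_(i in [set: 'I_d])
      (fun x : 'rV[R]_d => x ord0 i) @^-1` A (lift ord0 i)).
    apply: fin_bigcap_measurable => // i _; rewrite -[X in measurable X]setTI.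
    exact: measurable_coord.
  by apply/seteqP; split=> x /= h i; [move=> _; exact: h|exact: (h i I)].
rewrite big_ord_recl muleC -(IH (fun i => A (lift ord0 i)))//=.
rewrite /lebesgue_step /pushforward -(product_measure1E (lebesgue_rV d) lebesgue_measure mB (mA ord0)).
congr product_measure1; apply/seteqP; split=> -[x t] /=.
  move=> h; split=> [i|]; first by have := h (lift ord0 i); rewrite mxE liftK.
  by have := h ord0; rewrite mxE unlift_none.
move=> [hx ht] i; rewrite mxE.
by case: unliftP => [j ->|->] //=; exact: hx.
Qed.

End lebesgue_rV.

Section function_spaces.
Context (R : realType).

Definition partial d (i : 'I_d) (f : 'rV[R]_d -> R) : 'rV[R]_d -> R :=
  fun x => 'D_(delta_mx ord0 i) f x.

Fixpoint Ck d (k : nat) (f : 'rV[R]_d -> R) : Prop :=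
  continuous f /\
  if k is k'.+1 then
    forall i : 'I_d,
      (forall x, derivable f x (delta_mx ord0 i)) /\ Ck k' (partial i f)
  else True.

Definition smooth d (f : 'rV[R]_d -> R) := forall k, Ck k f.

(* Near each boundary point, and up to relabeling and reflecting the coordinate
   axes, O is the set of points lying strictly above the graph of a smooth
   function of the other coordinates. *)
Definition smooth_boundary d (O : set 'rV[R]_d) :=
  forall x0, (closure O `\` interior O) x0 ->
  exists (r : R) (i : 'I_d) (s : bool) (g : 'rV[R]_d.-1 -> R),
    [/\ 0 < r, smooth g &
     forall x, ball x0 r x -> O x <-> g (col' i x) < (-1) ^+ s * x ord0 i].

Definition bounded_smooth_domain d (O : set 'rV[R]_d) :=
  [/\ open O, connected O, O !=set0, bounded_set O & smooth_boundary O].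

(* Functions on O vanishing on (or near) its boundary are represented by their
   extension by zero to the whole space; likewise measures on O. *)
Definition support d (f : 'rV[R]_d -> R) := closure [set x | f x != 0].

Definition Cc0 d (O : set 'rV[R]_d) (f : 'rV[R]_d -> R) :=
  [/\ continuous f, compact (support f) & support f `<=` O].

Definition Cc1 d (O : set 'rV[R]_d) (f : 'rV[R]_d -> R) :=
  Cc0 O f /\ Ck 1 f.

Definition C00 d (O : set 'rV[R]_d) (f : 'rV[R]_d -> R) :=
  continuous f /\ forall x, ~ O x -> f x = 0.

Lemma Cc0_lin d (O : set 'rV[R]_d) (a : R) f g :
  Cc0 O f -> Cc0 O g -> Cc0 O (fun x => a * f x + g x).
Proof.
move=> [cf kf fO] [cg kg gO].
have sub : support (fun x => a * f x + g x) `<=` support f `|` support g.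
  rewrite /support -closureU; apply: closureS => x /= h; apply/orP.
  apply: contraNT h; rewrite negb_or !negbK => /andP[/eqP -> /eqP ->].
  by rewrite mulr0 addr0.
split.
- by move=> x; apply: (cvgD (cvgMl_tmp (cf x)) (cg x)).
- by apply: subclosed_compact sub; [exact: closed_closure|exact: compactU].
- by move=> x /sub[/fO|/gO].
Qed.

Lemma derive_lin d (a : R) (f g : 'rV[R]_d -> R) (x v : 'rV[R]_d) :
  derivable f x v -> derivable g x v ->
  derivable (fun y => a * f y + g y) x v /\
  'D_v (fun y => a * f y + g y) x = a * 'D_v f x + 'D_v g x.
Proof.
move=> df dg; have daf : derivable (a \*: (f : 'rV[R]_d -> R^o)) x v.
  exact: derivableZ.
by split; [exact: derivableD|rewrite deriveD// deriveZ].
Qed.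

Lemma Ck_lin d k (a : R) (f g : 'rV[R]_d -> R) :
  Ck k f -> Ck k g -> Ck k (fun x => a * f x + g x).
Proof.
have cD (f' g' : 'rV[R]_d -> R) : continuous f' -> continuous g' ->
    continuous (fun x => a * f' x + g' x).
  by move=> cf cg x; apply: (cvgD (cvgMl_tmp (cf x)) (cg x)).
elim: k f g => [f g [cf _] [cg _]|k IH f g [cf df] [cg dg]].
  by split => //; exact: cD.
split=> [|i]; first exact: cD.
have [dfi cfi] := df i; have [dgi cgi] := dg i; split.
  by move=> x; have [] := derive_lin a (dfi x) (dgi x).
rewrite (_ : partial i _ = fun x => a * partial i f x + partial i g x).
  exact: IH.
by apply/funext => x; have [] := derive_lin a (dfi x) (dgi x).
Qed.

Lemma Cc1_lin d (O : set 'rV[R]_d) (a : R) f g :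
  Cc1 O f -> Cc1 O g -> Cc1 O (fun x => a * f x + g x).
Proof.
by move=> [Of f1] [Og g1]; split; [exact: Cc0_lin|exact: Ck_lin].
Qed.

Lemma Cc1_0 d (O : set 'rV[R]_d) : Cc1 O (cst 0).
Proof.
have s0 : support (cst 0 : 'rV[R]_d -> R) = set0.
  rewrite /support (_ : [set _ | _] = set0) ?closure0//.
  by apply/seteqP; split=> x //=; rewrite eqxx.
split; first by split; rewrite ?s0//; [exact: cst_continuous|exact: compact0].
split=> [|i]; first exact: cst_continuous.
split=> [x|]; first exact: derivable_cst.
split=> //; rewrite (_ : partial i _ = cst 0); first exact: cst_continuous.
by apply/funext => x; rewrite /partial derive_cst.
Qed.

End function_spaces.

Section sobolev.
Context (R : realType) (d : nat).

Lemma one_le_two : (1 <= 2%:E :> \bar R)%E.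
Proof. by rewrite lee_fin ler1n. Qed.

Definition L2 := LfunType (lebesgue_rV R d) one_le_two.

Definition L2norm (f : L2) : R :=
  fine ('N[lebesgue_rV R d]_2%:E[EFin \o f])%E.

Lemma L2norm_ge0 f : 0 <= L2norm f.
Proof. exact/fine_ge0/Lnorm_ge0. Qed.

Lemma L2normD f g : L2norm (f + g) <= L2norm f + L2norm g.
Proof. exact: ler_LnormD. Qed.

Lemma L2normZ a f : L2norm (a *: f) = `|a| * L2norm f.
Proof. by rewrite /L2norm LnormZ -finite_norm_fine -EFinM. Qed.

Lemma L2norm0 : L2norm 0 = 0.
Proof. by rewrite -(scale0r 0) L2normZ normr0 mul0r. Qed.

(* Pairs (w, g), where g is meant to be the weak gradient of w. *)
Definition pre_H10 := (L2 * {ffun 'I_d -> L2})%type.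

Variable O : set 'rV[R]_d.

(* C^1_c(O), each function being paired with its classical gradient. *)
Definition Cc1_graph : set pre_H10 :=
  [set w : pre_H10 |
    Cc1 O w.1 /\ forall i x, w.2 i x = partial i w.1 x].

(* H^1_0(O) is the closure of C^1_c(O) in H^1. An element is a function w paired
   with its weak gradient, the L^2 limit of the gradients of the approximating
   functions (w determines it almost everywhere). Functions that agree almost
   everywhere are not identified: H10norm is a seminorm on H10, and its dual Hm1
   is the dual of the quotient. *)
Definition H10_pred : {pred pre_H10} := mem [set w : pre_H10 |
  forall e, 0 < e -> exists w' : pre_H10, [/\ Cc1_graph w',
    L2norm (w.1 - w'.1) < e & forall i, L2norm (w.2 i - w'.2 i) < e]].

Lemma Cc1_graph_lin a w w' : Cc1_graph w -> Cc1_graph w' ->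
  Cc1_graph (a *: w + w').
Proof.
move=> [Cw ww] [Cw' ww']; split; first exact: (Cc1_lin a Cw Cw').
move=> i x; rewrite !ffunE.
have [[_ [_ /(_ i)[dw _]]] [_ [_ /(_ i)[dw' _]]]] := (Cw, Cw').
by have [_] := derive_lin a (dw x) (dw' x); rewrite /partial /= => ->; rewrite -[in RHS]/(partial i w.1 x) -[in RHS]/(partial i w'.1 x) -ww -ww'.
Qed.

Lemma H10_submod_closed : submod_closed H10_pred.
Proof.
split=> [|a u v]; rewrite !inE.
  move=> e e0; exists 0; split.
  - split; first exact: Cc1_0.
    move=> i x; rewrite ffunE; by rewrite /partial derive_cst.
  - by rewrite subrr L2norm0.
  - by move=> i; rewrite subrr L2norm0.
move=> hu hv e e0.
have a0 : 0 < `|a| + 1 by rewrite ltr_wpDl.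
have [u' [Gu u1 u2]] := hu _ (divr_gt0 (divr_gt0 e0 (ltr0n R 2)) a0).
have [v' [Gv v1 v2]] := hv _ (divr_gt0 e0 (ltr0n R 2)).
have key (f f' g g' : L2) : L2norm (f - f') < e / 2 / (`|a| + 1) ->
    L2norm (g - g') < e / 2 -> L2norm (a *: f + g - (a *: f' + g')) < e.
  move=> fe ge; rewrite opprD addrACA -scalerBr.
  rewrite (le_lt_trans (L2normD _ _))// L2normZ [e]splitr ltr_leD// ?ltW//.
  rewrite (le_lt_trans _ (_ : (`|a| + 1) * L2norm (f - f') < _))//.
    by rewrite ler_wpM2r ?L2norm_ge0// lerDl.
  by rewrite mulrC -ltr_pdivlMr.
exists (a *: u' + v'); split; first exact: Cc1_graph_lin.
- exact: key.
- by move=> i; rewrite !ffunE; apply: key.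
Qed.

HB.instance Definition _ := GRing.isSubmodClosed.Build R pre_H10 H10_pred
  H10_submod_closed.

Record H10 := MkH10 { H10_val :> pre_H10 ; _ : H10_val \in H10_pred }.

HB.instance Definition _ := [isSub for H10_val].
HB.instance Definition _ := [Choice of H10 by <:].
HB.instance Definition _ := [SubChoice_isSubLmodule of H10 by <:].

Definition H10_fun (w : H10) : L2 := (H10_val w).1.
Definition H10_grad (w : H10) (i : 'I_d) : L2 := (H10_val w).2 i.

Definition H10norm (w : H10) : R :=
  Num.sqrt (\sum_(i < d) L2norm (H10_grad w i) ^+ 2).

Lemma H10normZ a w : H10norm (a *: w) = `|a| * H10norm w.
Proof.
rewrite /H10norm -[`|a| in RHS]normr_id -sqrtr_sqr -sqrtrM ?sqr_ge0//.
congr Num.sqrt; rewrite mulr_sumr; apply: eq_bigr => i _.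
by rewrite /H10_grad /= ffunE L2normZ exprMn.
Qed.

Definition Hm1_pred : {pred (H10 -> R^o)} := mem [set f : H10 -> R^o |
  linear f /\ exists C, forall w, `|f w| <= C * H10norm w].

Lemma Hm1_submod_closed : submod_closed Hm1_pred.
Proof.
split=> [|a f g]; rewrite !inE.
  split; first by move=> k u v; rewrite scaler0 addr0.
  by exists 0 => w; rewrite normr0 mul0r.
move=> [lf [C fC]] [lg [D gD]]; split.
  move=> k u v /=; rewrite !fctE lf lg !scalerDr !scalerA [k * a]mulrC.
  by rewrite addrACA.
exists (`|a| * C + D) => w; rewrite !fctE (le_trans (ler_normD _ _))//.
by rewrite mulrDl lerD// normrZ -mulrA ler_wpM2l.
Qed.

HB.instance Definition _ := GRing.isSubmodClosed.Build R (H10 -> R^o) Hm1_pred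
  Hm1_submod_closed.

Record Hm1 := MkHm1 { Hm1_val :> H10 -> R^o ; _ : Hm1_val \in Hm1_pred }.

HB.instance Definition _ := [isSub for Hm1_val].
HB.instance Definition _ := [Choice of Hm1 by <:].
HB.instance Definition _ := [SubChoice_isSubLmodule of Hm1 by <:].

Lemma Hm1_spec (f : Hm1) :
  linear (f : H10 -> R^o) /\ exists C, forall w, `|f w| <= C * H10norm w.
Proof. by have := valP f; rewrite inE. Qed.

Definition Hm1norm (f : Hm1) : R :=
  sup [set `|f w| | w in [set w | H10norm w <= 1]].

Lemma Hm1norm_has_sup (f : Hm1) :
  has_sup [set `|f w| | w in [set w | H10norm w <= 1]].
Proof.
split.
  exists `|f 0|, 0 => //=; rewrite -(scale0r 0) H10normZ normr0 mul0r.
  exact: ler01.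
have [_ [C fC]] := Hm1_spec f; exists `|C| => _ [w /= w1 <-].
rewrite (le_trans (fC w))// (le_trans (ler_norm _))// normrM.
by rewrite ler_piMr// ger0_norm ?sqrtr_ge0.
Qed.

Lemma Hm1normP (f : Hm1) w : `|f w| <= Hm1norm f * H10norm w.
Proof.
have [w0|w0] := eqVneq (H10norm w) 0.
  by have [_ [C /(_ w)]] := Hm1_spec f; rewrite w0 !mulr0.
have wgt0 : 0 < H10norm w by rewrite lt_neqAle eq_sym w0 sqrtr_ge0.
rewrite -ler_pdivrMr//.
have -> : `|f w| / H10norm w = `|f ((H10norm w)^-1 *: w)|.
  have [lf _] := Hm1_spec f.
  have -> : f ((H10norm w)^-1 *: w) = (H10norm w)^-1 *: f w.
    have f0 : f 0 = 0 by have := lf (-1) 0 0; rewrite !scaleN1r oppr0 addr0 addNr.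
    by have := lf (H10norm w)^-1 w 0; rewrite f0 !addr0.
  by rewrite normrZ mulrC ger0_norm// invr_ge0 ltW.
apply: (sup_upper_bound (Hm1norm_has_sup f)); exists ((H10norm w)^-1 *: w) => //=.
by rewrite H10normZ ger0_norm ?invr_ge0 ?(ltW wgt0)// mulVf.
Qed.

Lemma ler_Hm1normD f g : Hm1norm (f + g) <= Hm1norm f + Hm1norm g.
Proof.
apply: ge_sup => [|_ [w /= w1 <-]]; first exact: (Hm1norm_has_sup _).1.
rewrite !fctE (le_trans (ler_normD _ _))// lerD//;
  apply: (sup_upper_bound (Hm1norm_has_sup _)); by exists w.
Qed.

Lemma Hm1normZ a f : Hm1norm (a *: f) = `|a| * Hm1norm f.
Proof.
have leZ b g : Hm1norm (b *: g) <= `|b| * Hm1norm g.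
  apply: ge_sup => [|_ [w /= w1 <-]]; first exact: (Hm1norm_has_sup _).1.
  rewrite !fctE normrZ ler_wpM2l//.
  by apply: (sup_upper_bound (Hm1norm_has_sup _)); exists w.
apply/eqP; rewrite eq_le leZ/=.
have [->|a0] := eqVneq a 0.
  rewrite normr0 mul0r; apply: (le_trans (normr_ge0 ((0 *: f : Hm1) 0))).
  apply: (sup_upper_bound (Hm1norm_has_sup _)); exists 0 => //=.
  by rewrite -(scale0r 0) H10normZ normr0 mul0r ler01.
rewrite mulrC -ler_pdivlMr ?normr_gt0// mulrC -normfV.
by apply: le_trans (leZ _ _); rewrite scalerA mulVf// scale1r.
Qed.

Lemma Hm1norm0_eq0 f : Hm1norm f = 0 -> f = 0.
Proof.
move=> f0; apply: val_inj; apply/funext => w /=; apply/eqP.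
by rewrite -normr_le0 (le_trans (Hm1normP f w))// f0 mul0r.
Qed.

HB.instance Definition _ := @Lmodule_isNormed.Build R Hm1 Hm1norm
  ler_Hm1normD Hm1normZ Hm1norm0_eq0.

End sobolev.

Section charges.
Context (R : realType) (d : nat).
Let charge_rV := {charge set 'rV[R]_d -> \bar R}.

Lemma hahn_ex (mu : charge_rV) :
  exists PN : set 'rV[R]_d * set 'rV[R]_d, hahn_decomposition mu PN.1 PN.2.
Proof. by have [P [N h]] := Hahn_decomposition mu; exists (P, N). Qed.

(* Neither the Jordan parts nor the variation depend on the chosen Hahn
   decomposition. *)
Definition hahn (mu : charge_rV) := cid (hahn_ex mu).
Definition charge_pos (mu : charge_rV) := jordan_pos (svalP (hahn mu)).
Definition charge_neg (mu : charge_rV) := jordan_neg (svalP (hahn mu)).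

Definition charge_int (mu : charge_rV) (f : 'rV[R]_d -> R) : R :=
  \int[charge_pos mu]_x f x - \int[charge_neg mu]_x f x.

Definition tv (O : set 'rV[R]_d) (mu : charge_rV) : \bar R :=
  charge_variation (svalP (hahn mu)) O.

(* M(O): finite signed Borel measures (automatically Radon) carried by O. *)
Definition measures_on (O : set 'rV[R]_d) : set charge_rV :=
  [set mu | forall A, measurable A -> A `&` O = set0 -> mu A = 0%E].

Definition has_density (O : set 'rV[R]_d) (f : 'rV[R]_d -> R) (mu : charge_rV) :=
  forall A, measurable A ->
    mu A = (\int[lebesgue_rV R d]_(x in A `&` O) (f x)%:E)%E.

End charges.

Section duality.
Context (R : realType) (d : nat) (O : set 'rV[R]_d).
Let charge_rV := {charge set 'rV[R]_d -> \bar R}.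

Definition measures_in_Hm1 : set charge_rV :=
  [set mu | measures_on O mu /\ exists2 C : R, 0 <= C &
    forall w : H10 O, Cc1_graph O w -> charge_int mu (H10_fun w) <= C * H10norm w].

Definition extends (u : Hm1 O) (mu : charge_rV) :=
  forall w : H10 O, Cc1_graph O w -> u w = charge_int mu (H10_fun w).

(* u in H^{-1} is the element with which mu, in the intersection of M(O) and
   H^{-1}, is identified. Such a mu is unique, since C^1_c(O) is dense in
   C^0_0(O). *)
Definition is_measure_of (u : Hm1 O) (mu : charge_rV) :=
  measures_in_Hm1 mu /\ extends u mu.

(* L^2(O) consists of the restrictions to O of functions in L^2. *)
Definition L2_in_Hm1 : set (Hm1 O) :=
  [set u | exists (f : L2 R d) (mu : charge_rV),
    has_density O f mu /\ is_measure_of u mu].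


Definition conjugate (psi : R -> R) (x : R) : \bar R :=
  ereal_sup [set (x * y - psi y)%:E | y in [set: R]].

Definition conj_domain (psi : R -> R) : set ('rV[R]_d -> R) :=
  [set v | Cc0 O v /\
    (lebesgue_rV R d).-integrable O (fun x => conjugate psi (v x))].

(* nu = psi(mu). For eta of arbitrary sign the value of the integral of eta
   follows from the nonnegative case by linearity in eta. *)
Definition is_measure_fun (psi : R -> R) (mu nu : charge_rV) :=
  [/\ measures_on O nu,
      forall A, measurable A -> (0 <= nu A)%E &
      forall eta, C00 O eta -> (forall x, 0 <= eta x) ->
        (charge_int nu eta)%:E = ereal_sup
          [set ((charge_int mu (fun x => v x * eta x))%:E -
                \int[lebesgue_rV R d]_(x in O)
                  (conjugate psi (v x) * (eta x)%:E))%E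
             | v in conj_domain psi]].

(* The default value czero is never used: psi(mu) exists for every mu in M(O)
   and every psi as in the theorem. *)
Definition measure_fun (psi : R -> R) (mu : charge_rV) : charge_rV :=
  if pselect (exists nu, is_measure_fun psi mu nu) is left h
  then projT1 (cid h) else czero.

Definition phi (psi : R -> R) (u : Hm1 O) : \bar R :=
  if pselect (exists mu, is_measure_of u mu) is left h
  then tv O (measure_fun psi (projT1 (cid h))) else +oo%E.

End duality.

Definition econvex (R : realType) (V : lmodType R) (beta : V -> \bar R) :=
  forall (u v : V) (t : R), 0 <= t <= 1 ->
    (beta (t *: u + (1 - t) *: v)%R
      <= t%:E * beta u + (1 - t)%:E * beta v)%E.

(* Main.v *)
Require Import Defs.
From HB Require Import structures.
From mathcomp Require Import all_boot all_order all_algebra.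
From mathcomp Require Import ring lra.
From mathcomp Require Import all_classical all_reals all_analysis measurable_realfun.
Set Implicit Arguments.
Unset Strict Implicit.
Unset Printing Implicit Defensive.
Import Order.TTheory GRing.Theory Num.Theory.
Import numFieldTopology.Exports numFieldNormedType.Exports.
Local Open Scope classical_set_scope.
Local Open Scope ring_scope.

(* For u in H^{-1} let Phi(u) be the supremum of <u, v> - int psi^*(v) over the
   v in C^1_c with psi^*(v) integrable. Then phi = Phi. If u is a measure, this is the
   formula for the total variation of psi(u), since C^1_c is dense in C^0_0 and psi^*
   is Lipschitz on compact subsets of the interior of its domain. If Phi(u) is finite,
   then u is bounded for the sup norm on C^1_c, hence a measure by Riesz' theorem.
   The truncated affine functions max(0, <., v> - int psi^*(v)) are competitors whose
   supremum is Phi.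

   Conversely a lower semicontinuous beta below phi on L^2 is below Phi as soon as u
   with Phi(u) < oo is an H^{-1} limit of continuous densities f such that int psi(f)
   is at most Phi(u) + eta. Let psi_delta(y) = psi(y) + delta y^2, let w in C^1_c almost
   maximize <u, w> - int psi_delta^*(w) - lam/2 |grad w|^2, and put
   f = k'(w) with k = psi_delta^*. By the Euler-Lagrange equation u - f is close to
   - lam Laplacian(w), which tends to 0 in H^{-1} with lam, and int psi(f) is at most
   the supremum, up to a small error. The supremum is at most Phi(u) + eta for small
   delta: the almost maximizers for two small values of delta are close in H^1_0, so
   that truncating and rescaling one of them yields an admissible v for Phi(u). *)

(** * Continuous functions vanishing outside a bounded set *)

(** The obstacle is that psi^* jumps to infinity beyond the recession slope M and need not be
    differentiable, so the dual problem has no usable Euler-Lagrange equation. The conjugate of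
    psi_delta is finite with a Lipschitz derivative, and the Dirichlet term makes the dual energy
    coercive and uniformly concave. Almost maximizers suffice: along every direction the energy is
    bounded below by a quadratic, and a discriminant bounds the first-order residual. The delicate
    point is to let delta tend to 0, because an almost maximizer w for psi_delta may exceed M.
    Cutting it off changes <u, w> by at most |u| times the L^2 norm of grad w over the set where |w|
    exceeds a level a > M. There psi_delta^*(w) is at least (a - M)^2 / (4 delta), so that set has
    measure O(delta); but grad w could concentrate on it. Uniform concavity excludes this: grad w is
    close in L^2 to the gradient of an almost maximizer for an earlier, fixed delta, and that
    gradient is a bounded function. *)

Section continuous_ops.
Context (R : realType) (T : topologicalType).
Implicit Types f g : T -> R.

Lemma continuousD_fun f g : continuous f -> continuous g ->
  continuous (fun x => f x + g x).
Proof. by move=> cf cg x; apply: cvgD; [exact: cf|exact: cg]. Qed.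

Lemma continuousM_fun f g : continuous f -> continuous g ->
  continuous (fun x => f x * g x).
Proof. by move=> cf cg x; apply: cvgM; [exact: cf|exact: cg]. Qed.

Lemma continuousN_fun f : continuous f -> continuous (fun x => - f x).
Proof. by move=> cf x; apply: cvgN; exact: cf. Qed.

Lemma continuousB_fun f g : continuous f -> continuous g ->
  continuous (fun x => f x - g x).
Proof. by move=> cf cg; apply: continuousD_fun => //; exact: continuousN_fun. Qed.

Lemma continuous_abs_fun f : continuous f -> continuous (fun x => `|f x|).
Proof. by move=> cf x; apply: cvg_norm; exact: cf. Qed.

Lemma maxrE (a b : R) : Num.max a b = (a + b + `|a - b|) / 2.
Proof.
by case: (lerP a b) => ab; field.
Qed.

Lemma minrE (a b : R) : Num.min a b = (a + b - `|a - b|) / 2.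
Proof.
by case: (lerP a b) => ab; field.
Qed.

Lemma continuous_max_fun f g : continuous f -> continuous g ->
  continuous (fun x => Num.max (f x) (g x)).
Proof.
move=> cf cg; under eq_fun do rewrite maxrE.
apply: continuousM_fun; last exact: cst_continuous.
apply: continuousD_fun; first exact: continuousD_fun.
by apply: continuous_abs_fun; exact: continuousB_fun.
Qed.

Lemma continuous_min_fun f g : continuous f -> continuous g ->
  continuous (fun x => Num.min (f x) (g x)).
Proof.
move=> cf cg; under eq_fun do rewrite minrE.
apply: continuousM_fun; last exact: cst_continuous.
apply: continuousB_fun; first exact: continuousD_fun.
by apply: continuous_abs_fun; exact: continuousB_fun.
Qed.

Lemma continuous_sum_fun (I : Type) (s : seq I) (f : I -> T -> R) :
  (forall i, continuous (f i)) -> continuous (fun x => \sum_(i <- s) f i x).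
Proof.
move=> cf; elim: s => [|i s IH].
  by under eq_fun do rewrite big_nil; exact: cst_continuous.
by under eq_fun do rewrite big_cons; exact: continuousD_fun.
Qed.

Lemma open_gt f c : continuous f -> open [set x | c < f x].
Proof.
move=> cf; rewrite (_ : [set _ | _] = f @^-1` [set y | c < y])//.
by apply: open_comp => [x _|]; [exact: cf|exact: open_gt].
Qed.

Lemma open_lt f c : continuous f -> open [set x | f x < c].
Proof.
move=> cf; rewrite (_ : [set _ | _] = f @^-1` [set y | y < c])//.
by apply: open_comp => [x _|]; [exact: cf|exact: open_lt].
Qed.

Lemma closed_ge f c : continuous f -> closed [set x | c <= f x].
Proof.
move=> cf; rewrite (_ : [set _ | _] = f @^-1` [set y | c <= y])//.
by apply: preimage_closed => //; exact: closed_ge.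
Qed.

End continuous_ops.

(** * Distance to the complement and cutoff functions *)

Section cdist.
Context (R : realType) (V : normedModType R).
Implicit Types (U : set V) (x y : V).

(** The distance to the complement of [U], capped at 1; the element 1 also keeps the set nonempty
    when [U] is the whole space. *)
Definition cdist U x : R := inf ([set 1] `|` [set `|x - y| | y in ~` U]).

Let has_inf_cdist U x : has_inf ([set 1] `|` [set `|x - y| | y in ~` U]).
Proof.
split; first by exists 1; left.
by exists 0 => _ [->|[y _ <-]]; [exact: ler01|exact: normr_ge0].
Qed.

Lemma cdist_ge0 U x : 0 <= cdist U x.
Proof.
apply: lb_le_inf; first exact: (has_inf_cdist U x).1.
by move=> _ [->|[y _ <-]]; [exact: ler01|exact: normr_ge0].
Qed.

Lemma cdist_out U x : ~ U x -> cdist U x = 0.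
Proof.
move=> Ux; apply/eqP; rewrite eq_le cdist_ge0 andbT.
apply: ge_inf; first exact: (has_inf_cdist U x).2.
by right; exists x => //; rewrite subrr normr0.
Qed.

Lemma cdist_gt0 U x : open U -> U x -> 0 < cdist U x.
Proof.
move=> oU Ux; have /nbhs_ballP[e /= e0 eU] : nbhs x U by exact: open_nbhs_nbhs.
apply: (@lt_le_trans _ _ (Num.min 1 e)); first by rewrite lt_min ltr01.
apply: lb_le_inf; first exact: (has_inf_cdist U x).1.
move=> _ [->|[y Uy <-]]; first by rewrite ge_min lexx.
rewrite ge_min; apply/orP; right; rewrite leNgt; apply/negP => xy.
by apply: Uy; apply: eU; rewrite -ball_normE.
Qed.

Lemma cdist_lip U x y : cdist U x <= `|x - y| + cdist U y.
Proof.
rewrite -lerBlDl; apply: lb_le_inf; first exact: (has_inf_cdist U y).1.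
move=> _ [->|[z Uz <-]]; rewrite lerBlDl.
  apply: (@le_trans _ _ 1); last by rewrite lerDr.
  by apply: ge_inf; [exact: (has_inf_cdist U x).2|left].
apply: (@le_trans _ _ `|x - z|); last first.
  exact: ler_distD.
by apply: ge_inf; [exact: (has_inf_cdist U x).2|right; exists z].
Qed.

Lemma continuous_cdist U : continuous (cdist U).
Proof.
move=> x; apply/cvgrPdist_lt => e e0; near=> y.
rewrite ltr_norml; have xy : `|x - y| < e by near: y; exact: cvgr_dist_lt.
have := cdist_lip U x y; have := cdist_lip U y x; rewrite (distrC y x).
by move=> h1 h2; apply/andP; split; lra.
Unshelve. all: by end_near. Qed.

(** For open [U] these continuous functions increase with [n] to the indicator of [U]. They take the
    place of Urysohn functions. *)
Definition cutoff U n x : R := Num.min 1 (n%:R * cdist U x).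

Lemma continuous_cutoff U n : continuous (cutoff U n).
Proof.
apply: continuous_min_fun; first exact: cst_continuous.
by apply: continuousM_fun; [exact: cst_continuous|exact: continuous_cdist].
Qed.

Lemma cutoff_ge0 U n x : 0 <= cutoff U n x.
Proof. by rewrite le_min ler01 mulr_ge0// cdist_ge0. Qed.

Lemma cutoff_le1 U n x : cutoff U n x <= 1.
Proof. by rewrite ge_min lexx. Qed.

Lemma cutoff_out U n x : ~ U x -> cutoff U n x = 0.
Proof. by move=> Ux; rewrite /cutoff cdist_out// mulr0 min_r. Qed.

Lemma cutoff_nd U m n x : (m <= n)%N -> cutoff U m x <= cutoff U n x.
Proof.
move=> mn; rewrite le_min ge_min lexx/= ge_min; apply/orP; right.
by rewrite ler_wpM2r ?cdist_ge0// ler_nat.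
Qed.

Lemma cutoff_eq1 U x : open U -> U x ->
  exists N, forall n, (N <= n)%N -> cutoff U n x = 1.
Proof.
move=> oU Ux; have d0 := cdist_gt0 oU Ux.
exists (Num.truncn (cdist U x)^-1).+1 => n Nn.
rewrite /cutoff min_l// -ler_pdivrMr// mul1r.
by rewrite (le_trans (ltW (truncnS_gt _)))// ler_nat.
Qed.

End cdist.

(** * The lattice C^0_0 and Dini's theorem *)

Section C00_theory.
Context (R : realType) (d : nat) (O : set 'rV[R]_d).
Implicit Types f g : 'rV[R]_d -> R.

Lemma C00_0 : C00 O (fun=> 0).
Proof. by split=> //; exact: cst_continuous. Qed.

Lemma C00D f g : C00 O f -> C00 O g -> C00 O (fun x => f x + g x).
Proof.
move=> [cf f0] [cg g0]; split; first exact: continuousD_fun.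
by move=> x Ox; rewrite f0// g0// addr0.
Qed.

Lemma C00Ml f g : continuous f -> C00 O g -> C00 O (fun x => f x * g x).
Proof.
move=> cf [cg g0]; split; first exact: continuousM_fun.
by move=> x Ox; rewrite g0// mulr0.
Qed.

Lemma C00Mr f g : C00 O f -> continuous g -> C00 O (fun x => f x * g x).
Proof.
move=> [cf f0] cg; split; first exact: continuousM_fun.
by move=> x Ox; rewrite f0// mul0r.
Qed.

Lemma C00Z a f : C00 O f -> C00 O (fun x => a * f x).
Proof. by apply: C00Ml; exact: cst_continuous. Qed.

Lemma C00N f : C00 O f -> C00 O (fun x => - f x).
Proof.
move=> [cf f0]; split; first exact: continuousN_fun.
by move=> x Ox; rewrite f0// oppr0.
Qed.

Lemma C00B f g : C00 O f -> C00 O g -> C00 O (fun x => f x - g x).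
Proof. by move=> Cf Cg; apply: C00D => //; exact: C00N. Qed.

Lemma C00_max f g : C00 O f -> C00 O g -> C00 O (fun x => Num.max (f x) (g x)).
Proof.
move=> [cf f0] [cg g0]; split; first exact: continuous_max_fun.
by move=> x Ox; rewrite f0// g0// maxxx.
Qed.

Lemma C00_min f g : C00 O f -> C00 O g -> C00 O (fun x => Num.min (f x) (g x)).
Proof.
move=> [cf f0] [cg g0]; split; first exact: continuous_min_fun.
by move=> x Ox; rewrite f0// g0// minxx.
Qed.

Lemma C00_abs f : C00 O f -> C00 O (fun x => `|f x|).
Proof.
move=> [cf f0]; split; first exact: continuous_abs_fun.
by move=> x Ox; rewrite f0// normr0.
Qed.

Lemma C00_sum (I : Type) (s : seq I) (f : I -> 'rV[R]_d -> R) :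
  (forall i, C00 O (f i)) -> C00 O (fun x => \sum_(i <- s) f i x).
Proof.
move=> Cf; split; first by apply: continuous_sum_fun => i; exact: (Cf i).1.
by move=> x Ox; rewrite big1// => i _; exact: (Cf i).2.
Qed.

Lemma C00_comp (h : R -> R) f : continuous h -> h 0 = 0 -> C00 O f ->
  C00 O (fun x => h (f x)).
Proof.
move=> ch h0 [cf f0]; split=> [x|x Ox]; last by rewrite f0.
by apply: continuous_comp; [exact: cf|exact: ch].
Qed.

Hypothesis bO : bounded_set O.

Lemma bounded_subset_compact (K : set 'rV[R]_d) :
  closed K -> K `<=` O -> compact K.
Proof.
move=> cK KO; apply: bounded_closed_compact => //.
have [M [Mreal hM]] := bO; exists M; split=> // x Mx y Ky.
by apply: (hM x Mx); exact: KO.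
Qed.

Lemma C00_bounded f : C00 O f -> exists2 M, 0 < M & forall x, `|f x| <= M.
Proof.
move=> [cf f0]; pose K := [set x | 1 <= `|f x|].
have cK : compact K.
  apply: bounded_subset_compact; last first.
    move=> x; rewrite /K /=; apply: contraPP => Ox; rewrite f0// normr0.
    by apply/negP; rewrite -ltNge ltr01.
  exact/closed_ge/continuous_abs_fun.
have /compact_bounded[M [Mreal hM]] : compact (f @` K).
  by apply: continuous_compact => //; exact: continuous_subspaceT.
exists (`|M| + 1) => [|x]; first by rewrite ltr_wpDl.
have [xK|xK] := lerP 1 `|f x|.
  apply: (hM (`|M| + 1)); first by rewrite (le_lt_trans (ler_norm _))// ltrDl.
  by exists x.
by rewrite (le_trans (ltW xK))// lerDr.
Qed.

(** The set where [F 0 >= e] is closed and lies in the bounded set [O], hence is compact; off it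
    monotonicity gives the bound for every index. *)
Lemma Dini (F : nat -> 'rV[R]_d -> R) : (forall n, C00 O (F n)) ->
  (forall m n x, (m <= n)%N -> F n x <= F m x) ->
  (forall x e, 0 < e -> exists n, F n x < e) ->
  forall e, 0 < e -> exists n, forall x, F n x < e.
Proof.
move=> CF dF F0 e e0; pose K := [set x | e <= F 0%N x].
have cK : compact K.
  apply: bounded_subset_compact.
    by apply: closed_ge; exact: (CF 0%N).1.
  move=> x; rewrite /K /=; apply: contraPP => Ox; rewrite (CF 0%N).2//.
  by apply/negP; rewrite -ltNge.
have : \forall n \near \oo, K `<=` [set x | F n x < e].
  move/compact_near_coveringP : cK => /(_ nat \oo (fun n x => F n x < e)).
  apply => x _; have [n nx] := F0 x e e0.
  exists ([set y | F n y < e], [set m | (n <= m)%N]) => /=.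
    split; last by exists n.
    by apply: open_nbhs_nbhs; split=> //; apply: open_lt; exact: (CF n).1.
  by move=> [y m] [/= yn nm]; exact: le_lt_trans (dF _ _ _ nm) yn.
move=> [n _ /(_ n (leqnn n)) Kn]; exists n => x.
have [xK|xK] := lerP e (F 0%N x); first exact: Kn.
exact: le_lt_trans (dF _ _ _ (leq0n _)) xK.
Qed.

End C00_theory.

(** * The Riesz representation theorem *)

Section measurable_continuous.
Context (R : realType) (d : nat).

Lemma continuous_measurable_rV (f : 'rV[R]_d -> R) :
  continuous f -> measurable_fun [set: 'rV[R]_d] f.
Proof.
move=> cf; apply: (measurability _ (RGenOpens.measurableE R)).
move=> _ [_ [a [b ->]] <-]; rewrite setTI; apply: open_measurable_mx.
by apply: open_comp; [move=> x _; exact: cf|exact: interval_open].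
Qed.

Lemma bounded_continuous_integrable (mu : {finite_measure set 'rV[R]_d -> \bar R})
    (f : 'rV[R]_d -> R) (M : R) :
  continuous f -> (forall x, `|f x| <= M) -> mu.-integrable setT (EFin \o f).
Proof.
move=> cf fM; apply: measurable_bounded_integrable => //.
- by rewrite ltey_eq fin_num_measure.
- exact: continuous_measurable_rV.
- by exists M; split; [exact: num_real|move=> x Mx y _ /=; rewrite (le_trans (fM y))// ltW].
Qed.

End measurable_continuous.

(** * Additive functionals on nonnegative functions and their level sets *)

Section additive_C00.
Context (R : realType) (d : nat) (O : set 'rV[R]_d).
Variable L : ('rV[R]_d -> R) -> R.

(** Functionals built as suprema, such as the positive part of a signed functional, are directly
    additive only on the nonnegative cone. Homogeneity is used for natural multiples alone, which
    additivity provides. *)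
Definition additive_C00 := forall f g, C00 O f -> C00 O g ->
  (forall x, 0 <= f x) -> (forall x, 0 <= g x) ->
  L (fun x => f x + g x) = L f + L g.

Hypothesis LD : additive_C00.

Lemma additive_C00_0 : L (fun=> 0) = 0.
Proof.
have := LD (C00_0 O) (C00_0 O) (fun=> lexx _) (fun=> lexx _).
under [in LHS]eq_fun do rewrite addr0.
by move/eqP; rewrite -subr_eq subrr eq_sym => /eqP.
Qed.

Lemma additive_C00_sum (f : nat -> 'rV[R]_d -> R) n : (forall i, C00 O (f i)) ->
  (forall i x, 0 <= f i x) ->
  L (fun x => \sum_(i < n) f i x) = \sum_(i < n) L (f i).
Proof.
move=> Cf f0; elim: n => [|n IH].
  by rewrite big_ord0 -[RHS]additive_C00_0; congr L; apply/funext => x; rewrite big_ord0.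
rewrite big_ord_recr/= -IH -LD//; last 2 first.
- exact: C00_sum.
- by move=> x; exact: sumr_ge0.
by congr L; apply/funext => x; rewrite big_ord_recr.
Qed.

Lemma additive_C00_natmul f n : C00 O f -> (forall x, 0 <= f x) ->
  L (fun x => n%:R * f x) = n%:R * L f.
Proof.
move=> Cf f0; have := @additive_C00_sum (fun=> f) n (fun=> Cf) (fun=> f0).
rewrite sumr_const card_ord mulr_natl => <-; congr L; apply/funext => x.
by rewrite sumr_const card_ord mulr_natl.
Qed.

(* The slices [min (max (f - j / n) 0) (1 / n)] of [f], scaled by [n], lie between
   the indicators of the level sets [f > (j + 1) / n] and [f > j / n]. *)
Lemma additive_C00_slices f n N (m : nat -> R) : (0 < n)%N ->
  C00 O f -> (forall x, 0 <= f x <= N%:R / n%:R) ->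
  (forall j g, C00 O g -> (forall x, 0 <= g x <= 1) ->
    (forall x, f x <= j%:R / n%:R -> g x = 0) -> L g <= m j) ->
  (forall j g, C00 O g -> (forall x, 0 <= g x) ->
    (forall x, j%:R / n%:R < f x -> 1 <= g x) -> m j <= L g) ->
  \sum_(j < N) m j.+1 <= n%:R * L f <= \sum_(j < N) m j.
Proof.
move=> n0 Cf fN mu ml.
have n0R : (0 : R) < n%:R by rewrite ltr0n.
pose s j x := Num.min (Num.max (f x - j%:R / n%:R) 0) (n%:R^-1).
have Cs j : C00 O (s j).
  split=> [|x Ox].
    apply: continuous_min_fun; last exact: cst_continuous.
    apply: continuous_max_fun; last exact: cst_continuous.
    by apply: continuousB_fun; [exact: Cf.1|exact: cst_continuous].
  rewrite /s Cf.2// sub0r max_r ?min_l ?invr_ge0 ?(ltW n0R)//.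
have s0 j x : 0 <= s j x.
  by rewrite /s le_min le_max lexx orbT/= invr_ge0 ltW.
have sE x : forall k, \sum_(j < k) s j x = Num.min (f x) (k%:R / n%:R).
  elim=> [|k IH]; first by rewrite big_ord0 mul0r min_r//; case/andP : (fN x).
  rewrite big_ord_recr/= IH /s -natr1 mulrDl mul1r.
  have nV : 0 < (n%:R : R)^-1 by rewrite invr_gt0.
  case: (lerP (f x) (k%:R / n%:R)) => h.
    rewrite max_r ?subr_le0// min_l ?(ltW nV)// addr0 min_l//.
    by rewrite (le_trans h)// lerDl ltW.
  rewrite max_l ?subr_ge0 ?(ltW h)//.
  case: (lerP (f x) (k%:R / n%:R + n%:R^-1)) => h'.
    by rewrite min_l ?lerBlDl// addrC subrK.
  by rewrite min_r// lerBrDl ltW.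
have -> : L f = \sum_(j < N) L (s j).
  rewrite -additive_C00_sum//; congr L; apply/funext => x; rewrite sE min_l//.
  by case/andP : (fN x).
rewrite mulr_sumr; apply/andP; split; apply: ler_sum => j _.
- rewrite -additive_C00_natmul//; apply: ml.
  + exact: C00Z.
  + by move=> x; rewrite mulr_ge0// ltW.
  + move=> x xj; rewrite mulrC -ler_pdivrMr// mul1r le_min lexx andbT le_max.
    by rewrite lerBrDl -[X in _ + X]mul1r -mulrDl natr1 ltW.
- rewrite -additive_C00_natmul//; apply: mu.
  + exact: C00Z.
  + move=> x; rewrite mulr_ge0 ?(ltW n0R)//= mulrC -ler_pdivlMr// mul1r.
    by rewrite /s ge_min lexx orbT.
  + move=> x xj; rewrite /s max_r ?subr_le0// min_l ?mulr0// invr_ge0 ltW//.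
Qed.

End additive_C00.

Section level_sets.
Context (R : realType) (d : nat) (O : set 'rV[R]_d).
Implicit Types (L : ('rV[R]_d -> R) -> R) (f g : 'rV[R]_d -> R) (m : R -> R).

(** [m c] plays the role of the mass that [L] gives to the set where [f > c]; it is squeezed by
    continuous functions, so that [L] is never evaluated at an indicator. *)
Definition level_bounds L f m :=
  (forall c g, 0 <= c -> C00 O g -> (forall x, 0 <= g x <= 1) ->
    (forall x, f x <= c -> g x = 0) -> L g <= m c) /\
  (forall c g, 0 <= c -> C00 O g -> (forall x, 0 <= g x) ->
    (forall x, c < f x -> 1 <= g x) -> m c <= L g).

Let ler_dist_bounds (p q r s k : R) :
  q <= r <= p -> q <= s <= p -> p - q <= k -> `|s - r| <= k.
Proof. by rewrite ler_norml => /andP[? ?] /andP[? ?] ?; apply/andP; split; lra. Qed.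

(** Layer-cake formula: for each [n], both [n L1 f] and [n L2 f] lie between the same two Riemann
    sums of [m]. Their difference telescopes to at most [K], so [L1 f] and [L2 f] differ by at most
    [K / n]. *)
Lemma level_bounds_eq L1 L2 f m K M : additive_C00 O L1 -> additive_C00 O L2 ->
  C00 O f -> (forall x, 0 <= f x <= M) -> (forall c, 0 <= c -> 0 <= m c <= K) ->
  level_bounds L1 f m -> level_bounds L2 f m -> L1 f = L2 f.
Proof.
move=> LD1 LD2 Cf fM mK [u1 l1] [u2 l2].
pose N n := (Num.truncn (M * n.+1%:R)).+1.
have fN n x : 0 <= f x <= (N n)%:R / n.+1%:R.
  have /andP[f0 fx] := fM x.
  by rewrite f0/= ler_pdivlMr ?ltr0n// (le_trans _ (ltW (truncnS_gt _)))// ler_wpM2r.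
pose mn n j := m (j%:R / n.+1%:R).
have c0 n j : 0 <= (j%:R / n.+1%:R : R) by rewrite divr_ge0.
have S1 n := additive_C00_slices (m := mn n) LD1 (ltn0Sn n) Cf (fN n)
  (fun j g => u1 _ g (c0 n j)) (fun j g => l1 _ g (c0 n j)).
have S2 n := additive_C00_slices (m := mn n) LD2 (ltn0Sn n) Cf (fN n)
  (fun j g => u2 _ g (c0 n j)) (fun j g => l2 _ g (c0 n j)).
have tele n : \sum_(j < N n) mn n j - \sum_(j < N n) mn n j.+1 <= K.
  rewrite -sumrB -(big_mkord xpredT (fun j => mn n j - mn n j.+1)).
  rewrite (@telescope_sumr_eq _ _ _ (fun j => - mn n j))//; last first.
    by move=> j _; rewrite opprK addrC.
  have /andP[_ h1] := mK _ (c0 n 0%N); have /andP[h2 _] := mK _ (c0 n (N n)).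
  by rewrite /mn; lra.
apply/eqP; rewrite -subr_eq0 -normr_eq0 eq_le normr_ge0 andbT.
apply/ler_addgt0Pr => e e0; rewrite add0r.
pose n := Num.truncn (K / e).
have nK : K < n.+1%:R * e by rewrite -ltr_pdivrMr// truncnS_gt.
rewrite -(@ler_pM2l _ n.+1%:R)// (le_trans _ (ltW nK))//.
rewrite -[X in X * _]ger0_norm// -normrM mulrBr.
exact: ler_dist_bounds (S2 n) (S1 n) (tele n).
Qed.

Lemma integral_additive_C00 (nu : {finite_measure set 'rV[R]_d -> \bar R}) :
  bounded_set O -> additive_C00 O (fun g => \int[nu]_x g x).
Proof.
move=> bO g h Cg Ch _ _; have [Mg _ gM] := C00_bounded bO Cg.
have [Mh _ hM] := C00_bounded bO Ch.
by rewrite RintegralD//; [apply: bounded_continuous_integrable gM; exact: Cg.1|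
  apply: bounded_continuous_integrable hM; exact: Ch.1].
Qed.

Lemma integral_level_bounds (nu : {finite_measure set 'rV[R]_d -> \bar R}) f :
  bounded_set O -> continuous f ->
  level_bounds (fun g => \int[nu]_x g x) f (fun c => fine (nu [set x | c < f x])).
Proof.
move=> bO cf.
have mset c : measurable [set x | c < f x] by apply: open_measurable_mx; exact: open_gt.
have mE c : ((fine (nu [set x | c < f x]))%:E =
    \int[nu]_x (\1_[set x | c < f x] x)%:E)%E.
  by rewrite integral_indic// setIT fineK// fin_num_measure.
have IE g : C00 O g -> ((\int[nu]_x g x)%:E = \int[nu]_x (g x)%:E)%E.
  move=> Cg; have [M _ gM] := C00_bounded bO Cg.
  rewrite /Rintegral fineK//; apply: integrable_fin_num => //.
  by apply: bounded_continuous_integrable gM; exact: Cg.1.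
split=> c g c0 Cg g1 gc; rewrite -lee_fin mE IE//.
  apply: ge0_le_integral => //.
  - by move=> x _; rewrite lee_fin; case/andP : (g1 x).
  - by apply/measurable_EFinP; apply: continuous_measurable_rV; exact: Cg.1.
  - by apply/measurable_EFinP; exact: measurable_indic.
  - move=> x _; rewrite lee_fin indicE.
    have [_|] := boolP (x \in [set z | c < f z]).
      by case/andP : (g1 x).
    by rewrite notin_setE/= => /negP; rewrite -leNgt => /gc ->.
apply: ge0_le_integral => //.
- by apply/measurable_EFinP; exact: measurable_indic.
- by apply/measurable_EFinP; apply: continuous_measurable_rV; exact: Cg.1.
- move=> x _; rewrite lee_fin indicE.
  have [|_] := boolP (x \in [set z | c < f z]); last exact: g1.
  by rewrite inE/= => /gc.
Qed.

End level_sets.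

(** * Positive functionals: construction of the measure *)

Section riesz_positive.
Local Open Scope ereal_scope.
Context (R : realType) (d : nat) (O : set 'rV[R]_d).
Variables (Lam : ('rV[R]_d -> R) -> R) (K : R).
Hypothesis bO : bounded_set O.
Hypothesis LamD : additive_C00 O Lam.
Hypothesis LamK : forall f c, C00 O f -> (forall x, 0 <= f x <= c)%R ->
  (0 <= Lam f <= K * c)%R.

Let Lam0 : Lam (fun=> 0%R) = 0%R := additive_C00_0 LamD.

Let LamK1 f : C00 O f -> (forall x, 0 <= f x)%R -> (0 <= Lam f)%R.
Proof.
move=> Cf f0; have [M M0 fM] := C00_bounded bO Cf.
have /andP[] // : (0 <= Lam f <= K * M)%R.
by apply: LamK => // x; rewrite f0 (le_trans (ler_norm _)).
Qed.

Let le_Lam f g : C00 O f -> C00 O g -> (forall x, 0 <= f x)%R ->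
  (forall x, f x <= g x)%R -> (Lam f <= Lam g)%R.
Proof.
move=> Cf Cg f0 fg.
rewrite (_ : g = fun x => f x + (g x - f x))%R; last first.
  by apply/funext => x; rewrite addrC subrK.
have Cgf : C00 O (fun x => g x - f x)%R by exact: C00B.
rewrite LamD//; last by move=> x; rewrite subr_ge0.
by rewrite lerDl LamK1// => x; rewrite subr_ge0.
Qed.

(** Competitors vanish off [U] instead of having compact support in [U]: they then form a class
    stable under the truncations below, and [Dini] supplies the compactness. *)
Let cls (U : set 'rV[R]_d) : set ('rV[R]_d -> R) :=
  [set f | [/\ C00 O f, forall x, (0 <= f x <= 1)%R & forall x, ~ U x -> f x = 0%R]].

Let muo U := ereal_sup [set (Lam f)%:E | f in cls U].

Let cls0 U : cls U (fun=> 0%R).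
Proof. by split=> //; [exact: C00_0|move=> x; rewrite lexx ler01]. Qed.

Let muo_ge0 U : 0 <= muo U.
Proof. by apply: ereal_sup_ubound; exists (fun=> 0%R); rewrite ?Lam0. Qed.

Let muo_leK U : muo U <= K%:E.
Proof.
apply: ge_ereal_sup => _ [f [Cf f1 _] <-]; rewrite lee_fin.
by have /andP[_] := LamK Cf f1; rewrite mulr1.
Qed.

Let muo_fin U : muo U \is a fin_num.
Proof. by rewrite ge0_fin_numE// (le_lt_trans (muo_leK U)) ?ltry. Qed.

Let le_muo U V : U `<=` V -> muo U <= muo V.
Proof.
move=> UV; apply: ereal_sup_le => _ [f [Cf f1 fU] <-].
by exists f => //; split=> // x Vx; apply: fU => /UV.
Qed.

(** A competitor [f] for the union is multiplied by [h n], a truncated finite sum of cutoffs. The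
    remainder [f * (1 - h n)] decreases to 0 pointwise, hence uniformly by [Dini], and [LamK] makes
    its contribution small. *)
Let muo_sub (U : (set 'rV[R]_d)^nat) : (forall n, open (U n)) ->
  muo (\bigcup_n U n) <= \sum_(i <oo) muo (U i).
Proof.
move=> oU; apply: ge_ereal_sup => _ [f [Cf f1 fU] <-].
have f0 x : (0 <= f x)%R by case/andP : (f1 x).
apply/lee_addgt0Pr => e e0.
have K0 : (0 <= K)%R.
  by have /andP[a b] := LamK Cf f1; rewrite -(mulr1 K) (le_trans a).
pose s n x := (\sum_(i < n) cutoff (U i) n x)%R.
pose h n x := Num.min 1%R (s n x).
have cs n : continuous (s n) by apply: continuous_sum_fun => i; exact: continuous_cutoff.
have ch n : continuous (h n) by apply: continuous_min_fun => //; exact: cst_continuous.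
have s0 n x : (0 <= s n x)%R by apply: sumr_ge0 => i _; exact: cutoff_ge0.
have h01 n x : (0 <= h n x <= 1)%R by rewrite le_min ler01 s0 ge_min lexx.
pose F n x := (f x * (1 - h n x))%R.
have CF n : C00 O (F n).
  apply: C00Mr => //; apply: continuousB_fun => //; exact: cst_continuous.
have snd m n x : (m <= n)%N -> (s m x <= s n x)%R.
  move=> mn; rewrite /s -(big_mkord xpredT (fun i => cutoff (U i) m x)).
  rewrite -(big_mkord xpredT (fun i => cutoff (U i) n x)).
  rewrite [leRHS](big_cat_nat (leq0n m) mn)//= ler_wpDr//; first by apply: sumr_ge0 => i _; exact: cutoff_ge0.
  by apply: ler_sum => i _; exact: cutoff_nd.
have FF m n x : (m <= n)%N -> (F n x <= F m x)%R.
  move=> mn; rewrite ler_wpM2l// lerB// le_min ge_min lexx/= ge_min.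
  by rewrite snd// orbT.
have F0 x a : (0 < a)%R -> exists n, (F n x < a)%R.
  move=> a0; have [[i _ Uix]|Ux] := pselect ((\bigcup_n U n) x); last first.
    by exists 0%N; rewrite /F fU// mul0r.
  have [N hN] := cutoff_eq1 (oU i) Uix.
  (* The index must be large enough for the cutoff of [U i] to equal 1 at [x] and for [i] to enter
     the sum. *)
  exists (maxn N i.+1); rewrite /F (_ : h _ x = 1%R) ?subrr ?mulr0//.
  rewrite /h min_l//; have iN : (i < maxn N i.+1)%N by rewrite leq_max ltnSn orbT.
  rewrite /s (bigD1 (Ordinal iN))//= hN ?leq_maxl//.
  by rewrite lerDl; apply: sumr_ge0 => j _; exact: cutoff_ge0.
have K1 : (0 < K + 1)%R by rewrite ltr_wpDl.
have [n nF] := Dini bO CF FF F0 (divr_gt0 e0 K1).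
have Fn0 x : (0 <= F n x)%R.
  by rewrite mulr_ge0// subr_ge0; case/andP : (h01 n x).
have LF : (Lam (F n) <= e)%R.
  have /andP[_ /le_trans->//] : (0 <= Lam (F n) <= K * (e / (K + 1)))%R.
    by apply: LamK => // x; rewrite Fn0 ltW.
  rewrite mulrCA -[leRHS]mulr1 ler_wpM2l ?(ltW e0)//.
  by rewrite ler_pdivrMr// mul1r lerDl.
have Cfh : C00 O (fun x => f x * h n x)%R by exact: C00Mr.
have fh0 x : (0 <= f x * h n x)%R by rewrite mulr_ge0//; case/andP : (h01 n x).
rewrite (_ : f = fun x => f x * h n x + F n x)%R; last first.
  by apply/funext => x; rewrite /F; ring.
rewrite LamD// EFinD leeD ?lee_fin//.
pose g i x := (f x * cutoff (U i) n x)%R.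
have Cg i : C00 O (g i) by apply: C00Mr => //; exact: continuous_cutoff.
have g0 i x : (0 <= g i x)%R by rewrite mulr_ge0// cutoff_ge0.
apply: (@le_trans _ _ (\sum_(i < n) muo (U i))); last first.
  rewrite -(big_mkord xpredT (fun i => muo (U i))).
  exact: (@nneseries_lim_ge _ _ xpredT).
apply: (@le_trans _ _ (\sum_(i < n) Lam (g i))%R%:E).
  rewrite lee_fin -(additive_C00_sum LamD)//; apply: le_Lam => //; first exact: C00_sum.
  by move=> x; rewrite -mulr_sumr ler_wpM2l// ge_min lexx orbT.
rewrite -sumEFin; apply: lee_sum => i _; apply: ereal_sup_ubound.
exists (g i) => //; split=> // x.
  rewrite g0/=; have /andP[_ fx] := f1 x.
  by rewrite (le_trans (ler_wpM2l (f0 x) (cutoff_le1 _ _ _)))// mulr1.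
by move=> Ux; rewrite /g cutoff_out// mulr0.
Qed.

Let mus (A : set 'rV[R]_d) : \bar R := ereal_inf [set muo U | U in [set U | open U /\ A `<=` U]].

Let mus0 : mus set0 = 0.
Proof.
apply/eqP; rewrite eq_le; apply/andP; split.
  apply: (@le_trans _ _ (muo set0)).
    by apply: ereal_inf_lbound; exists set0 => //; split=> //; exact: open0.
  apply: ge_ereal_sup => _ [f [Cf _ f0] <-].
  by rewrite (_ : f = fun=> 0%R) ?Lam0//; apply/funext => x; rewrite f0.
by apply: le_ereal_inf_tmp => _ [U _ <-].
Qed.

Let mus_ge0 A : 0 <= mus A.
Proof. by apply: le_ereal_inf_tmp => _ [U _ <-]. Qed.

Let le_mus : {homo mus : A B / A `<=` B >-> A <= B}.
Proof.
move=> A B AB; apply: le_ereal_inf_tmp => _ [U [oU BU] <-].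
by apply: ereal_inf_lbound; exists U => //; split=> //; exact: subset_trans BU.
Qed.

Let mus_open U : open U -> mus U = muo U.
Proof.
move=> oU; apply/eqP; rewrite eq_le; apply/andP; split.
  by apply: ereal_inf_lbound; exists U => //; split.
by apply: le_ereal_inf_tmp => _ [V [oV UV] <-]; exact: le_muo.
Qed.

Let mus_fin A : mus A \is a fin_num.
Proof.
rewrite ge0_fin_numE// (@le_lt_trans _ _ K%:E) ?ltry//.
apply: (@le_trans _ _ (muo setT)) => //.
by apply: ereal_inf_lbound; exists setT => //; split=> //; exact: openT.
Qed.

Let mus_sub : sigma_subadditive mus.
Proof.
move=> A; apply/lee_addgt0Pr => e e0.
rewrite (le_trans _ (epsilon_trick _ _ (ltW e0)))//.
have /choice[U hU] n : exists U, [/\ open U, A n `<=` U &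
    muo U <= mus (A n) + (e / (2 ^ n.+1)%:R)%:E].
  have en : (0 < e / (2 ^ n.+1)%:R)%R by rewrite divr_gt0// ltr0n expn_gt0.
  have [_ [U [oU AU] <-] /ltW h] := lb_ereal_inf_adherent en (mus_fin (A n)).
  by exists U.
apply: (@le_trans _ _ (muo (\bigcup_n U n))).
  apply: ereal_inf_lbound; exists (\bigcup_n U n) => //; split.
    by apply: bigcup_open => i _; case: (hU i).
  by apply: subset_bigcup => i _; case: (hU i).
apply: (le_trans (muo_sub _)); first by move=> n; case: (hU n).
by apply: lee_nneseries => // i _; case: (hU i).
Qed.

HB.instance Definition _ :=
  isOuterMeasure.Build R _ mus mus0 mus_ge0 le_mus mus_sub.

Let Lam_trunc f e : C00 O f -> (forall x, 0 <= f x)%R -> (0 <= e)%R ->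
  (Lam f <= Lam (fun x => Num.max (f x - e) 0) + K * e)%R.
Proof.
move=> Cf f0 e0.
have C1 : C00 O (fun x => Num.max (f x - e) 0)%R.
  split=> [|x Ox]; last by rewrite Cf.2// sub0r max_r// oppr_le0.
  apply: continuous_max_fun; last exact: cst_continuous.
  by apply: continuousB_fun; [exact: Cf.1|exact: cst_continuous].
have C2 : C00 O (fun x => Num.min (f x) e)%R.
  split=> [|x Ox]; last by rewrite Cf.2// min_l.
  by apply: continuous_min_fun; [exact: Cf.1|exact: cst_continuous].
rewrite {1}(_ : f = fun x => Num.max (f x - e) 0 + Num.min (f x) e)%R; last first.
  apply/funext => x; case: (lerP (f x) e) => h.
    by rewrite max_r ?subr_le0// add0r.
  by rewrite max_l ?subr_ge0 ?ltW// subrK.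
rewrite LamD//; last 2 first.
- by move=> x; rewrite le_max lexx orbT.
- by move=> x; rewrite le_min f0.
rewrite lerD2l.
have /andP[]// : (0 <= Lam (fun x => Num.min (f x) e) <= K * e)%R.
by apply: LamK => // x; rewrite le_min f0 e0 ge_min lexx orbT.
Qed.

Let K_ge0 : (0 <= K)%R.
Proof.
have /andP[a] := @LamK _ 1%R (C00_0 O) (fun=> introT andP (conj (lexx _) ler01)).
by rewrite mulr1; exact: le_trans.
Qed.

(** Caratheodory's inequality on an open test set. For a competitor [f] of [V] and [U] intersected,
    the part of [f] above [e'] vanishes on the open set [W] of points of [V] where [f < e']. Since
    [W] contains [V] minus [U], any competitor for [W] can be added to that part without exceeding
    1; removing the slice below [e'] costs at most [K e']. *)
Let muo_split U V : open U -> open V -> muo (V `&` U) + mus (V `\` U) <= muo V.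
Proof.
move=> oU oV; rewrite -leeBrDr//; apply: ge_ereal_sup => _ [f [Cf f1 fU] <-].
have f0 x : (0 <= f x)%R by case/andP : (f1 x).
rewrite leeBrDr//; apply/lee_addgt0Pr => e e0.
pose e' := (e / (K + 1))%R.
have K1 : (0 < K + 1)%R by rewrite ltr_wpDl.
have e'0 : (0 < e')%R by rewrite divr_gt0.
pose W := V `&` [set x | (f x < e')%R].
have oW : open W by apply: openI => //; apply: open_lt; exact: Cf.1.
have sW : V `\` U `<=` W.
  by move=> x [Vx Ux]; split=> //=; rewrite fU// => -[].
pose fe x := Num.max (f x - e')%R 0%R.
have Cfe : C00 O fe.
  split=> [|x Ox]; last by rewrite /fe Cf.2// sub0r max_r// oppr_le0 ltW.
  apply: continuous_max_fun; last exact: cst_continuous.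
  by apply: continuousB_fun; [exact: Cf.1|exact: cst_continuous].
have fe0 x : (0 <= fe x)%R by rewrite /fe le_max lexx orbT.
apply: (@le_trans _ _ ((Lam fe)%:E + muo W + e%:E)).
  rewrite -addeA [X in _ <= _ + X]addeC addeA -EFinD leeD//; last first.
    by rewrite -mus_open//; exact: le_mus.
  rewrite lee_fin (le_trans (Lam_trunc Cf f0 (ltW e'0)))// lerD2l.
  by rewrite /e' mulrCA -[leRHS]mulr1 ler_wpM2l ?(ltW e0)// ler_pdivrMr// mul1r lerDl.
rewrite leeD2r// -leeBrDl//; apply: ge_ereal_sup => _ [g [Cg g1 gW] <-].
have g0 x : (0 <= g x)%R by case/andP : (g1 x).
rewrite leeBrDl// -EFinD -LamD//.
apply: ereal_sup_ubound; exists (fun x => fe x + g x)%R => //.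
split=> [|x|x Vx]; first exact: C00D.
- rewrite addr_ge0//=; have [fx|fx] := ltP (f x) e'.
    have -> : fe x = 0%R by rewrite /fe max_r// subr_le0 ltW.
    by rewrite add0r; case/andP : (g1 x).
  rewrite gW ?addr0; last by move=> [_ /=]; rewrite ltNge fx.
  rewrite /fe ge_max ler01 andbT lerBlDr.
  by have /andP[_ h] := f1 x; rewrite (le_trans h)// lerDl ltW.
- rewrite gW; last by case.
  by rewrite addr0 /fe fU ?sub0r ?max_r ?oppr_le0 ?ltW// => -[].
Qed.

Let caratheodory_open U : open U -> mus.-caratheodory U.
Proof.
move=> oU; apply: le_caratheodory_measurable => X.
apply: le_ereal_inf_tmp => _ [V [oV XV] <-].
apply: le_trans (muo_split oU oV); rewrite -mus_open; last exact: openI.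
by rewrite leeD// le_mus//; [exact: setSI|exact: setSI].
Qed.

Let mus_cara (A : set 'rV[R]_d) : measurable A -> mus.-caratheodory A.
Proof.
move: A; apply: smallest_sub => [|U]; last exact: caratheodory_open.
split.
- exact: caratheodory_measurable_set0.
- by move=> A mA; rewrite setTD; exact: caratheodory_measurable_setC.
- exact: caratheodory_measurable_bigcup.
Qed.

Let mu_ : set 'rV[R]_d -> \bar R := mus.

Let mu_sigma_additive : semi_sigma_additive mu_.
Proof.
move=> F mF tF mUF.
exact: (@caratheodory_measure_sigma_additive _ _ mus _ (fun n => mus_cara (mF n)) tF (mus_cara mUF)).
Qed.

HB.instance Definition _ := isMeasure.Build _ _ _ mu_ mus0 mus_ge0 mu_sigma_additive.

Lemma riesz_C00_positive : open O ->
  exists nu : {finite_measure set 'rV[R]_d -> \bar R},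
    (forall A, measurable A -> A `&` O = set0 -> nu A = 0) /\
    forall f, C00 O f -> (forall x, 0 <= f x)%R -> (\int[nu]_x f x = Lam f)%R.
Proof.
move=> oO; have mO : measurable O by exact: open_measurable_mx.
pose rho := mrestr (mu_ : {measure set _ -> \bar R}) mO.
have finrho : fin_num_fun rho by move=> A mA; exact: mus_fin.
pose nuM := isFinite.Build _ _ _ rho finrho.
pose nu : {finite_measure set 'rV[R]_d -> \bar R} :=
  HB.pack rho (@Measure_isFinite.Build _ _ _ rho finrho).
exists nu; split=> [A mA AO|f Cf f0].
  by rewrite /nu/= /rho /mrestr AO; exact: mus0.
have [M M0 fM] := C00_bounded bO Cf.
have nuE c : (0 <= c)%R -> nu [set x | (c < f x)%R] = muo [set x | (c < f x)%R].
  move=> c0; rewrite /nu/= /rho /mrestr /= (_ : _ `&` O = [set x | (c < f x)%R]).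
    by rewrite /mu_ mus_open//; apply: open_gt; exact: Cf.1.
  apply/seteqP; split=> [x []//|x /= cx]; split=> //.
  by apply: contrapT => Ox; move: cx; rewrite Cf.2// ltNge c0.
(* By [nuE] the same numbers are level bounds for the integral, as masses, and for [Lam], as
   suprema. *)
apply: (@level_bounds_eq _ _ O (fun g => (\int[nu]_x g x)%R) Lam f
  (fun c => fine (nu [set x | (c < f x)%R])) K M) => //.
- exact: integral_additive_C00.
- by move=> x; rewrite f0/= (le_trans (ler_norm _)).
- by move=> c c0; rewrite nuE// -!lee_fin fineK// muo_ge0 muo_leK.
- by apply: integral_level_bounds => //; exact: Cf.1.
split=> c g c0 Cg g1 gc; rewrite nuE// -lee_fin fineK//.
  apply: ereal_sup_ubound; exists g => //; split=> // x /= /negP.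
  by rewrite -leNgt => /gc.
apply: ge_ereal_sup => _ [h [Ch h1 hc] <-]; rewrite lee_fin le_Lam//.
  by move=> x; case/andP : (h1 x).
move=> x; have [/gc|xc] := ltP c (f x).
  by apply: le_trans; case/andP : (h1 x).
by rewrite hc ?g1// /= ltNge xc.
Qed.

End riesz_positive.

(** * Integration against a charge *)

Section charge_integral.
Context (R : realType) (d : nat).
Implicit Types (mu : {charge set 'rV[R]_d -> \bar R}) (f g : 'rV[R]_d -> R).

Let fin_num_addE (p n a b : \bar R) : p \is a fin_num -> n \is a fin_num ->
  a \is a fin_num -> b \is a fin_num -> (p - n = a - b)%E -> (p + b = a + n)%E.
Proof.
move: p n a b => [p| |] [n| |] [a| |] [b| |]// _ _ _ _ [] H.
by congr EFin; lra.
Qed.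

Definition charge_posm mu : {finite_measure set 'rV[R]_d -> \bar R} := charge_pos mu.
Definition charge_negm mu : {finite_measure set 'rV[R]_d -> \bar R} := charge_neg mu.

Lemma charge_decomp mu A : measurable A ->
  mu A = (charge_posm mu A - charge_negm mu A)%E.
Proof.
move=> mA; rewrite (jordan_decomp (svalP (hahn mu)) mA).
have -> : forall m1 m2 : {charge set 'rV[R]_d -> \bar R},
    cadd m1 (cscale (-1) m2) A = (m1 A + (-1)%:E * m2 A)%E by [].
by rewrite EFinN mulN1e.
Qed.

(** [charge_int] is defined through a chosen Hahn decomposition; this frees it from that choice.
    Moving the subtracted measures to the other side leaves two sums of finite measures that agree
    on all measurable sets. *)
Lemma charge_int_diff mu (m1 m2 : {finite_measure set 'rV[R]_d -> \bar R}) f M :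
  (forall A, measurable A -> mu A = (m1 A - m2 A)%E) ->
  continuous f -> (forall x, `|f x| <= M) ->
  charge_int mu f = \int[m1]_x f x - \int[m2]_x f x.
Proof.
move=> muE cf fM.
have intf (m : {finite_measure set 'rV[R]_d -> \bar R}) :
  m.-integrable setT (EFin \o f) by exact: bounded_continuous_integrable fM.
have := @eq_measure_integral _ _ R setT (measure_add m1 (charge_negm mu))
  (measure_add (charge_posm mu) m2) (EFin \o f).
rewrite !integral_measure_add//; last 4 first; do 4?exact: intf.
have h A : measurable A -> A `<=` setT ->
    measure_add (charge_posm mu) m2 A = measure_add m1 (charge_negm mu) A.
  move=> mA _; rewrite !measure_addE; apply: fin_num_addE; do ?exact: fin_num_measure.
  by rewrite -charge_decomp// muE.
move=> /(_ h) /(congr1 fine).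
have fin (m : {finite_measure set 'rV[R]_d -> \bar R}) :
    (\int[m]_x (EFin \o f) x)%E \is a fin_num by apply: integrable_fin_num => //; exact: intf.
rewrite (fineD (fin _) (fin _)) (fineD (fin _) (fin _)).
by move=> /eqP; rewrite -subr_eq addrAC eq_sym -subr_eq eq_sym => /eqP.
Qed.

Lemma charge_intE mu f : charge_int mu f =
  \int[charge_posm mu]_x f x - \int[charge_negm mu]_x f x.
Proof. by []. Qed.

Lemma charge_int_lin mu a f g Mf Mg :
  continuous f -> (forall x, `|f x| <= Mf) ->
  continuous g -> (forall x, `|g x| <= Mg) ->
  charge_int mu (fun x => a * f x + g x) = a * charge_int mu f + charge_int mu g.
Proof.
move=> cf fM cg gM; rewrite !charge_intE.
have intf (m : {finite_measure set 'rV[R]_d -> \bar R}) :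
  m.-integrable setT (EFin \o f) by exact: bounded_continuous_integrable fM.
have intg (m : {finite_measure set 'rV[R]_d -> \bar R}) :
  m.-integrable setT (EFin \o g) by exact: bounded_continuous_integrable gM.
have key (m : {finite_measure set 'rV[R]_d -> \bar R}) :
    \int[m]_x (a * f x + g x) = a * \int[m]_x f x + \int[m]_x g x.
  rewrite RintegralD//; last 2 first.
  - apply: (@bounded_continuous_integrable _ _ m _ (`|a| * Mf)).
      by apply: continuousM_fun => //; exact: cst_continuous.
    by move=> x; rewrite normrM ler_wpM2l.
  - exact: intg.
  by rewrite RintegralZl//; exact: intf.
by rewrite !key; ring.
Qed.

Definition charge_tv mu : R :=
  fine (charge_posm mu setT) + fine (charge_negm mu setT).

Lemma charge_tv_ge0 mu : 0 <= charge_tv mu.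
Proof. by rewrite addr_ge0// fine_ge0. Qed.

Lemma le_charge_int mu f M : continuous f -> (forall x, `|f x| <= M) ->
  `|charge_int mu f| <= charge_tv mu * M.
Proof.
move=> cf fM; rewrite charge_intE (le_trans (ler_normB _ _))// mulrDl.
have key (m : {finite_measure set 'rV[R]_d -> \bar R}) :
    `|\int[m]_x f x| <= fine (m setT) * M.
  have intf : m.-integrable setT (EFin \o f).
    exact: bounded_continuous_integrable fM.
  apply: (le_trans (le_normr_Rintegral _ intf)) => //.
  rewrite mulrC -Rintegral_cst//.
  apply: le_Rintegral => //.
    apply: (@bounded_continuous_integrable _ _ m _ M).
      exact: continuous_abs_fun.
    by move=> x; rewrite normr_id.
  by apply: (@bounded_continuous_integrable _ _ m _ `|M|) => //; exact: cst_continuous.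
by rewrite lerD.
Qed.

Lemma charge_of_diff (m1 m2 : {finite_measure set 'rV[R]_d -> \bar R}) :
  exists mu, forall A, measurable A -> mu A = (m1 A - m2 A)%E.
Proof.
exists (cadd (charge_of_finite_measure m1) (cscale (-1) (charge_of_finite_measure m2))).
move=> A mA; transitivity (m1 A + (-1)%:E * m2 A)%E; first by [].
by rewrite EFinN mulN1e.
Qed.

End charge_integral.

(** * Signed functionals *)

Section riesz_signed.
Context (R : realType) (d : nat) (O : set 'rV[R]_d).
Variables (U : ('rV[R]_d -> R) -> R) (K : R).
Hypothesis (bO : bounded_set O) (oO : open O).
Hypothesis Ulin : forall a f g, C00 O f -> C00 O g ->
  U (fun x => a * f x + g x) = a * U f + U g.
Hypothesis UK : forall f c, C00 O f -> (forall x, `|f x| <= c) -> `|U f| <= K * c.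

Let UD f g : C00 O f -> C00 O g -> U (fun x => f x + g x) = U f + U g.
Proof.
move=> Cf Cg; have := Ulin 1 Cf Cg; rewrite mul1r => <-.
by congr U; apply/funext => x; rewrite mul1r.
Qed.

Let UB f g : C00 O f -> C00 O g -> U (fun x => f x - g x) = U f - U g.
Proof.
move=> Cf Cg; have := Ulin (-1) Cg Cf; rewrite mulN1r addrC => <-.
by congr U; apply/funext => x; rewrite mulN1r addrC.
Qed.

Let below f : set R :=
  [set U g | g in [set g | C00 O g /\ forall x, 0 <= g x <= f x]].

Let below_ub f c : (forall x, 0 <= f x <= c) -> forall y, below f y -> y <= K * c.
Proof.
move=> fc _ [g [Cg gf] <-]; rewrite (le_trans (ler_norm _))// UK// => x.
have /andP[g0 gfx] := gf x; have /andP[_ fxc] := fc x.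
by rewrite ger0_norm// (le_trans gfx).
Qed.

Let U0 : U (fun=> 0) = 0.
Proof.
by have := UB (C00_0 O) (C00_0 O); under [in LHS]eq_fun do rewrite subrr; rewrite subrr.
Qed.

Let below0 f : (forall x, 0 <= f x) -> below f 0.
Proof.
by move=> f0; exists (fun=> 0); rewrite ?U0//; split=> [|x]; [exact: C00_0|rewrite lexx f0].
Qed.

Let has_sup_below f : C00 O f -> (forall x, 0 <= f x) -> has_sup (below f).
Proof.
move=> Cf f0; split; first by exists 0; exact: below0.
have [M M0 fM] := C00_bounded bO Cf.
exists (K * M) => y; apply: below_ub => x.
by rewrite f0 (le_trans (ler_norm _)).
Qed.

(** The positive part of [U] in the order dual of the lattice C^0_0. *)
Let Up f := sup (below f).

Let Up_ge f g : C00 O f -> C00 O g -> (forall x, 0 <= g x <= f x) -> U g <= Up f.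
Proof.
move=> Cf Cg gf; apply: (sup_upper_bound (has_sup_below Cf _)); last by exists g.
by move=> x; have /andP[] := gf x; exact: le_trans.
Qed.

Let UpD : additive_C00 O Up.
Proof.
move=> f g Cf Cg f0 g0; apply/eqP; rewrite eq_le; apply/andP; split.
  apply: ge_sup.
    by exists 0; apply: below0 => x; exact: addr_ge0.
  move=> _ [h [Ch hfg] <-].
  (* Riesz decomposition: a function below [f + g] is the sum of one below [f] and one below [g]. *)
  pose h1 x := Num.min (h x) (f x).
  have Ch1 : C00 O h1 by exact: C00_min.
  have Ch2 : C00 O (fun x => h x - h1 x) by exact: C00B.
  rewrite (_ : U h = U h1 + U (fun x => h x - h1 x)); last first.
    by rewrite -UD//; congr U; apply/funext => x; rewrite addrC subrK.
  apply: lerD; apply: Up_ge => // x; have /andP[h0 hx] := hfg x.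
    by rewrite /h1 le_min h0 f0 ge_min lexx orbT.
  rewrite /h1; case: (lerP (h x) (f x)) => hf; first by rewrite subrr lexx g0.
  by rewrite subr_ge0 (ltW hf) lerBlDl.
rewrite -lerBrDr; apply: ge_sup; first by exists 0; exact: below0.
move=> _ [a [Ca af] <-]; rewrite lerBrDr -lerBrDl.
apply: ge_sup; first by exists 0; exact: below0.
move=> _ [b [Cb bg] <-]; rewrite lerBrDl -UD//; apply: Up_ge => //; do ?exact: C00D.
move=> x; have /andP[a0 ax] := af x; have /andP[b0 bx] := bg x.
by rewrite addr_ge0// lerD.
Qed.

Let UpK f c : C00 O f -> (forall x, 0 <= f x <= c) -> 0 <= Up f <= K * c.
Proof.
move=> Cf fc; have f0 x : 0 <= f x by case/andP : (fc x).
apply/andP; split.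
  by apply: (sup_upper_bound (has_sup_below Cf f0)); exact: below0.
by apply: ge_sup; [exists 0; exact: below0|exact: below_ub].
Qed.

Let Um f := Up f - U f.

Let UmD : additive_C00 O Um.
Proof. by move=> f g Cf Cg f0 g0; rewrite /Um UpD// UD//; ring. Qed.

Let UmK f c : C00 O f -> (forall x, 0 <= f x <= c) -> 0 <= Um f <= (K + K) * c.
Proof.
move=> Cf fc; have /andP[u1 u2] := UpK Cf fc.
have f0 x : 0 <= f x by case/andP : (fc x).
have : `|U f| <= K * c.
  by apply: UK => // x; rewrite ger0_norm//; case/andP : (fc x).
rewrite ler_norml => /andP[h1 h2].
rewrite /Um subr_ge0 Up_ge//=; last by move=> x; rewrite f0 lexx.
lra.
Qed.

Theorem riesz_C00 : exists mu : {charge set 'rV[R]_d -> \bar R},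
  measures_on O mu /\ forall f, C00 O f -> charge_int mu f = U f.
Proof.
have [m1 [m1O m1E]] := riesz_C00_positive bO UpD UpK oO.
have [m2 [m2O m2E]] := riesz_C00_positive bO UmD UmK oO.
have [mu muE] := charge_of_diff m1 m2.
exists mu; split=> [A mA AO|f Cf]; first by rewrite muE// m1O// m2O// sube0.
have pos g : C00 O g -> (forall x, 0 <= g x) -> charge_int mu g = U g.
  move=> Cg g0; have [M M0 gM] := C00_bounded bO Cg.
  rewrite (charge_int_diff muE Cg.1 gM) m1E// m2E// /Um; ring.
pose fp x := Num.max (f x) 0; pose fm x := Num.max (- f x) 0.
have Cfp : C00 O fp by apply: C00_max => //; exact: C00_0.
have Cfm : C00 O fm by apply: C00_max; [exact: C00N|exact: C00_0].
have fE : f = fun x => -1 * fm x + fp x.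
  apply/funext => x; rewrite /fm /fp mulN1r.
  case: (leP 0 (f x)) => h; first by rewrite max_r ?oppr_le0// oppr0 add0r.
  by rewrite max_l ?oppr_ge0 ?ltW// opprK addr0.
have [Mp _ fpM] := C00_bounded bO Cfp; have [Mm _ fmM] := C00_bounded bO Cfm.
rewrite fE (charge_int_lin _ _ Cfm.1 fmM Cfp.1 fpM) Ulin// !pos//.
- by move=> x; rewrite le_max lexx orbT.
- by move=> x; rewrite le_max lexx orbT.
Qed.

End riesz_signed.

(** * Density of C^1_c in C^0_0 *)

Section directional_derivatives.
Context (R : realType).

Lemma is_derive_line (V W : normedModType R) (f : V -> W) (x v : V) (c : W) :
  is_derive x v f c <-> is_derive (0 : R) 1 (fun h : R => f (h *: v + x)) c.
Proof.
have E : (fun h : R => h^-1 *: ((f \o shift x) (h *: v) - f x)) =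
    (fun h : R => h^-1 *:
      (((fun h : R => f (h *: v + x)) \o shift 0) (h *: 1) - f (0 *: v + x))).
  by apply/funext => h /=; rewrite addr0 scale0r add0r [_%:A]mulr1.
split=> -[df vf]; split.
- exact/(derivable1P _ _ _).1.
- by rewrite -vf /derive E.
- exact/(derivable1P _ _ _).2.
- by rewrite -vf /derive E.
Qed.

Lemma is_derive_comp (V : normedModType R) (h : R -> R) (f : V -> R) (x v : V)
    (a b : R) : is_derive (f x) 1 h a -> is_derive x v f b ->
  is_derive x v (fun y => h (f y)) (a * b).
Proof.
move=> dh /is_derive_line df; apply/is_derive_line.
apply: (is_derive1_comp (f := h) (g := fun t : R => f (t *: v + x))) => //.
by rewrite scale0r add0r.
Qed.

Lemma is_derive_mul (V : normedModType R) (f g : V -> R) (x v : V) (a b : R) :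
  is_derive x v f a -> is_derive x v g b ->
  is_derive x v (fun y => f y * g y) (f x * b + g x * a).
Proof.
move=> df dg; rewrite (_ : (fun y => _) = f * g); last exact/funext.
by have := is_deriveM df dg.
Qed.

(** One criterion for all the derivatives computed by hand: affine functions with [K = 0], squares
    of positive parts, and the regularized conjugate, which is trapped between a tangent line and a
    parabola. *)
Lemma is_derive_quadratic (f : R -> R) (t c K : R) :
  (forall h, `|f (h + t) - f t - c * h| <= K * h ^+ 2) -> is_derive t 1 f c.
Proof.
move=> H.
have K0 : 0 <= K by rewrite -[K]mulr1 -(expr1n R 2); exact: le_trans (H 1).
have K1 : 0 < K + 1 by rewrite ltr_wpDl.
have cv : h^-1 *: ((f \o shift t) (h *: (1 : R)) - f t) @[h --> 0^'] --> c.
  apply/cvgrPdist_lt => e e0; near=> h.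
  have h0 : h != 0 by near: h; exact: nbhs_dnbhs_neq.
  have hn : 0 < `|h| by rewrite normr_gt0.
  rewrite /= [_%:A]mulr1 distrC -(@ltr_pM2l _ `|h|)// -normrM mulrBr.
  rewrite /GRing.scale/= mulrA divff// mul1r [h * c]mulrC.
  rewrite (le_lt_trans (H h))// -[h ^+ 2]ger0_norm ?sqr_ge0// normrX expr2.
  rewrite mulrCA ltr_pM2l//.
  rewrite (@le_lt_trans _ _ ((K + 1) * `|h|))//; first by rewrite ler_pM2r// lerDl.
  rewrite mulrC -ltr_pdivlMr//; near: h; apply: dnbhs0_lt.
  by rewrite divr_gt0.
split; last exact: cvg_lim cv.
by apply/cvg_ex; exists c.
Unshelve. all: by end_near. Qed.

End directional_derivatives.

Section C1_functions.
Context (R : realType) (d : nat).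
Implicit Types (f : 'rV[R]_d -> R) (g : 'I_d -> 'rV[R]_d -> R).

(** With the gradient as an argument, products and compositions yield it explicitly, and [Ck 1] and
    [partial] are recovered at the end. *)
Definition C1_grad f g := [/\ continuous f, forall i, continuous (g i) &
  forall i x, is_derive x (delta_mx ord0 i) f (g i x)].

Lemma C1_gradP f : Ck 1 f <-> C1_grad f (fun i => partial i f).
Proof.
split=> [[cf df]|[cf cg dg]].
  split=> // [i|i x]; first by case: (df i) => _ [].
  by split=> //; exact: (df i).1.
apply: conj; first exact: cf.
move=> i; apply: conj => [x|]; first by case: (dg i x).
by apply: conj; [exact: cg|].
Qed.

Lemma C1_grad_Ck1 f g : C1_grad f g -> Ck 1 f.
Proof.
move=> [cf cg dg]; apply/C1_gradP.
have -> : (fun i => partial i f) = g by apply/funext => i; apply/funext => x; have [] := dg i x.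
by split.
Qed.

Lemma C1_grad_partial f g i : C1_grad f g -> partial i f = g i.
Proof. by move=> [cf cg dg]; apply/funext => x; have [] := dg i x. Qed.

Lemma C1_grad_comp (h h' : R -> R) f g : C1_grad f g ->
  (forall t : R, is_derive t 1 h (h' t)) -> continuous h' ->
  C1_grad (fun x => h (f x)) (fun i x => h' (f x) * g i x).
Proof.
move=> [cf cg dg] dh ch'; split.
- move=> x; apply: continuous_comp; first exact: cf.
  by apply/differentiable_continuous/derivable1_diffP; case: (dh (f x)).
- move=> i; apply: continuousM_fun => // x.
  by apply: continuous_comp; [exact: cf|exact: ch'].
- by move=> i x; exact: is_derive_comp.
Qed.

Lemma C1_grad_mul f1 g1 f2 g2 : C1_grad f1 g1 -> C1_grad f2 g2 ->
  C1_grad (fun x => f1 x * f2 x) (fun i x => f1 x * g2 i x + f2 x * g1 i x).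
Proof.
move=> [cf1 cg1 dg1] [cf2 cg2 dg2]; split.
- exact: continuousM_fun.
- by move=> i; apply: continuousD_fun; exact: continuousM_fun.
- by move=> i x; exact: is_derive_mul.
Qed.

Lemma C1_grad_cst (c : R) : C1_grad (fun=> c) (fun _ _ => 0).
Proof.
split=> [|i|i x]; [exact: cst_continuous|exact: cst_continuous|].
exact: is_derive_cst.
Qed.

Lemma C1_grad_coord (j : 'I_d) :
  C1_grad (fun x => x ord0 j) (fun i _ => (i == j)%:R).
Proof.
split=> [|i|i x]; [exact: coord_continuous|exact: cst_continuous|].
apply/is_derive_line.
rewrite (_ : (fun _ => _) = (fun t : R => t * (i == j)%:R + x ord0 j)); last first.
  by apply/funext => t; rewrite !mxE eqxx/= eq_sym.
apply: (@is_derive_quadratic _ _ _ _ 0) => h.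
by rewrite mul0r addr0 mul0r add0r addrK mulrC subrr normr0.
Qed.

Lemma Ck1_prod (I : Type) (s : seq I) (F : I -> 'rV[R]_d -> R) :
  (forall i, Ck 1 (F i)) -> Ck 1 (fun x => \prod_(i <- s) F i x).
Proof.
move=> CF; elim: s => [|i s IH].
  by under eq_fun do rewrite big_nil; exact: C1_grad_Ck1 (C1_grad_cst 1).
under eq_fun do rewrite big_cons.
move/C1_gradP : (CF i) => Ci; move/C1_gradP : IH => Cs.
exact: C1_grad_Ck1 (C1_grad_mul Ci Cs).
Qed.

Lemma Ck1_sum (I : Type) (s : seq I) (a : I -> R) (F : I -> 'rV[R]_d -> R) :
  (forall i, Ck 1 (F i)) -> Ck 1 (fun x => \sum_(i <- s) a i * F i x).
Proof.
move=> CF; elim: s => [|i s IH].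
  by under eq_fun do rewrite big_nil; exact: C1_grad_Ck1 (C1_grad_cst 0).
by under eq_fun do rewrite big_cons; exact: Ck_lin.
Qed.

End C1_functions.

Section smooth_step.
Context (R : realType).
Implicit Types t : R.

Definition pos_sqr t : R := (Num.max t 0) ^+ 2.

Lemma is_derive_pos_sqr t : is_derive t 1 pos_sqr (2 * Num.max t 0).
Proof.
apply: (@is_derive_quadratic _ _ _ _ 1) => h; rewrite mul1r /pos_sqr.
case: (leP (h + t) 0) => h1; case: (leP t 0) => h2.
- by rewrite !expr0n/= !mulr0 !mul0r !subr0 normr0 sqr_ge0.
- rewrite expr0n/= ler_norml; apply/andP; split; nra.
- rewrite expr0n/= mulr0 mul0r !subr0 ger0_norm ?sqr_ge0//; nra.
- by rewrite (_ : _ - _ = h ^+ 2) ?ger0_norm ?sqr_ge0//; ring.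
Qed.

Lemma is_derive_pos_sqr_shift (c t : R) :
  is_derive t 1 (fun s => pos_sqr (s - c)) (2 * Num.max (t - c) 0).
Proof.
rewrite -[X in is_derive _ _ _ X]mulr1.
apply: (@is_derive_comp R R pos_sqr (fun s => s - c)); first exact: is_derive_pos_sqr.
apply: (@is_derive_quadratic _ _ _ _ 0) => h.
by rewrite mul0r (_ : _ - _ = 0) ?normr0//; ring.
Qed.

Lemma continuous_pos_part (c : R) : continuous (fun s : R => 2 * Num.max (s - c) 0).
Proof.
apply: continuousM_fun; first exact: cst_continuous.
apply: continuous_max_fun; last exact: cst_continuous.
by apply: continuousB_fun; [exact: (fun x => @cvg_id _ _)|exact: cst_continuous].
Qed.

(** A quadratic spline rising from 0 to 1 on [[0, 1]]: its second derivative is 4 on the first half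
    and -4 on the second. *)
Definition smooth_step t : R :=
  2 * pos_sqr t + (-4 * pos_sqr (t - 2^-1) + 2 * pos_sqr (t - 1)).

Lemma smooth_step_le0 t : t <= 0 -> smooth_step t = 0.
Proof.
move=> t0; rewrite /smooth_step /pos_sqr !max_r//; first by ring.
- lra.
- lra.
Qed.

Lemma smooth_step_ge1 t : 1 <= t -> smooth_step t = 1.
Proof.
move=> t1; rewrite /smooth_step /pos_sqr !max_l//; first by field.
- lra.
- lra.
- lra.
Qed.

Lemma smooth_step_nd s t : s <= t -> smooth_step s <= smooth_step t.
Proof.
move=> st; rewrite /smooth_step /pos_sqr.
case: (leP s 0) => s0; case: (leP (s - 2^-1) 0) => s1; case: (leP (s - 1) 0) => s2;
case: (leP t 0) => t0; case: (leP (t - 2^-1) 0) => t1; case: (leP (t - 1) 0) => t2;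
  try lra; nra.
Qed.

End smooth_step.

Lemma is_derive_mull (R : realType) (V : normedModType R) (f : V -> R) (x v : V)
    (a b : R) : is_derive x v f b -> is_derive x v (fun y => a * f y) (a * b).
Proof.
move=> df; have := is_derive_mul (is_derive_cst a x v) df.
by rewrite mulr0 addr0.
Qed.

Section C00_uniform_continuity.
Context (R : realType) (d : nat) (O : set 'rV[R]_d).
Hypothesis bO : bounded_set O.

Lemma le_coord_norm (x : 'rV[R]_d) i : `|x ord0 i| <= `|x|.
Proof.
rewrite [leRHS]/Num.norm/= mx_normrE.
exact: (le_bigmax _ (fun ij : 'I_1 * 'I_d => `|x ij.1 ij.2|) (ord0, i)).
Qed.

Lemma bounded_set_coord : exists2 B : R, 0 < B & forall x i, O x -> `|x ord0 i| <= B.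
Proof.
have [M [Mreal hM]] := bO; exists (`|M| + 1) => [|x i Ox]; first by rewrite ltr_wpDl.
apply: (le_trans (le_coord_norm x i)); apply: (hM (`|M| + 1)) => //.
by rewrite (le_lt_trans (ler_norm _))// ltrDl.
Qed.

(** Compactness handles the points where [|f| >= e / 2]; two points outside that set have values
    within [e] of each other whatever their distance. *)
Lemma C00_uniform_continuous f e : C00 O f -> 0 < e ->
  exists2 r, 0 < r & forall x y, ball x r y -> `|f x - f y| < e.
Proof.
move=> [cf f0] e0; pose K := [set x | e / 2 <= `|f x|].
have e20 : 0 < e / 2 by rewrite divr_gt0.
have cK : compact K.
  apply: (bounded_subset_compact bO).
    exact/closed_ge/continuous_abs_fun.
  move=> x; rewrite /K /=; apply: contraPP => Ox; rewrite f0// normr0.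
  by apply/negP; rewrite -ltNge.
have : \forall r \near 0^'+, K `<=`
    [set x | forall y, ball x r y -> `|f x - f y| < e].
  move/compact_near_coveringP : cK => /(_ R 0^'+
    (fun r x => forall y, ball x r y -> `|f x - f y| < e)).
  apply => x _.
  have /cvgrPdist_lt/(_ _ e20)/nbhs_ballP[s /= s0 xs] := cf x.
  have s20 : 0 < s / 2 by rewrite divr_gt0.
  exists (ball x (s / 2), [set r | 0 < r < s / 2]) => /=.
    split; first exact: nbhsx_ballx.
    by near=> r; apply/andP; split; near: r; [exact: nbhs_right_gt|exact: nbhs_right_lt].
  move=> [z r] [/= xz /andP[r0 rs]] y zy.
  have xy : ball x s y.
    by rewrite [s]splitr; apply: (ball_triangle xz); apply: le_ball zy; exact: ltW.
  have {}xz : ball x s z by apply: le_ball xz; rewrite ler_pdivrMr// ler_pMr// ler1n.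
  rewrite [e]splitr (le_lt_trans (ler_distD (f x) _ _))// ltrD//; last exact: xs.
  by rewrite distrC; exact: xs.
move=> [r /= r0 Kr].
have {}Kr : forall x y, K x -> ball x (r / 2) y -> `|f x - f y| < e.
  move=> x y Kx; apply: (Kr (r / 2)) => //=; last by rewrite divr_gt0.
  rewrite sub0r normrN gtr0_norm ?divr_gt0// ltr_pdivrMr// ltr_pMr//.
  by rewrite ltr1n.
exists (r / 2); first by rewrite divr_gt0.
move=> x y xy; have [Kx|/negP Kx] := pselect (K x); first exact: Kr.
have [Ky|/negP Ky] := pselect (K y).
  by rewrite distrC; apply: Kr => //; exact: ball_sym.
by rewrite [e]splitr (le_lt_trans (ler_normB _ _))// ltrD// ltNge.
Unshelve. all: by end_near. Qed.

End C00_uniform_continuity.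

(** * Approximation by a C^1 partition of unity *)

Section C1_density.
Context (R : realType) (d : nat) (O : set 'rV[R]_d).
Hypothesis bO : bounded_set O.

Lemma Cc0_C00 (f : 'rV[R]_d -> R) : Cc0 O f -> C00 O f.
Proof.
move=> [cf _ fO]; split=> // x Ox; apply: contrapT => fx; apply/Ox/fO.
by apply: subset_closure => /=; exact/eqP.
Qed.

Lemma Cc1_C00 (f : 'rV[R]_d -> R) : Cc1 O f -> C00 O f.
Proof. by move=> [/Cc0_C00]. Qed.

Lemma Cc0_subset (f : 'rV[R]_d -> R) (K : set 'rV[R]_d) : continuous f ->
  closed K -> K `<=` O -> (forall x, f x != 0 -> K x) -> Cc0 O f.
Proof.
move=> cf cK KO fK; have sK : Defs.support f `<=` K.
  rewrite /Defs.support [X in _ `<=` X](closure_id K).1//.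
  by apply: closureS => x /=; exact: fK.
split=> //; last exact: subset_trans KO.
apply: (bounded_subset_compact bO); last exact: subset_trans KO.
exact: closed_closure.
Qed.

(** A difference of two consecutive shifts of the step, living within [r] of the grid point
    [r (k - N)]. This form makes sums over [k] telescope. *)
Let bump (r : R) (N : nat) (k : nat) (t : R) : R :=
  smooth_step (t / r - (k%:R - N%:R) + 1) - smooth_step (t / r - (k%:R - N%:R)).

Let bump_ge0 r N k t : 0 <= bump r N k t.
Proof. by rewrite subr_ge0 smooth_step_nd// lerDl. Qed.

Let bump_neq0 r N k t : 0 < r -> bump r N k t != 0 -> `|t - r * (k%:R - N%:R)| < r.
Proof.
move=> r0; apply: contraNT; rewrite -leNgt => h.
rewrite /bump (_ : t / r = (t - r * (k%:R - N%:R)) / r + (k%:R - N%:R)); last first.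
  by field; rewrite gt_eqF.
rewrite addrK.
have {h} : 1 <= `|(t - r * (k%:R - N%:R)) / r|.
  by rewrite normrM normfV (gtr0_norm r0) ler_pdivlMr// mul1r.
rewrite ler_normr => /orP[h|h].
  by rewrite !smooth_step_ge1 ?subrr//; lra.
by rewrite !smooth_step_le0 ?subrr//; lra.
Qed.

(** The sum telescopes to [smooth_step (t / r + N + 2) - smooth_step (t / r - N)], whose arguments
    are at least 1 and at most 0. The extra grid point on the left, from [N.+1], is what the width
    of the bumps requires. *)
Let bump_sum r N t : 0 < r -> `|t| <= r * N%:R ->
  \sum_(k < (N + N).+2) bump r N.+1 k t = 1.
Proof.
move=> r0; rewrite -ler_pdivrMl// [_^-1 * _]mulrC => h.
have {}h : `|t / r| <= N%:R by rewrite normrM normfV (gtr0_norm r0).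
move: h; rewrite ler_norml => /andP[h1 h2].
rewrite -(big_mkord xpredT (fun k => bump r N.+1 k t)).
rewrite (@telescope_sumr_eq _ _ _
  (fun k => - smooth_step (t / r - (k%:R - N.+1%:R) + 1)))//; last first.
  move=> k _; rewrite /bump opprK addrC; congr (- smooth_step _ + _).
    by rewrite -natr1; ring.
rewrite smooth_step_le0 ?oppr0 ?sub0r ?opprK; last first.
  rewrite -!natr1 natrD; lra.
rewrite smooth_step_ge1// -natr1; lra.
Qed.

Let bump_C1 r N k : exists2 h' : R -> R,
  (forall t : R, is_derive t 1 (bump r N k) (h' t)) & continuous h'.
Proof.
have H (c : R) : exists2 h' : R -> R, (forall t : R, is_derive t 1
    (fun t => smooth_step (t / r - c)) (h' t)) & continuous h'.
  have H1 (a b : R) : exists2 h' : R -> R, (forall t : R, is_derive t 1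
      (fun t => a * pos_sqr (t / r - c - b)) (h' t)) & continuous h'.
    exists (fun t => a * (2 * Num.max (t / r - c - b) 0 * r^-1)).
      move=> t; apply: is_derive_mull.
      apply: (@is_derive_comp R R (@pos_sqr R) (fun t => t / r - c - b)).
        exact: is_derive_pos_sqr.
      apply: (@is_derive_quadratic _ _ _ _ 0) => h.
      by rewrite mul0r (_ : _ - _ = 0) ?normr0//; ring.
    apply: continuousM_fun; first exact: cst_continuous.
    apply: continuousM_fun; last exact: cst_continuous.
    apply: continuousM_fun; first exact: cst_continuous.
    apply: continuous_max_fun; last exact: cst_continuous.
    do 2 (apply: continuousB_fun; last exact: cst_continuous).
    by apply: continuousM_fun; [exact: (fun x => @cvg_id _ _)|exact: cst_continuous].
  have [h1 d1 c1] := H1 2 0; have [h2 d2 c2] := H1 (-4) (2^-1).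
  have [h3 d3 c3] := H1 2 1.
  exists (fun t => h1 t + (h2 t + h3 t)); last first.
    by do 2 (apply: continuousD_fun => //).
  move=> t; rewrite /smooth_step.
  rewrite (_ : (fun _ => _) = (fun t => 2 * pos_sqr (t / r - c - 0)) +
    ((fun t => -4 * pos_sqr (t / r - c - 2^-1)) + (fun t => 2 * pos_sqr (t / r - c - 1)))).
    exact: is_deriveD.
  by apply/funext => s; rewrite !fctE subr0.
have [h1 d1 c1] := H (k%:R - N%:R - 1); have [h2 d2 c2] := H (k%:R - N%:R).
exists (fun t => h1 t - h2 t); last exact: continuousB_fun.
move=> t; rewrite (_ : bump r N k = (fun t => smooth_step (t / r - (k%:R - N%:R - 1))) -
  (fun t => smooth_step (t / r - (k%:R - N%:R)))); first exact: is_deriveB.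
by apply/funext => s; rewrite !fctE /bump opprB addrA addrAC addrC addrA; congr (smooth_step _ - _); ring.
Qed.

(* [f] is sampled on a fine grid against a C^1 partition of unity. Soft
   thresholding the sampled values keeps the support inside [O]. *)
Lemma Cc1_dense f e : C00 O f -> 0 < e ->
  exists2 v, Cc1 O v & forall x, `|v x - f x| <= e.
Proof.
move=> Cf e0; pose a := e / 2; have a0 : 0 < a by rewrite divr_gt0.
have a20 : 0 < a / 2 by rewrite divr_gt0.
have [r r0 rf] := C00_uniform_continuous bO Cf a20.
have [B B0 OB] := bounded_set_coord bO.
pose N := (Num.truncn (B / r)).+1.
have NB : B <= r * N%:R by rewrite -ler_pdivrMl// mulrC ltW// truncnS_gt.
pose g x := Num.max (f x - a) 0 - Num.max (- f x - a) 0.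
have gf x : `|g x - f x| <= a.
  rewrite /g ler_norml; case: (leP (f x - a) 0); case: (leP (- f x - a) 0) => ? ?;
  apply/andP; split; lra.
have g0 x : g x != 0 -> a <= `|f x|.
  apply: contraNT; rewrite -ltNge ltr_norml => /andP[h1 h2].
  by rewrite /g !max_r ?subrr//; lra.
pose pt (k : {ffun 'I_d -> 'I_((N + N).+2)}) : 'rV[R]_d :=
  \row_i (r * ((k i)%:R - N.+1%:R)).
pose P k (x : 'rV[R]_d) := \prod_i bump r N.+1 (k i : 'I_((N + N).+2)) (x ord0 i).
have P0 k x : 0 <= P k x by apply: prodr_ge0 => i _.
have Pnear (k : {ffun 'I_d -> 'I_((N + N).+2)}) x : P k x != 0 -> ball (pt k) r x.
  move=> /prodf_neq0 Px; split=> // i j; rewrite !ord1 /ball/= mxE distrC.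
  by apply: bump_neq0 => //; exact: Px.
pose v x := \sum_(k : {ffun 'I_d -> 'I_((N + N).+2)}) g (pt k) * P k x.
have sumP x : O x -> \sum_(k : {ffun 'I_d -> 'I_((N + N).+2)}) P k x = 1.
  move=> Ox; rewrite /P -(bigA_distr_bigA
    (fun i (k : 'I_((N + N).+2)) => bump r N.+1 k (x ord0 i))).
  by rewrite big1// => i _; apply: bump_sum => //; exact: le_trans (OB _ i Ox) NB.
have sumP1 x : \sum_(k : {ffun 'I_d -> 'I_((N + N).+2)}) P k x <= 1.
  rewrite /P -(bigA_distr_bigA
    (fun i (k : 'I_((N + N).+2)) => bump r N.+1 k (x ord0 i))).
  apply: prodr_ile1 => i _; apply/andP; split; first exact: sumr_ge0.
  rewrite -(big_mkord xpredT (fun k => bump r N.+1 k (x ord0 i))).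
  rewrite (@telescope_sumr_eq _ _ _
    (fun k => - smooth_step (x ord0 i / r - (k%:R - N.+1%:R) + 1)))//; last first.
    move=> k _; rewrite /bump opprK addrC; congr (- smooth_step _ + _).
      by rewrite -natr1; ring.
  have S01 (t : R) : 0 <= smooth_step t <= 1.
    have [t0|t0] := leP t 0; first by rewrite smooth_step_le0// lexx ler01.
    rewrite -(smooth_step_le0 (lexx 0)) smooth_step_nd ?(ltW t0)//=.
    have [t1|t1] := leP 1 t; first by rewrite smooth_step_ge1.
    by rewrite -(smooth_step_ge1 (lexx 1)) smooth_step_nd ?(ltW t1).
  rewrite opprK.
  have /andP[h1 _] := S01 (x ord0 i / r - ((N + N).+2%:R - N.+1%:R) + 1).
  have /andP[_ h2] := S01 (x ord0 i / r - (0%:R - N.+1%:R) + 1).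
  by rewrite addrC lerBlDr (le_trans h2)// lerDl.
have vC1 : Ck 1 v.
  apply: (Ck1_sum _ (fun k => g (pt k))) => k; apply: Ck1_prod => i.
  have [h' dh ch] := bump_C1 r N.+1 (k i).
  exact: C1_grad_Ck1 (C1_grad_comp (C1_grad_coord R i) dh ch).
exists v.
  (* A grid point that contributes to [v x] has [|f| >= a] and lies within [r] of [x], where [f]
     changes by less than [a / 2]. *)
  split=> //; apply: (@Cc0_subset _ [set x | a / 2 <= `|f x|]).
  - by case: vC1.
  - by apply/closed_ge/continuous_abs_fun; exact: Cf.1.
  - move=> x /=; apply: contraPP => Ox; rewrite Cf.2// normr0.
    by apply/negP; rewrite -ltNge.
  - move=> x vx /=.
    have [k /= kx] : exists k, g (pt k) * P k x != 0.
      apply: contrapT => /forallNP H; move: vx; rewrite /v big1 ?eqxx// => k _.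
      by have /negP := H k; rewrite negbK => /eqP.
    have gk : g (pt k) != 0 by apply: contraNneq kx => ->; rewrite mul0r.
    have Pk : P k x != 0 by apply: contraNneq kx => ->; rewrite mulr0.
    have := rf _ _ (Pnear _ _ Pk); have := g0 _ gk.
    have := ler_normD (f (pt k) - f x) (f x).
    by rewrite subrK => h1 h2 h3; lra.
move=> x.
(* Off [O] the weights need not add up to 1, but there [f] vanishes. *)
have -> : f x = \sum_(k : {ffun 'I_d -> 'I_((N + N).+2)}) f x * P k x.
  have [Ox|Ox] := pselect (O x); first by rewrite -mulr_sumr sumP// mulr1.
  by rewrite Cf.2// big1// => k _; rewrite mul0r.
rewrite /v -sumrB (le_trans (ler_norm_sum _ _ _))//.
rewrite -[leRHS]mulr1 (le_trans _ (ler_wpM2l (ltW e0) (sumP1 x)))// mulr_sumr.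
apply: ler_sum => k _; rewrite -mulrBl normrM (ger0_norm (P0 _ _)).
have [->|Pk] := eqVneq (P k x) 0; first by rewrite !mulr0.
rewrite ler_wpM2r//.
have h1 := rf _ _ (Pnear _ _ Pk); have h2 := gf (pt k).
rewrite (le_trans (ler_distD (f (pt k)) _ _))// [e]splitr lerD//.
by rewrite (le_trans (ltW h1))// ler_pdivrMr// ler_pMr// ler1n.
Qed.

End C1_density.

(** * Extension of functionals from C^1_c to C^0_0 *)

Section C1_functional.
Context (R : realType) (d : nat) (O : set 'rV[R]_d).
Variables (u : ('rV[R]_d -> R) -> R) (K : R).
Hypothesis (bO : bounded_set O) (oO : open O) (K0 : 0 <= K).
Hypothesis ulin : forall a f g, Cc1 O f -> Cc1 O g ->
  u (fun x => a * f x + g x) = a * u f + u g.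
Hypothesis uK : forall f c, Cc1 O f -> (forall x, `|f x| <= c) -> `|u f| <= K * c.

(** McShane's formula: the infimum of [u v + K e] over approximations [v] of [f] within [e] extends
    a [K]-Lipschitz functional, with no choice of approximating sequences. *)
Let approx f : set R := [set t | exists v e,
  [/\ Cc1 O v, 0 <= e, forall x, `|v x - f x| <= e & t = u v + K * e]].

Let uB f g : Cc1 O f -> Cc1 O g -> u f - u g = u (fun x => f x - g x).
Proof.
move=> Cf Cg; rewrite addrC -mulN1r -ulin//; congr u.
by apply/funext => x; rewrite mulN1r addrC.
Qed.

Let Cc1B f g : Cc1 O f -> Cc1 O g -> Cc1 O (fun x => f x - g x).
Proof.
move=> Cf Cg; have := Cc1_lin (-1) Cg Cf.
by rewrite (_ : (fun _ => _) = (fun x => f x - g x))//; apply/funext => x; rewrite mulN1r addrC.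
Qed.

Let approx_lb f v e : Cc1 O v -> 0 <= e -> (forall x, `|v x - f x| <= e) ->
  lbound (approx f) (u v - K * e).
Proof.
move=> Cv e0 ve _ [w [s [Cw s0 ws ->]]].
rewrite lerBlDr -addrA -mulrDr -lerBlDl uB//.
apply: le_trans (ler_norm _) _; apply: uK; first exact: Cc1B.
move=> x; rewrite (le_trans (ler_distD (f x) _ _))// addrC lerD//.
by rewrite distrC.
Qed.

Let ext f := inf (approx f).

Let ext_approx f v e : Cc1 O v -> 0 <= e -> (forall x, `|v x - f x| <= e) ->
  `|ext f - u v| <= K * e.
Proof.
move=> Cv e0 ve; have av : approx f (u v + K * e) by exists v, e.
have lb := approx_lb Cv e0 ve.
rewrite ler_distl; apply/andP; split.
  by apply: lb_le_inf => //; exists (u v + K * e).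
by apply: ge_inf => //; exists (u v - K * e).
Qed.

Let ext_near f e : C00 O f -> 0 < e -> exists2 v, Cc1 O v &
  (forall x, `|v x - f x| <= e) /\ `|ext f - u v| <= K * e.
Proof.
move=> Cf e0; have [v Cv ve] := Cc1_dense bO Cf e0.
by exists v => //; split=> //; apply: ext_approx => //; exact: ltW.
Qed.

Let ext_eq f : Cc1 O f -> ext f = u f.
Proof.
move=> Cf; apply/eqP; rewrite -subr_eq0 -normr_le0 -(mulr0 K).
by apply: ext_approx => // x; rewrite subrr normr0.
Qed.

Let ext_lin a f g : C00 O f -> C00 O g ->
  ext (fun x => a * f x + g x) = a * ext f + ext g.
Proof.
move=> Cf Cg; apply/eqP; rewrite -subr_eq0 -normr_le0; apply/ler_addgt0Pr => e e0.
rewrite add0r; pose C := 2 * (K * (`|a| + 1)) + 1.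
have a1 : 0 < `|a| + 1 by rewrite ltr_wpDl.
have C0 : 0 < C by rewrite ltr_wpDl// mulr_ge0// mulr_ge0// ltW.
pose s := e / C; have s0 : 0 < s by rewrite divr_gt0.
have [v Cv [vs uv]] := ext_near Cf s0; have [w Cw [ws uw]] := ext_near Cg s0.
have Cvw := Cc1_lin a Cv Cw.
have H : `|ext (fun x => a * f x + g x) - u (fun x => a * v x + w x)| <=
    K * (`|a| * s + s).
  have s0' := ltW s0; have as0 : 0 <= `|a| * s + s.
    by apply: addr_ge0 => //; exact: mulr_ge0.
  apply: ext_approx => //.
  move=> x; rewrite (_ : _ - _ = a * (v x - f x) + (w x - g x)); last by ring.
  by rewrite (le_trans (ler_normD _ _))// lerD// normrM ler_wpM2l.
move: H; rewrite ulin// => H.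
rewrite (_ : ext _ - _ = (ext (fun x => a * f x + g x) - (a * u v + u w)) -
  (a * (ext f - u v) + (ext g - u w))); last by ring.
rewrite (le_trans (ler_normB _ _))//.
apply: (@le_trans _ _ (K * (`|a| * s + s) + (`|a| * (K * s) + K * s))).
  rewrite lerD// (le_trans (ler_normD _ _))// lerD// normrM ler_wpM2l//.
have -> : K * (`|a| * s + s) + (`|a| * (K * s) + K * s) = (2 * (K * (`|a| + 1))) * s.
  by ring.
by rewrite /s mulrCA -[leRHS]mulr1 ler_wpM2l ?(ltW e0)// ler_pdivrMr// mul1r lerDl.
Qed.

Let ext_le f c : C00 O f -> (forall x, `|f x| <= c) -> `|ext f| <= K * c.
Proof.
move=> Cf fc; apply/ler_addgt0Pr => e e0.
have C0 : 0 < 2 * K + 1 by rewrite ltr_wpDl// mulr_ge0.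
pose s := e / (2 * K + 1); have s0 : 0 < s by rewrite divr_gt0.
have [v Cv [vs uv]] := ext_near Cf s0.
have H : `|u v| <= K * (c + s).
  apply: uK => // x; rewrite -(subrK (f x) (v x)) addrC.
  by rewrite (le_trans (ler_normD _ _))// lerD.
rewrite -(subrK (u v) (ext f)) (le_trans (ler_normD _ _))//.
rewrite (le_trans (lerD uv H))// mulrDr addrCA lerD2l.
have -> : K * s + K * s = (2 * K) * s by ring.
by rewrite /s mulrCA -[leRHS]mulr1 ler_wpM2l ?(ltW e0)// ler_pdivrMr// mul1r lerDl.
Qed.

Theorem riesz_Cc1 : exists mu : {charge set 'rV[R]_d -> \bar R},
  measures_on O mu /\ forall f, Cc1 O f -> charge_int mu f = u f.
Proof.
have [mu [muO muE]] := riesz_C00 bO oO ext_lin ext_le.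
exists mu; split=> // f Cf; rewrite muE ?ext_eq//; exact: Cc1_C00.
Qed.

End C1_functional.

(** * The integrand, its conjugate, and a regularized conjugate *)

Record integrand (R : realType) (psi : R -> R) : Prop := Integrand {
  integrand_ge0 : forall x, 0 <= psi x ;
  integrand_convex : forall x y t, 0 <= t <= 1 ->
    psi (t * x + (1 - t) * y) <= t * psi x + (1 - t) * psi y ;
  integrand0 : psi 0 = 0 ;
  integrand_even : forall x, psi x = psi (- x) ;
  integrand_growth : exists2 C : R, 0 < C & forall x, psi x <= C * (1 + `|x|) ;
  integrand_nontrivial : exists2 y : R, 0 < y & 0 < psi y }.

Section integrand_theory.
Context (R : realType).
Variable psi : R -> R.
Hypothesis Hpsi : integrand psi.

Let psi_ge0 := integrand_ge0 Hpsi.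
Let psi_conv := integrand_convex Hpsi.
Let psi0 := integrand0 Hpsi.
Let psi_even := integrand_even Hpsi.
Let psi_growth := integrand_growth Hpsi.
Let psi_nontrivial := integrand_nontrivial Hpsi.

Let psi_abs x : psi `|x| = psi x.
Proof. by case: (ger0P x) => // _; rewrite -psi_even. Qed.

Let psi_sub t x : 0 <= t <= 1 -> psi (t * x) <= t * psi x.
Proof.
by move=> t01; have := psi_conv x 0 t01; rewrite psi0 !mulr0 !addr0.
Qed.

(* The recession slope: the conjugate of [psi] is finite on [|x| < slope] and
   infinite on [|x| > slope]. *)
Definition slope : R := sup [set psi y / y | y in [set y | 0 < y]].

Let slope_has_sup : has_sup [set psi y / y | y in [set y | 0 < y]].
Proof.
split; first by exists (psi 1 / 1), 1 => //=.
have [C C0 hC] := psi_growth; exists C => _ [y /= y0 <-].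
rewrite ler_pdivrMr//; apply/ler_addgt0Pr => e e0.
(* The quotient [psi y / y] is nondecreasing by convexity, so it is compared with its value at
   [n.+1 * y], where the growth bound is close to [C]. *)
have [n nC] : exists n : nat, C / e <= n.+1%:R.
  by exists (Num.truncn (C / e)); rewrite ltW// truncnS_gt.
have n0 : (0 : R) < n.+1%:R by [].
have := psi_sub (n.+1%:R * y) (t := n.+1%:R^-1).
rewrite mulrA mulVf ?mul1r// => /(_ _) H.
have {}H : psi y <= n.+1%:R^-1 * psi (n.+1%:R * y).
  by apply: H; rewrite invr_ge0 ltW//= invf_le1// ler1n.
rewrite (le_trans H)// mulrC ler_pdivrMr// (le_trans (hC _))//.
have ny0 : 0 <= n.+1%:R * y by rewrite mulr_ge0// ltW.
move: nC; rewrite ler_pdivrMr// (ger0_norm ny0) => nC; lra.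
Qed.

Let slope_ge y : 0 < y -> psi y / y <= slope.
Proof. by move=> y0; apply: (sup_upper_bound slope_has_sup); exists y. Qed.

Lemma slope_gt0 : 0 < slope.
Proof.
have [y y0 py] := psi_nontrivial.
by apply: lt_le_trans (slope_ge y0); rewrite divr_gt0.
Qed.

Lemma psi_le_slope y : psi y <= slope * `|y|.
Proof.
rewrite -psi_abs; have [->|y0] := eqVneq y 0; first by rewrite normr0 psi0 mulr0.
by rewrite -ler_pdivrMr ?normr_gt0// slope_ge// normr_gt0.
Qed.

(** [x] is the combination, with a small weight [s], of [y] and of a far point on the ray from [y]
    through [x]. By [psi_le_slope] the far value is at most [slope * |x - y| / s] plus a constant,
    and the weight [s] makes the constant negligible. *)
Let psi_lip1 x y : psi x - psi y <= slope * `|x - y|.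
Proof.
apply/ler_addgt0Pr => e e0; have M0 := slope_gt0.
have My0 : 0 < slope * `|y| + 1 by rewrite ltr_wpDl// mulr_ge0// ltW.
pose s := Num.min 1 (e / (slope * `|y| + 1)).
have s0 : 0 < s by rewrite lt_min ltr01 divr_gt0.
have s1 : s <= 1 by rewrite ge_min lexx.
have se : s * (slope * `|y|) <= e.
  rewrite (@le_trans _ _ (e / (slope * `|y| + 1) * (slope * `|y| + 1)))//; last first.
    by rewrite divfK// gt_eqF.
  rewrite ler_pM ?(ltW s0)//; first by rewrite mulr_ge0// ltW.
    by rewrite ge_min lexx orbT.
  by rewrite lerDl.
have s01 : 0 <= s <= 1 by rewrite ltW.
have H := psi_conv (y + (x - y) / s) y s01.
have {}H : psi x <= s * psi (y + (x - y) / s) + (1 - s) * psi y.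
  apply: le_trans H; rewrite le_eqVlt; apply/orP; left; apply/eqP; congr psi.
  by field; rewrite gt_eqF.
have H2 : psi (y + (x - y) / s) <= slope * `|y| + slope * `|x - y| / s.
  rewrite (le_trans (psi_le_slope _))// -mulrA -mulrDr ler_wpM2l ?(ltW M0)//.
  by rewrite (le_trans (ler_normD _ _))// normrM normfV (gtr0_norm s0).
have H3 : s * psi (y + (x - y) / s) <= e + slope * `|x - y|.
  rewrite (le_trans (ler_wpM2l (ltW s0) H2))// mulrDr lerD//.
  by rewrite mulrCA mulfV ?mulr1// gt_eqF.
have H4 : 0 <= s * psi y by rewrite mulr_ge0// ltW.
lra.
Qed.

Lemma psi_lipschitz x y : `|psi x - psi y| <= slope * `|x - y|.
Proof.
by rewrite ler_norml psi_lip1 andbT lerNl opprB distrC psi_lip1.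
Qed.

Lemma psi_continuous : continuous psi.
Proof.
move=> x; apply/cvgrPdist_lt => e e0.
have r0 : 0 < e / slope by rewrite divr_gt0// slope_gt0.
near=> y.
have xy : `|x - y| < e / slope by near: y; exact: cvgr_dist_lt.
by rewrite (le_lt_trans (psi_lipschitz _ _))// mulrC -ltr_pdivlMr ?slope_gt0.
Unshelve. all: by end_near. Qed.

Local Notation conj := (conjugate psi).

Lemma le_conj x y : ((x * y - psi y)%:E <= conj x)%E.
Proof. by apply: ereal_sup_ubound; exists y. Qed.

Lemma conj_ge0 x : (0 <= conj x)%E.
Proof. by rewrite (le_trans _ (le_conj x 0))// psi0 mulr0 subr0. Qed.

Lemma conj0 : conj 0 = 0%E.
Proof.
apply/eqP; rewrite eq_le conj_ge0 andbT; apply: ge_ereal_sup => _ [y _ <-].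
by rewrite lee_fin mul0r sub0r oppr_le0.
Qed.

(** Total weight below 1 is allowed because [psi >= 0]; this is what lets test functions be
    multiplied by cutoffs and scaling factors. *)
Lemma conj_convex a1 a2 x1 x2 : 0 <= a1 -> 0 <= a2 -> a1 + a2 <= 1 ->
  (conj (a1 * x1 + a2 * x2) <= a1%:E * conj x1 + a2%:E * conj x2)%E.
Proof.
move=> a10 a20 a12; apply: ge_ereal_sup => _ [y _ <-].
apply: (@le_trans _ _ (a1%:E * (x1 * y - psi y)%:E + a2%:E * (x2 * y - psi y)%:E)%E).
  rewrite -!EFinM -EFinD lee_fin; have := psi_ge0 y; nra.
by apply: leeD; apply: lee_wpmul2l; rewrite ?lee_fin// le_conj.
Qed.

Lemma conjN x : conj (- x) = conj x.
Proof.
have le z : (conj (- z) <= conj z)%E.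
  apply: ge_ereal_sup => _ [y _ <-]; apply: le_trans (le_conj z (- y)).
  by rewrite mulNr mulrN -psi_even.
by apply/eqP; rewrite eq_le le -{1}[x]opprK le.
Qed.

Lemma conj_abs x : conj `|x| = conj x.
Proof. by case: (ger0P x) => // _; rewrite conjN. Qed.

Lemma conj_pinfty x : slope < `|x| -> conj x = +oo%E.
Proof.
move=> xM; apply/eqyP => A A0.
have d0 : 0 < `|x| - slope by rewrite subr_gt0.
have y0 : 0 <= A / (`|x| - slope) by rewrite divr_ge0// ltW.
rewrite -conj_abs; apply: le_trans (le_conj `|x| (A / (`|x| - slope))).
rewrite lee_fin lerBrDl (le_trans (lerD (psi_le_slope _) (lexx _)))//.
rewrite (ger0_norm y0) -lerBrDl -mulrBl mulrC divfK ?gt_eqF//.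
Qed.

(* Below the recession slope only bounded [y] matter in the supremum defining
   the conjugate. *)
Lemma conj_attained a : a < slope -> exists2 Y : R, 0 < Y &
  forall x, `|x| <= a -> forall y, exists2 z, `|z| <= Y &
    x * y - psi y <= x * z - psi z.
Proof.
rewrite -subr_gt0 => aM.
(* For [|y| > y0] the quotient [psi y / |y|] is at least [psi y0 / y0 > a >= |x|], so
   [x * y - psi y] is at most 0, the value at [z = 0]. *)
have [_ [y0 /= y00 <-] ay0] := sup_adherent aM slope_has_sup.
exists y0 => // x xa y.
have [yY|Yy] := lerP `|y| y0; first by exists y.
exists 0; first by rewrite normr0 ltW.
rewrite psi0 mulr0 subr0 subr_le0.
have y_gt0 : 0 < `|y| by exact: lt_trans Yy.
have H : psi y0 <= y0 / `|y| * psi y.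
  rewrite -(psi_abs y); have := @psi_sub (y0 / `|y|) `|y|.
  rewrite divfK ?gt_eqF//; apply; rewrite divr_ge0 ?(ltW y00)//=.
  by rewrite ler_pdivrMr// mul1r ltW.
have {}ay0 : a * y0 <= psi y0.
  by rewrite -ler_pdivlMr// ltW// (le_lt_trans _ ay0)// opprB addrC subrK.
rewrite (le_trans (ler_norm _))// normrM.
rewrite -(@ler_pM2l _ (y0 / `|y|)) ?divr_gt0//.
apply: le_trans H; apply: le_trans ay0; rewrite mulrCA divfK ?gt_eqF//.
by rewrite ler_wpM2r// ltW.
Qed.

Lemma conj_fin a : a < slope -> exists2 Y : R, 0 < Y &
  forall x, `|x| <= a -> (conj x <= (a * Y)%:E)%E.
Proof.
move=> /conj_attained[Y Y0 HY]; exists Y => // x xa.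
apply: ge_ereal_sup => _ [y _ <-]; have [z zY /le_trans] := HY x xa y.
rewrite lee_fin; apply; rewrite lerBlDr (le_trans (ler_norm _))// normrM.
by rewrite (@le_trans _ _ (a * Y))// ?ler_pM// lerDl.
Qed.

Lemma conj_lipschitz a : a < slope -> exists2 Y : R, 0 < Y &
  forall x1 x2, `|x1| <= a -> (conj x1 <= conj x2 + (Y * `|x1 - x2|)%:E)%E.
Proof.
move=> /conj_attained[Y Y0 HY]; exists Y => // x1 x2 xa.
apply: ge_ereal_sup => _ [y _ <-]; have [z zY /le_trans] := HY x1 xa y.
move=> H; apply: (@le_trans _ _ ((x2 * z - psi z)%:E + (Y * `|x1 - x2|)%:E)%E).
  rewrite -EFinD lee_fin; apply: H; rewrite -lerBlDl.
  rewrite (_ : _ - _ = (x1 - x2) * z); last by ring.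
  by rewrite (le_trans (ler_norm _))// normrM mulrC ler_wpM2r.
by rewrite leeD2r// le_conj.
Qed.

Lemma conj_measurable d (v : 'rV[R]_d -> R) : continuous v ->
  measurable_fun setT (fun x => conj (v x)).
Proof.
move=> cv; apply: (measurability _ (ErealGenOInfty.measurableE R)).
move=> _ [_ [c ->] <-]; rewrite setTI.
rewrite (_ : _ @^-1` _ = \bigcup_(y in setT) [set x | c < v x * y - psi y]).
  apply: open_measurable_mx; apply: bigcup_open => y _.
  apply: open_gt; apply: continuousB_fun; last exact: cst_continuous.
  by apply: continuousM_fun => //; exact: cst_continuous.
apply/seteqP; split=> x /=.
  rewrite in_itv/= andbT => /ereal_sup_gt[_ [y _ <-]]; rewrite lte_fin => h.
  by exists y.
move=> [y _ /= h]; rewrite in_itv/= andbT; apply: lt_le_trans (le_conj _ y).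
by rewrite lte_fin.
Qed.

Definition is_prox (delta : R) (g : R -> R) := forall s y,
  s * y - psi y - delta * y ^+ 2 + delta * (y - g s) ^+ 2 <=
  s * g s - psi (g s) - delta * g s ^+ 2.

(* [g] is the proximal-type map [s |-> argmax (s y - psi y - delta y^2)]; strong
   concavity gives the quadratic gap at the maximizer. *)
Lemma prox_exists delta : 0 < delta -> exists g : R -> R, is_prox delta g.
Proof.
move=> de0; suff /choice[g hg] : forall s, exists g, forall y,
    s * y - psi y - delta * y ^+ 2 + delta * (y - g) ^+ 2 <=
    s * g - psi g - delta * g ^+ 2 by exists g.
move=> s; pose h y := s * y - psi y - delta * y ^+ 2.
(* Beyond [L] the term [delta y^2] outweighs [s y] and the value is at most the one at 0, so a
   maximizer over [[-L, L]] is global. *)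
pose L := `|s| / delta; have L0 : 0 <= L by rewrite divr_ge0// ltW.
have ch : continuous h.
  apply: continuousB_fun.
    apply: continuousB_fun; last exact: psi_continuous.
    by apply: continuousM_fun; [exact: cst_continuous|exact: (fun x => @cvg_id _ _)].
  apply: continuousM_fun; first exact: cst_continuous.
  by under eq_fun do rewrite expr2; apply: continuousM_fun; exact: (fun x => @cvg_id _ _).
have [g gL gmax] := @EVT_max R h (- L) L (ge0_cp L0).2 (continuous_subspaceT ch).
have {}gmax y : h y <= h g.
  have [yL|yL] := boolP (y \in `[- L, L]); first exact: gmax.
  apply: (@le_trans _ _ (h 0)); last first.
    by apply: gmax; rewrite in_itv/= oppr_le0 L0.
  rewrite /h psi0 mulr0 expr0n/= mulr0 !subr0.
  have {}yL : L < `|y|.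
    by rewrite ltNge; apply: contra yL; rewrite in_itv/= ler_norml.
  have h1 : s * y <= delta * y ^+ 2.
    rewrite (le_trans (ler_norm _))// normrM -[y ^+ 2]real_normK ?num_real// expr2.
    by rewrite mulrA ler_wpM2r// mulrC -ler_pdivrMr// ltW.
  by have := psi_ge0 y; lra.
exists g => y; apply/ler_addgt0Pr => e e0.
(* Comparing the maximizer with the point at fraction [t] of the way to [y] gives the gap
   [(1 - t) D]; [t] is so small that the missing [t D] is below [e]. *)
pose D := delta * (y - g) ^+ 2; have D0 : 0 <= D by rewrite mulr_ge0 ?sqr_ge0// ltW.
pose t := Num.min 1 (e / (D + 1)).
have D1 : 0 < D + 1 by rewrite ltr_wpDl.
have t0 : 0 < t by rewrite lt_min ltr01 divr_gt0.
have t1 : t <= 1 by rewrite ge_min lexx.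
have tD : t * D <= e.
  rewrite (@le_trans _ _ (e / (D + 1) * (D + 1)))//; last by rewrite divfK// gt_eqF.
  by rewrite ler_pM ?(ltW t0)// ?lerDl// ge_min lexx orbT.
have /(psi_conv y g) H : 0 <= t <= 1 by rewrite t1 ltW.
have := gmax (t * y + (1 - t) * g); rewrite /h => H2.
suff : t * (s * y - psi y - delta * y ^+ 2 + D) <=
    t * (s * g - psi g - delta * g ^+ 2 + e) by rewrite ler_pM2l.
have := ler_wpM2l (ltW t0) tD; rewrite /D in tD *.
nra.
Qed.

(** * The regularized conjugate *)

Section regularized_conjugate.
Variables (delta : R) (g : R -> R).
Hypothesis de0 : 0 < delta.
Hypothesis hg : is_prox delta g.

(** The conjugate of [psi + delta y^2], written with its maximizer [g s]. It is finite on the whole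
    line and its derivative is [g]. *)
Definition rconj s := s * g s - psi (g s) - delta * g s ^+ 2.

Lemma le_rconj s y : s * y - psi y - delta * y ^+ 2 <= rconj s.
Proof. by apply: le_trans (hg s y); rewrite lerDl mulr_ge0 ?sqr_ge0// ltW. Qed.

Lemma rconj_ge0 s : 0 <= rconj s.
Proof. by have := le_rconj s 0; rewrite psi0 mulr0 expr0n/= mulr0 !subr0. Qed.

(** The quadratic gap in [is_prox] leaves [r z - delta z^2], at most [r^2 / (4 delta)], where [z] is
    the displacement of the maximizer. With [rconj_lower] this gives the derivative of [rconj]. *)
Lemma rconj_upper s r : rconj (s + r) <= rconj s + g s * r + r ^+ 2 / (4 * delta).
Proof.
have := hg s (g (s + r)); rewrite /rconj.
move: (g (s + r)) (g s) => y z H.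
suff : r * (y - z) - delta * (y - z) ^+ 2 <= r ^+ 2 / (4 * delta) by nra.
rewrite -subr_ge0 (_ : _ - _ = (r - 2 * delta * (y - z)) ^+ 2 / (4 * delta)).
  by rewrite divr_ge0 ?sqr_ge0// mulr_ge0// ltW.
by field; rewrite gt_eqF.
Qed.

Lemma rconj_lower s r : rconj s + g s * r <= rconj (s + r).
Proof. by have := le_rconj (s + r) (g s); rewrite /rconj; lra. Qed.

Lemma prox0 : g 0 = 0.
Proof.
have h1 := hg 0 0; have h2 := psi_ge0 (g 0).
rewrite psi0 in h1.
apply/eqP; rewrite -sqrf_eq0 eq_le sqr_ge0 andbT.
have : delta * g 0 ^+ 2 <= 0 by lra.
by rewrite pmulr_rle0.
Qed.

Lemma rconj0 : rconj 0 = 0.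
Proof. by rewrite /rconj prox0 psi0 mul0r expr0n/= mulr0 !subr0. Qed.

Lemma is_derive_rconj (s : R) : is_derive s 1 rconj (g s).
Proof.
apply: (@is_derive_quadratic _ _ _ _ (4 * delta)^-1) => h.
rewrite [h + s]addrC ger0_norm; last by have := rconj_lower s h; lra.
by have := rconj_upper s h; rewrite [_^-1 * _]mulrC; lra.
Qed.

Lemma prox_lipschitz s t : `|g s - g t| <= `|s - t| / (2 * delta).
Proof.
have H1 := hg s (g t); have H2 := hg t (g s).
have d20 : 0 < 2 * delta by rewrite mulr_gt0.
rewrite ler_pdivlMr// mulrC.
have [->|gst] := eqVneq (g s) (g t); first by rewrite subrr normr0 mulr0.
rewrite -(@ler_pM2r _ `|g s - g t|) ?normr_gt0 ?subr_eq0//.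
rewrite -mulrA -normrM -expr2 -normrM (ger0_norm (sqr_ge0 _)).
by apply: le_trans (ler_norm _); nra.
Qed.

Lemma prox_continuous : continuous g.
Proof.
have d20 : 0 < 2 * delta by rewrite mulr_gt0.
move=> x; apply/cvgrPdist_lt => e e0.
have r0 : 0 < e * (2 * delta) by rewrite mulr_gt0.
near=> y.
have xy : `|x - y| < e * (2 * delta) by near: y; exact: cvgr_dist_lt.
by rewrite (le_lt_trans (prox_lipschitz _ _))// ltr_pdivrMr.
Unshelve. all: by end_near. Qed.

Lemma rconj_continuous : continuous rconj.
Proof.
by move=> s; apply/differentiable_continuous/derivable1_diffP; case: (is_derive_rconj s).
Qed.

Lemma rconj_mid s t : rconj ((s + t) / 2) <= (rconj s + rconj t) / 2.
Proof.
have := le_rconj s (g ((s + t) / 2)); have := le_rconj t (g ((s + t) / 2)).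
by rewrite {3}/rconj; lra.
Qed.

Lemma rconj_mono s t : `|s| <= `|t| -> rconj s <= rconj t.
Proof.
move=> st; rewrite {1}/rconj.
pose z := g s; have [H|H] : `|t| * `|z| = t * z \/ `|t| * `|z| = t * (- z).
  by rewrite -normrM; case: (ger0P (t * z)) => _; [left|right; rewrite mulrN].
  have := le_rconj t z; have : s * z <= t * z.
    by rewrite -H (le_trans (ler_norm _))// normrM ler_wpM2r.
  by rewrite -/z; lra.
have := le_rconj t (- z); have : s * z <= t * (- z).
  by rewrite -H (le_trans (ler_norm _))// normrM ler_wpM2r.
by rewrite -/z sqrrN -psi_even; lra.
Qed.

(** Test with the maximizer of [(|s| - slope) y - delta y^2]. For small [delta] a bounded energy
    then allows [|s| > a > slope] only on a set of small measure. *)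
Lemma rconj_ge_excess s : slope <= `|s| -> (`|s| - slope) ^+ 2 / (4 * delta) <= rconj s.
Proof.
move=> sM; apply: (@le_trans _ _ (rconj `|s|)); last by rewrite rconj_mono// normr_id.
pose y := (`|s| - slope) / (2 * delta).
have d20 : 0 < 2 * delta by rewrite mulr_gt0.
have y0 : 0 <= y by rewrite divr_ge0 ?subr_ge0// ltW.
apply: le_trans (le_rconj _ y).
have := psi_le_slope y; rewrite (ger0_norm y0) => H.
rewrite -subr_ge0 (_ : _ - _ = slope * y - psi y + (`|s| * y - slope * y - delta * y ^+ 2 -
  (`|s| - slope) ^+ 2 / (4 * delta))); last by ring.
rewrite [X in _ + X](_ : _ = 0); first by rewrite addr0 subr_ge0.
by rewrite /y; field; rewrite gt_eqF.
Qed.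

End regularized_conjugate.

Lemma rconj_antimono delta1 delta2 g1 g2 s :
  0 < delta1 -> delta1 <= delta2 ->
  is_prox delta1 g1 ->
  rconj delta2 g2 s <= rconj delta1 g1 s.
Proof.
move=> d0 d12 h1; apply: le_trans (le_rconj d0 h1 s (g2 s)).
by rewrite /rconj lerB// ler_wpM2r// sqr_ge0.
Qed.

(** [Y] comes from [conj_attained], hence serves every [delta]: restricted to [|z| <= Y], the
    regularization costs at most [delta Y^2]. *)
Lemma conj_le_rconj a : a < slope -> exists2 Y : R, 0 < Y &
  forall delta g, 0 < delta -> is_prox delta g ->
  forall x, `|x| <= a -> (conj x <= (rconj delta g x + delta * Y ^+ 2)%:E)%E.
Proof.
move=> /conj_attained[Y Y0 HY]; exists Y => // delta g de0 hg x xa.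
apply: ge_ereal_sup => _ [y _ <-]; have [z zY H] := HY x xa y.
rewrite lee_fin (le_trans H)//.
have : delta * z ^+ 2 <= delta * Y ^+ 2.
  by rewrite ler_pM2l// -[z ^+ 2]real_normK ?num_real// lerXn2r// nnegrE ltW.
by have := le_rconj de0 hg x z; lra.
Qed.

End integrand_theory.

(** * Integrals over the domain and the Poincare inequality *)

Section lebesgue_rV_theory.
Context (R : realType).
Local Open Scope ereal_scope.
Local Notation leb d := (lebesgue_rV R d).

Lemma lebesgue_rV_cube d (x : 'rV[R]_d) (r : R) : (0 < r)%R ->
  leb d [set y | forall i, y ord0 i \in `](x ord0 i - r)%R, (x ord0 i + r)%R[ ] =
  (\prod_(i < d) (2 * r))%R%:E.
Proof.
move=> r0; rewrite (lebesgue_rV_box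
  (A := fun i => [set` `](x ord0 i - r)%R, (x ord0 i + r)%R[]))//.
rewrite (big_morph EFin (op1 := mule) (id1 := 1%E))//.
apply: eq_bigr => i _; rewrite lebesgue_measure_itv/= lte_fin.
rewrite ltrD2l gtrN// -EFinD; congr EFin; ring.
Qed.

Let measurable_cube d (x : 'rV[R]_d) (r : R) : measurable
  [set y : 'rV[R]_d | forall i, y ord0 i \in `](x ord0 i - r)%R, (x ord0 i + r)%R[ ].
Proof.
rewrite (_ : [set _ | _] = \bigcap_(i in [set: 'I_d])
    (fun y : 'rV[R]_d => y ord0 i) @^-1` [set` `](x ord0 i - r)%R, (x ord0 i + r)%R[]).
  apply: fin_bigcap_measurable => // i _; rewrite -[X in measurable X]setTI.
  by apply: measurable_coord => //; exact: measurable_itv.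
by apply/seteqP; split=> y /= h i; [move=> _; exact: h|exact: (h i I)].
Qed.

Lemma lebesgue_rV_sigma_finite d : sigma_finite [set: 'rV[R]_d] (leb d).
Proof.
exists (fun n => [set y : 'rV[R]_d | forall i,
    y ord0 i \in `](0 - n.+1%:R)%R, (0 + n.+1%:R)%R[ ]).
  apply/esym/seteqP; split=> // x _.
  exists (Num.truncn `|x|) => //= i; rewrite in_itv/= sub0r add0r -ltr_norml.
  by rewrite (le_lt_trans (le_coord_norm _ _))// truncnS_gt.
move=> n; split.
  by have := measurable_cube (0 : 'rV[R]_d) n.+1%:R; under eq_set do under eq_forall do rewrite mxE.
have := lebesgue_rV_cube (0 : 'rV[R]_d) (ltr0Sn R n).
under eq_set do under eq_forall do rewrite mxE.
by move=> ->; rewrite ltry.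
Qed.

Lemma lebesgue_rV_bounded d (O : set 'rV[R]_d) : measurable O -> bounded_set O ->
  leb d O < +oo.
Proof.
move=> mO bO; have [B B0 OB] := bounded_set_coord bO.
have B1 : (0 < B + 1)%R by rewrite ltr_wpDl// ltW.
have := lebesgue_rV_cube (0 : 'rV[R]_d) B1.
under eq_set do under eq_forall do rewrite mxE.
set Q := [set _ | _] => QE; apply: (@le_lt_trans _ _ (leb d Q)); last by rewrite QE ltry.
apply: le_measure; rewrite ?inE//.
  have := measurable_cube (0 : 'rV[R]_d) (B + 1)%R.
  by under eq_set do under eq_forall do rewrite mxE.
move=> x Ox i; rewrite in_itv/= sub0r add0r -ltr_norml.
by rewrite (le_lt_trans (OB x i Ox))// ltrDl.
Qed.

Lemma lebesgue_rV_open_gt0 d (U : set 'rV[R]_d) x : open U -> U x -> 0 < leb d U.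
Proof.
move=> oU Ux; have /nbhs_ballP[e /= e0 eU] : nbhs x U by exact: open_nbhs_nbhs.
apply: (@lt_le_trans _ _ (leb d
    [set y | forall i, y ord0 i \in `](x ord0 i - e)%R, (x ord0 i + e)%R[ ])).
  by rewrite lebesgue_rV_cube// lte_fin prodr_gt0// => i _; rewrite mulr_gt0.
apply: le_measure; rewrite ?inE; [exact: measurable_cube|exact: open_measurable_mx|].
move=> y /= xy; apply: eU; split=> // i j; rewrite !ord1 /ball/=.
by have := xy j; rewrite in_itv/= -ltr_distl distrC.
Qed.

End lebesgue_rV_theory.

(** * Integrals over the domain and measures with a continuous density *)

Section integral_on_domain.
Context (R : realType) (d : nat) (O : set 'rV[R]_d).
Hypothesis (bO : bounded_set O) (oO : open O).
Local Notation leb := (lebesgue_rV R d).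
Implicit Types f g : 'rV[R]_d -> R.

Let mO : measurable O. Proof. exact: open_measurable_mx. Qed.

Definition intO f : R := \int[leb]_(x in O) f x.

Definition volO : R := fine (leb O).

Lemma volO_ge0 : 0 <= volO. Proof. exact: fine_ge0. Qed.

Lemma leb_finO : (leb O < +oo)%E. Proof. exact: lebesgue_rV_bounded. Qed.

Lemma integrableO f M : measurable_fun O f -> (forall x, O x -> `|f x| <= M) ->
  leb.-integrable O (EFin \o f).
Proof.
move=> mf fM; apply: measurable_bounded_integrable => //; first exact: leb_finO.
by exists M; split; [exact: num_real|move=> x Mx y Oy /=; rewrite (le_trans (fM y Oy))// ltW].
Qed.

Lemma C00_integrableO f : C00 O f -> leb.-integrable O (EFin \o f).
Proof.
move=> Cf; have [M _ fM] := C00_bounded bO Cf; apply: (integrableO (M := M)) => //.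
by apply: measurable_funTS; apply: continuous_measurable_rV; exact: Cf.1.
Qed.

Lemma C00_integrable f : C00 O f -> leb.-integrable setT (EFin \o f).
Proof.
move=> Cf; have := C00_integrableO Cf; rewrite integrable_mkcond//.
rewrite (_ : (EFin \o f) \_ O = EFin \o f)//; apply/funext => x.
by rewrite patchE; case: ifPn => // /negP; rewrite inE => Ox; rewrite /= Cf.2.
Qed.

Lemma C00_setI_integral f A : C00 O f ->
  (\int[leb]_(x in A `&` O) (f x)%:E = \int[leb]_(x in A) (f x)%:E)%E.
Proof.
move=> Cf; rewrite integral_mkcondr; apply: eq_integral => x _.
by rewrite patchE; case: ifPn => // /negP; rewrite inE => Ox; rewrite /= Cf.2.
Qed.

Lemma intO_EFin f : C00 O f -> ((intO f)%:E = \int[leb]_(x in O) (f x)%:E)%E.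
Proof.
move=> Cf; rewrite /intO /Rintegral fineK//; apply: integrable_fin_num => //.
exact: C00_integrableO.
Qed.

Lemma intO_lin a f g : C00 O f -> C00 O g ->
  intO (fun x => a * f x + g x) = a * intO f + intO g.
Proof.
move=> Cf Cg; rewrite /intO RintegralD//; last 2 first.
- by apply: C00_integrableO; exact: C00Z.
- exact: C00_integrableO.
by rewrite RintegralZl//; exact: C00_integrableO.
Qed.

Lemma intOD f g : C00 O f -> C00 O g -> intO (fun x => f x + g x) = intO f + intO g.
Proof.
move=> Cf Cg; have := intO_lin 1 Cf Cg; rewrite mul1r => <-.
by congr intO; apply/funext => x; rewrite mul1r.
Qed.

Lemma intOZ a f : C00 O f -> intO (fun x => a * f x) = a * intO f.
Proof. by move=> Cf; rewrite /intO RintegralZl//; exact: C00_integrableO. Qed.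

Lemma le_intO f g : C00 O f -> C00 O g -> (forall x, O x -> f x <= g x) ->
  intO f <= intO g.
Proof. by move=> Cf Cg fg; apply: le_Rintegral => //; exact: C00_integrableO. Qed.

Lemma intO_ge0 f : (forall x, 0 <= f x) -> 0 <= intO f.
Proof. by move=> f0; apply: fine_ge0; apply: integral_ge0 => x _; rewrite lee_fin. Qed.

(** The change of density is again an instance of [level_bounds_eq]: the masses of the sets where
    [g > c] bound both functionals of [g]. *)
Lemma density_measure f : C00 O f -> (forall x, 0 <= f x) ->
  exists m : {finite_measure set 'rV[R]_d -> \bar R},
    (forall A, measurable A -> m A = \int[leb]_(x in A `&` O) (f x)%:E)%E /\
    forall g, C00 O g -> (forall x, 0 <= g x) ->
      \int[m]_x g x = intO (fun x => g x * f x).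
Proof.
move=> Cf f0.
pose nu A := (\int[leb]_(x in A) (f x)%:E)%E.
have mf : measurable_fun setT (EFin \o f).
  by apply/measurable_EFinP; apply: continuous_measurable_rV; exact: Cf.1.
have fe0 x : (0 <= (EFin \o f) x)%E by rewrite lee_fin.
have nu0 : nu set0 = 0%E by rewrite /nu integral_set0.
have nu_ge0 A : (0 <= nu A)%E by apply: integral_ge0 => x _; exact: fe0.
have nus : semi_sigma_additive nu := semi_sigma_additive_nng_induced mf fe0.
pose nuM : {measure set 'rV[R]_d -> \bar R} :=
  HB.pack nu (@isMeasure.Build _ _ R nu nu0 nu_ge0 nus).
have finnu : fin_num_fun nu.
  move=> A mA; apply: integrable_fin_num => //.
  by apply: integrableS (C00_integrable Cf).
pose m : {finite_measure set 'rV[R]_d -> \bar R} :=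
  HB.pack nu (Measure.on nuM) (@Measure_isFinite.Build _ _ _ nuM finnu).
have mE A : m A = (\int[leb]_(x in A) (f x)%:E)%E by [].
exists m; split=> [A mA|g Cg g0]; first by rewrite mE C00_setI_integral.
have [M _ gM] := C00_bounded bO Cg.
have CM h : C00 O h -> C00 O (fun x => h x * f x).
  by move=> Ch; apply: C00Mr => //; exact: Cf.1.
have mset c : measurable [set x | c < g x].
  by apply: open_measurable_mx; apply: open_gt; exact: Cg.1.
have mEf c : ((fine (m [set x | (c < g x)%R]))%:E =
    \int[leb]_(x in O) (((EFin \o f) \_ [set x | (c < g x)%R]) x))%E.
  rewrite fineK ?fin_num_measure// mE -C00_setI_integral// setIC.
  by rewrite integral_mkcondr.
have mpatch c : measurable_fun O ((EFin \o f) \_ [set x | (c < g x)%R]).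
  apply/measurable_restrict => //; exact: measurable_funTS.
have mfO h : C00 O h -> measurable_fun O (fun x => (h x * f x)%:E).
  move=> Ch; apply/measurable_EFinP; apply: measurable_funTS.
  by apply: continuous_measurable_rV; exact: (CM h Ch).1.
apply: (@level_bounds_eq _ _ O (fun h => \int[m]_x h x) (fun h => intO (fun x => h x * f x))
  g (fun c => fine (m [set x | c < g x])) (fine (m setT)) M) => //.
- exact: integral_additive_C00.
- move=> h1 h2 C1 C2 _ _; rewrite -intOD//; do ?exact: CM.
  by congr intO; apply/funext => x; rewrite mulrDl.
- by move=> x; rewrite g0 (le_trans (ler_norm _)).
- move=> c c0; rewrite fine_ge0//=; apply: fine_le; [exact (finnu _ (mset c))|exact (finnu _ measurableT)|].
  apply: (ge0_subset_integral leb (mset c) measurableT mf) => //.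
- by apply: integral_level_bounds => //; exact: Cg.1.
split=> c h c0 Ch h1 hc; rewrite -lee_fin mEf intO_EFin//; do ?exact: CM.
  apply: ge0_le_integral => //.
  - by move=> x _; rewrite lee_fin mulr_ge0//; case/andP : (h1 x).
  - exact: mfO.
  - move=> x _; rewrite patchE; case: ifPn => [_|].
      by rewrite lee_fin ler_piMl//; case/andP : (h1 x).
    by rewrite notin_setE/= => /negP; rewrite -leNgt => /hc ->; rewrite mul0r.
apply: ge0_le_integral => //.
- by move=> x _; rewrite patchE; case: ifPn => // _; rewrite lee_fin.
- exact: mfO.
- move=> x _; rewrite patchE; case: ifPn => [|_]; last by rewrite lee_fin mulr_ge0.
  by rewrite inE/= => /hc h1x; rewrite lee_fin ler_peMl.
Qed.

Lemma density_charge f : C00 O f -> exists mu : {charge set 'rV[R]_d -> \bar R},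
  [/\ has_density O f mu, measures_on O mu &
   forall g, C00 O g -> charge_int mu g = intO (fun x => g x * f x)].
Proof.
move=> Cf; pose fp x := Num.max (f x) 0; pose fm x := Num.max (- f x) 0.
have Cfp : C00 O fp by apply: C00_max => //; exact: C00_0.
have Cfm : C00 O fm by apply: C00_max; [exact: C00N|exact: C00_0].
have fE x : f x = fp x - fm x.
  rewrite /fm /fp; case: (leP 0 (f x)) => h; first by rewrite max_r ?oppr_le0// subr0.
  by rewrite max_l ?oppr_ge0 ?ltW// sub0r opprK.
have fp0 x : 0 <= fp x by rewrite le_max lexx orbT.
have fm0 x : 0 <= fm x by rewrite le_max lexx orbT.
have [m1 [m1E m1I]] := density_measure Cfp fp0.
have [m2 [m2E m2I]] := density_measure Cfm fm0.
have [mu muE] := charge_of_diff m1 m2.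
have Ci g h : C00 O g -> C00 O h -> C00 O (fun x => g x * h x).
  by move=> Cg Ch; apply: C00Mr => //; exact: Ch.1.
have mud A : measurable A -> mu A = (\int[leb]_(x in A `&` O) (f x)%:E)%E.
  move=> mA; rewrite muE// m1E// m2E// -integralB//; last 3 first.
  - exact: measurableI.
  - by apply: integrableS (C00_integrable Cfp) => //; exact: measurableI.
  - by apply: integrableS (C00_integrable Cfm) => //; exact: measurableI.
  by apply: eq_integral => x _; rewrite fE.
have pos g : C00 O g -> (forall x, 0 <= g x) -> charge_int mu g = intO (fun x => g x * f x).
  move=> Cg g0; have [M M0 gM] := C00_bounded bO Cg.
  rewrite (charge_int_diff muE Cg.1 gM) m1I// m2I//.
  rewrite -mulN1r addrC -intO_lin//; do ?exact: Ci.
  by congr intO; apply/funext => x; rewrite fE; ring.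
exists mu; split=> // [A mA AO|g Cg]; first by rewrite mud// AO integral_set0.
pose gp x := Num.max (g x) 0; pose gm x := Num.max (- g x) 0.
have Cgp : C00 O gp by apply: C00_max => //; exact: C00_0.
have Cgm : C00 O gm by apply: C00_max; [exact: C00N|exact: C00_0].
have gE : g = fun x => -1 * gm x + gp x.
  apply/funext => x; rewrite /gm /gp mulN1r.
  case: (leP 0 (g x)) => h; first by rewrite max_r ?oppr_le0// oppr0 add0r.
  by rewrite max_l ?oppr_ge0 ?ltW// opprK addr0.
have [Mp _ gpM] := C00_bounded bO Cgp; have [Mm _ gmM] := C00_bounded bO Cgm.
rewrite gE (charge_int_lin _ _ Cgm.1 gmM Cgp.1 gpM) !pos//; last 2 first.
- by move=> x; rewrite le_max lexx orbT.
- by move=> x; rewrite le_max lexx orbT.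
rewrite -intO_lin//; do ?exact: Ci.
by congr intO; apply/funext => x; ring.
Qed.

Lemma C00_L2 f : C00 O f -> exists w : L2 R d, (w : _ -> _) = f.
Proof.
move=> Cf; have mf : measurable_fun setT f by apply: continuous_measurable_rV; exact: Cf.1.
have C2 : C00 O (fun x => f x * f x) by apply: C00Mr => //; exact: Cf.1.
suff fL : f \in Lfun leb 2%:E by exists (Lfun_Sub (one_le_two R) fL); exact: Lfun_valP.
rewrite inE; apply/andP; split; rewrite inE//=.
rewrite /finite_norm unlock; apply: poweR_lty.
rewrite (_ : integral _ _ _ = \int[leb]_x (f x * f x)%:E)%E.
  by have /(integrable_fin_num measurableT) := C00_integrable C2; rewrite ltey_eq => ->.
apply: eq_integral => x _ /=.
by rewrite powR_mulrn// real_normK ?num_real// expr2.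
Qed.

Lemma L2norm_sqr (w : L2 R d) : C00 O w -> L2norm w ^+ 2 = intO (fun x => w x ^+ 2).
Proof.
move=> Cw; have C2 : C00 O (fun x => w x ^+ 2).
  by under eq_fun do rewrite expr2; apply: C00Mr => //; exact: Cw.1.
apply: EFin_inj; rewrite intO_EFin//.
have -> : ((L2norm w ^+ 2)%:E = 'N[leb]_2%:E[EFin \o w] `^ 2)%E.
  rewrite /L2norm -[in RHS]finite_norm_fine poweR_EFin powR_mulrn//.
  exact/fine_ge0/Lnorm_ge0.
rewrite poweR_Lnorm//; rewrite -[in RHS](setTI O) C00_setI_integral//.
apply: eq_integral => x _ /=.
by rewrite powR_mulrn// real_normK ?num_real.
Qed.

End integral_on_domain.

(** * The Poincare inequality by slicing along the first coordinate *)

Section poincare.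
Context (R : realType).
Local Notation mu1 := (@lebesgue_measure R).

(* Integrate the derivative of [t * h t ^ 2]. *)
Let poincare_1d (h h' : R -> R) (L : R) : 0 < L ->
  (forall t : R, is_derive t 1 h (h' t)) -> continuous h' ->
  (forall t, L <= `|t| -> h t = 0) ->
  (\int[mu1]_t (h t ^+ 2)%:E <= (4 * L ^+ 2)%:E * \int[mu1]_t (h' t ^+ 2)%:E)%E.
Proof.
move=> L0 dh ch' hL.
have ch : continuous h.
  by move=> t; apply/differentiable_continuous/derivable1_diffP; case: (dh t).
have cid : continuous (fun t : R => t) by move=> t; exact: cvg_id.
have LL : - L < L by rewrite gtrN.
pose F t := t * (h t * h t); pose F' t := t * (h t * h' t + h t * h' t) + (h t * h t) * 1.
have dF (t : R) : is_derive t 1 F (F' t).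
  by apply: is_derive_mul.
have cF : continuous F by apply: continuousM_fun => //; exact: continuousM_fun.
have cF' : continuous F'.
  apply: continuousD_fun; apply: continuousM_fun => //.
  - by apply: continuousD_fun; exact: continuousM_fun.
  - exact: continuousM_fun.
  - exact: cst_continuous.
have FTC : (\int[mu1]_(t in `[(- L)%R, L]) (F' t)%:E = 0)%E.
  rewrite (@continuous_FTC2 R F' F (- L) L)//.
  - rewrite /F !hL ?normrN ?ger0_norm ?(ltW L0)// !mulr0 -EFinB subrr//.
  - exact: continuous_subspaceT.
  - split.
    + by move=> t _; case: (dF t).
    + by apply: cvg_at_right_filter; exact: cF.
    + by apply: cvg_at_left_filter; exact: cF.
  - by move=> t _; rewrite derive1E; case: (dF t).
have itg k : continuous k -> mu1.-integrable `[(- L)%R, L] (EFin \o k).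
  move=> ck; apply: continuous_compact_integrable; first exact: segment_compact.
  exact: continuous_subspaceT.
have ch2 : continuous (fun t => h t ^+ 2).
  by under eq_fun do rewrite expr2; exact: continuousM_fun.
have ch'2 : continuous (fun t => h' t ^+ 2).
  by under eq_fun do rewrite expr2; exact: continuousM_fun.
have mitv : measurable (`[(- L)%R, L] : set R) by exact: measurable_itv.
have -> : (\int[mu1]_t (h t ^+ 2)%:E = \int[mu1]_(t in `[(- L)%R, L]) (h t ^+ 2)%:E)%E.
  rewrite [RHS]integral_mkcond; apply: eq_integral => t _; rewrite patchE.
  case: ifPn => //; rewrite notin_setE/= in_itv/= -ler_norml => /negP.
  by rewrite -ltNge => /ltW /hL ->; rewrite expr0n.
apply: (@le_trans _ _ ((4 * L ^+ 2)%:E * \int[mu1]_(t in `[(- L)%R, L]) (h' t ^+ 2)%:E)%E); last first.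
  apply: lee_wpmul2l; first by rewrite lee_fin mulr_ge0// sqr_ge0.
  apply: ge0_subset_integral => //.
    apply/measurable_EFinP; exact: continuous_measurable_fun.
  by move=> t _; rewrite lee_fin sqr_ge0.
(* Pointwise [h^2 <= 2 F' + 4 L^2 h'^2], since [h^2 + 4 t h h' + 4 t^2 h'^2] is a square and
   [|t| <= L]; the integral of [F'] vanishes. *)
apply: (@le_trans _ _ (\int[mu1]_(t in `[(- L)%R, L])
   ((2%:E * (F' t)%:E) + (4 * L ^+ 2)%:E * (h' t ^+ 2)%:E))%E).
  apply: le_integral => //.
  - exact: itg.
  - apply: integrableD => //; apply: integrableZl => //; exact: itg.
  - move=> t; rewrite inE/= in_itv/= -ler_norml => tL.
    rewrite -!EFinM -EFinD lee_fin /F'.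
    have H : t ^+ 2 <= L ^+ 2.
      by rewrite -[t ^+ 2]real_normK ?num_real// lerXn2r// nnegrE ltW.
    have H2 : t ^+ 2 * h' t ^+ 2 <= L ^+ 2 * h' t ^+ 2 by rewrite ler_wpM2r// sqr_ge0.
    have := sqr_ge0 (h t + 2 * t * h' t).
    move: (h t) (h' t) H2 => a b; nra.
rewrite integralD//; last 2 first.
- by apply: integrableZl => //; exact: itg.
- by apply: integrableZl => //; exact: itg.
rewrite !integralZl//; [|exact: itg|exact: itg].
by rewrite FTC mule0 add0e.
Qed.

(** A local copy of the measure that carries the sigma-finite structure required by Tonelli's
    theorem. *)
Let lebesgue_sf d : set 'rV[R]_d -> \bar R := lebesgue_rV R d.

HB.instance Definition _ d := Measure.on (@lebesgue_sf d).
HB.instance Definition _ d := @Measure_isSigmaFinite.Build _ _ R (@lebesgue_sf d)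
  (lebesgue_rV_sigma_finite R d).

Let lebesgue_prod d : {measure set ('rV[R]_d * measurableTypeR R) -> \bar R} :=
  (@lebesgue_sf d \x mu1)%E.

Let row_cons1 d : 'rV[R]_d * measurableTypeR R -> 'rV[R]_d.+1 := @row_cons R d.

Let measurable_row_cons1 d : measurable_fun setT (@row_cons1 d).
Proof. exact: measurable_row_cons. Qed.

Lemma lebesgue_rV_tonelli d (F : 'rV[R]_d.+1 -> \bar R) :
  measurable_fun setT F -> (forall x, 0 <= F x)%E ->
  measurable_fun setT (fun x : 'rV[R]_d => \int[mu1]_t F (row_cons (x, t)))%E /\
  (\int[lebesgue_rV R d.+1]_x F x =
   \int[lebesgue_rV R d]_x \int[mu1]_t F (row_cons (x, t)))%E.
Proof.
move=> mF F0; have mF2 : measurable_fun setT (F \o @row_cons1 d).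
  by apply: (measurableT_comp mF); exact: measurable_row_cons1.
split.
  exact: (@measurable_fun_fubini_tonelli_F _ _ _ (measurableTypeR R) R mu1 _ mF2 (fun z => F0 _)).
transitivity (\int[pushforward (lebesgue_prod d) (@row_cons1 d)]_x F x)%E.
  by apply: eq_measure_integral => A mA _.
rewrite (@ge0_integral_pushforward _ _ ('rV[R]_d * measurableTypeR R)%type _ R
  (@row_cons1 d) (@measurable_row_cons1 d) (lebesgue_prod d) setT F measurableT mF
  (fun x _ => F0 x)).
exact: (@fubini_tonelli1 _ _ _ (measurableTypeR R) R (@lebesgue_sf d) mu1 _ mF2 (fun z => F0 _)).
Qed.

Lemma row_consD d (x : 'rV[R]_d) (s t : R) :
  row_cons (x, s + t) = s *: delta_mx ord0 ord0 + row_cons (x, t).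
Proof.
apply/rowP => i; rewrite !mxE/=.
by case: unliftP => [j ->|->]; rewrite ?eqxx ?mulr1//= mulr0 add0r.
Qed.

Lemma poincare d (f : 'rV[R]_d.+1 -> R) g (L : R) : 0 < L ->
  C1_grad f g -> (forall x : 'rV[R]_d.+1, L <= `|x ord0 ord0| -> f x = 0) ->
  (\int[lebesgue_rV R d.+1]_x (f x ^+ 2)%:E <=
   (4 * L ^+ 2)%:E * \int[lebesgue_rV R d.+1]_x (g ord0 x ^+ 2)%:E)%E.
Proof.
move=> L0 [cf cg dg] fL.
have mk (k : 'rV[R]_d.+1 -> R) : continuous k ->
    measurable_fun setT (fun x : 'rV[R]_d.+1 => (k x ^+ 2)%:E).
  move=> ck; apply/measurable_EFinP; apply: continuous_measurable_rV.
  by under eq_fun do rewrite expr2; exact: continuousM_fun.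
have sq0 (k : 'rV[R]_d.+1 -> R) x : (0 <= (k x ^+ 2)%:E)%E by rewrite lee_fin sqr_ge0.
have [mf ->] := lebesgue_rV_tonelli (mk _ cf) (sq0 f).
have [mg ->] := lebesgue_rV_tonelli (mk _ (cg ord0)) (sq0 (g ord0)).
have sl x (k : 'rV[R]_d.+1 -> R) : continuous k ->
    continuous (fun t : R => k (row_cons (x, t))).
  move=> ck t; apply: (@continuous_comp _ _ _ (fun t => row_cons (x, t)) k); last exact: ck.
  rewrite (_ : (fun t : R => row_cons (x, t)) =
    (fun t => t *: delta_mx ord0 ord0 + row_cons (x, 0))); last first.
    by apply/funext => s; rewrite -row_consD addr0.
  by apply: cvgD; [apply: cvgZr_tmp; exact: cvg_id|exact: cvg_cst].
rewrite -ge0_integralZl//; last 2 first.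
- by move=> x _; apply: integral_ge0 => t _; rewrite lee_fin sqr_ge0.
- by rewrite lee_fin mulr_ge0// sqr_ge0.
apply: ge0_le_integral => //.
- by move=> x _; apply: integral_ge0 => t _; rewrite lee_fin sqr_ge0.
- by apply: measurable_funeM; exact: mg.
move=> x _; apply: poincare_1d => //.
- move=> t; apply/is_derive_line.
  rewrite (_ : (fun _ => _) = (fun s : R => f (s *: delta_mx ord0 ord0 + row_cons (x, t)))).
    by apply/(@is_derive_line R 'rV[R]_d.+1 R f); exact: dg.
  by apply/funext => s; rewrite -row_consD [s *: _]mulr1.
- exact: sl.
- by move=> t tL; apply: fL; rewrite mxE unlift_none.
Qed.

End poincare.

(** * H^1_0 and its dual *)

Section cauchy_schwarz.
Context (R : realType).

(** The discriminant inequality, including the degenerate case [c = 0]. Besides the Cauchy-Schwarz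
    inequalities it yields the approximate first-order condition at an almost maximizer. *)
Lemma quadratic_ge0 (a b c : R) : (forall t, 0 <= a + t * b *+ 2 + t ^+ 2 * c) ->
  0 <= c -> `|b| <= Num.sqrt a * Num.sqrt c.
Proof.
move=> H c0; have a0 : 0 <= a by have := H 0; rewrite mul0r mul0rn expr0n/= mul0r !addr0.
rewrite -sqrtrM// -sqrtr_sqr ler_wsqrtr//.
have [c0'|cn] := eqVneq c 0.
  have [->|bn] := eqVneq b 0; first by rewrite expr0n/= mulr_ge0.
  have := H (- (a + 1) / (b *+ 2)); rewrite c0' mulr0 addr0 mulr0 -mulrnAr.
  have b2 : b *+ 2 != 0 by rewrite mulrn_eq0.
  by rewrite divfK//; lra.
have cp : 0 < c by rewrite lt_neqAle eq_sym cn.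
have := H (- b / c); rewrite -(@ler_pM2r _ c)// mul0r.
rewrite (_ : (_ + _) * c = a * c - b ^+ 2); first by rewrite subr_ge0.
by field.
Qed.

Lemma sum_cauchy_schwarz (I : finType) (a b : I -> R) :
  `|\sum_i a i * b i| <=
  Num.sqrt (\sum_i a i ^+ 2) * Num.sqrt (\sum_i b i ^+ 2).
Proof.
apply: quadratic_ge0; last by apply: sumr_ge0 => i _; exact: sqr_ge0.
move=> t; rewrite -mulrnAr -sumrMnl !mulr_sumr -!big_split/=.
apply: sumr_ge0 => i _; rewrite (_ : _ + _ = (a i + t * b i) ^+ 2) ?sqr_ge0//.
by ring.
Qed.

Lemma sum_minkowski (I : finType) (a b : I -> R) :
  Num.sqrt (\sum_i (a i + b i) ^+ 2) <=
  Num.sqrt (\sum_i a i ^+ 2) + Num.sqrt (\sum_i b i ^+ 2).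
Proof.
have s0 (c : I -> R) : 0 <= \sum_i c i ^+ 2 by apply: sumr_ge0 => i _; exact: sqr_ge0.
rewrite -[leRHS]ger0_norm ?addr_ge0 ?sqrtr_ge0// -sqrtr_sqr ler_wsqrtr//.
rewrite sqrrD !sqr_sqrtr// -mulr_natl.
under eq_bigr do rewrite sqrrD -mulr_natl.
rewrite !big_split/= lerD2r lerD2l -mulr_sumr ler_pM2l//.
exact: le_trans (ler_norm _) (sum_cauchy_schwarz a b).
Qed.

End cauchy_schwarz.

(** * The Dirichlet form and the action of H^{-1} on C^1_c *)

Section sobolev_theory.
Context (R : realType) (d : nat) (O : set 'rV[R]_d).
Hypothesis (bO : bounded_set O) (oO : open O).
Implicit Types f g h : 'rV[R]_d -> R.
Local Notation intO := (intO O).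

Lemma Cc1_grad f : Cc1 O f -> C1_grad f (fun i => partial i f).
Proof. by move=> [_ /C1_gradP]. Qed.

Lemma Cc1_partial_C00 f i : Cc1 O f -> C00 O (partial i f).
Proof.
move=> Cf; have [cf cg dg] := Cc1_grad Cf; split; first exact: cg.
move=> x Ox; have [[_ _ fO] _] := Cf.
have nf : \forall y \near x, f y = 0.
  have : open (~` Defs.support f) by apply: closed_openC; exact: closed_closure.
  move=> oS; have Sx : (~` Defs.support f) x by move=> /fO.
  apply: filterS (open_nbhs_nbhs (conj oS Sx)) => y Sy.
  by apply: contrapT => fy; apply/Sy/subset_closure/eqP.
by rewrite /partial (near_eq_derive (g := cst 0)) ?derive_cst.
Qed.

Definition dirichlet f g : R := \sum_i intO (fun x => partial i f x * partial i g x).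

Definition gradnorm f : R := Num.sqrt (dirichlet f f).

Let CP f g i : Cc1 O f -> Cc1 O g -> C00 O (fun x => partial i f x * partial i g x).
Proof.
move=> Cf Cg; apply: C00Mr; first exact: Cc1_partial_C00.
by have [] := Cc1_partial_C00 i Cg.
Qed.

Lemma partial_lin a f g i : Cc1 O f -> Cc1 O g ->
  partial i (fun x => a * f x + g x) = fun x => a * partial i f x + partial i g x.
Proof.
move=> Cf Cg; have [_ _ df] := Cc1_grad Cf; have [_ _ dg] := Cc1_grad Cg.
apply/funext => x; case: (df i x) => dfx _; case: (dg i x) => dgx _.
by have [] := derive_lin a dfx dgx.
Qed.

Lemma dirichletC f g : dirichlet f g = dirichlet g f.
Proof.
by apply: eq_bigr => i _; congr intO; apply/funext => x; rewrite mulrC.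
Qed.

Lemma dirichlet_linl a f g h : Cc1 O f -> Cc1 O g -> Cc1 O h ->
  dirichlet (fun x => a * f x + g x) h = a * dirichlet f h + dirichlet g h.
Proof.
move=> Cf Cg Ch; rewrite /dirichlet mulr_sumr -big_split/=; apply: eq_bigr => i _.
rewrite -intO_lin//; do ?exact: CP.
by congr intO; apply/funext => x; rewrite partial_lin//; ring.
Qed.

Lemma dirichlet_linr a f g h : Cc1 O f -> Cc1 O g -> Cc1 O h ->
  dirichlet h (fun x => a * f x + g x) = a * dirichlet h f + dirichlet h g.
Proof. by move=> Cf Cg Ch; rewrite dirichletC (dirichlet_linl a Cf Cg Ch) (dirichletC h f) (dirichletC h g). Qed.

Lemma dirichlet_ge0 f : 0 <= dirichlet f f.
Proof.
by apply: sumr_ge0 => i _; apply: intO_ge0 => x; rewrite -expr2 sqr_ge0.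
Qed.

Lemma gradnorm_sqr f : gradnorm f ^+ 2 = dirichlet f f.
Proof. by rewrite sqr_sqrtr// dirichlet_ge0. Qed.

Lemma gradnorm_ge0 f : 0 <= gradnorm f. Proof. exact: sqrtr_ge0. Qed.

Lemma dirichlet_cauchy_schwarz f g : Cc1 O f -> Cc1 O g ->
  `|dirichlet f g| <= gradnorm f * gradnorm g.
Proof.
move=> Cf Cg; apply: quadratic_ge0; last exact: dirichlet_ge0.
move=> t; have Ctg := Cc1_lin t Cg Cf.
have := dirichlet_ge0 (fun x => t * g x + f x).
rewrite (dirichlet_linl t Cg Cf Ctg) (dirichlet_linr t Cg Cf Cg) (dirichlet_linr t Cg Cf Cf) (dirichletC g f).
move: (dirichlet f f) (dirichlet g g) (dirichlet f g) => A B C h.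
by apply: le_trans h _; rewrite le_eqVlt; apply/orP; left; apply/eqP; ring.
Qed.

Lemma Cc1_L2graph f : Cc1 O f ->
  exists w : H10 O, Cc1_graph O w /\ (H10_fun w : _ -> _) = f.
Proof.
move=> Cf; have [w0 w0E] := C00_L2 bO oO (Cc1_C00 Cf).
have /choice[w1 w1E] i := C00_L2 bO oO (Cc1_partial_C00 i Cf).
pose w : pre_H10 R d := (w0, [ffun i => w1 i]).
have Gw : Cc1_graph O w.
  by split=> [|i x]; rewrite /= ?w0E// ffunE w1E.
have Hw : w \in H10_pred O.
  rewrite inE => e e0; exists w; split=> //.
    by rewrite subrr L2norm0.
  by move=> i; rewrite subrr L2norm0.
by exists (MkH10 Hw).
Qed.

Lemma Cc1_graph_inj (w w' : H10 O) : Cc1_graph O w -> Cc1_graph O w' ->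
  H10_fun w =1 H10_fun w' -> w = w'.
Proof.
move=> [Cw gw] [Cw' gw'] ww'; apply: val_inj => /=.
have E : (H10_val w).1 = (H10_val w').1 by apply/LfuneqP.
rewrite [LHS]surjective_pairing [RHS]surjective_pairing; congr pair => //.
by apply/ffunP => i; apply/LfuneqP => x; rewrite gw gw' E.
Qed.

Lemma H10norm_graph (w : H10 O) : Cc1_graph O w -> H10norm w = gradnorm (H10_fun w).
Proof.
move=> [Cw gw]; rewrite /H10norm /gradnorm; congr Num.sqrt; apply: eq_bigr => i _.
have E : (H10_grad w i : _ -> _) = partial i (H10_fun w) by apply/funext => x; exact: gw.
rewrite (L2norm_sqr bO oO); last by rewrite E; exact: Cc1_partial_C00.
by rewrite E.
Qed.

Lemma H10normD (w w' : H10 O) : H10norm (w + w') <= H10norm w + H10norm w'.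
Proof.
apply: le_trans (sum_minkowski _ _); rewrite ler_wsqrtr//; apply: ler_sum => i _.
rewrite lerXn2r ?nnegrE ?addr_ge0 ?L2norm_ge0//.
by apply: le_trans (L2normD _ _); rewrite /H10_grad/= ffunE.
Qed.

Lemma H10_dense (w : H10 O) e : 0 < e -> exists w' : H10 O,
  [/\ Cc1_graph O w', L2norm (H10_fun w - H10_fun w') <= e & H10norm (w - w') <= e].
Proof.
move=> e0; have sd : 0 < Num.sqrt d%:R + 1 :> R by rewrite ltr_wpDl// sqrtr_ge0.
pose s := e / (Num.sqrt d%:R + 1); have s0 : 0 < s by rewrite divr_gt0.
have se : s <= e by rewrite ler_pdivrMr// ler_peMr ?(ltW e0)// lerDr sqrtr_ge0.
have := valP w; rewrite inE => /(_ s s0)[w' [Gw' w1 w2]].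
have Hw' : w' \in H10_pred O.
  rewrite inE => a a0; exists w'; split=> //.
    by rewrite subrr L2norm0.
  by move=> i; rewrite subrr L2norm0.
exists (MkH10 Hw'); split=> //; first by rewrite (le_trans (ltW w1)).
rewrite /H10norm (@le_trans _ _ (Num.sqrt (\sum_(i < d) s ^+ 2)))//.
  rewrite ler_wsqrtr//; apply: ler_sum => i _.
  rewrite lerXn2r ?nnegrE ?L2norm_ge0 ?(ltW s0)//.
  by have := w2 i; rewrite /H10_grad/= !ffunE => /ltW.
rewrite sumr_const card_ord -mulr_natl sqrtrM// sqrtr_sqr gtr0_norm//.
by rewrite /s mulrC -mulrA ler_piMr ?(ltW e0)// mulrC ler_pdivrMr// mul1r lerDl.
Qed.

Lemma H10_fun_lin a (w w' : H10 O) x :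
  H10_fun (a *: w + w') x = a * H10_fun w x + H10_fun w' x.
Proof. by []. Qed.

Lemma Hm1_lin (u : Hm1 O) a (w w' : H10 O) : u (a *: w + w') = a * u w + u w'.
Proof. by have [lu _] := Hm1_spec u; exact: lu. Qed.

(* The action of [u] on a C^1_c function, seen as an element of H^1_0 through its
   classical gradient; 0 outside C^1_c. *)
Definition app (u : Hm1 O) f : R :=
  if pselect (exists w : H10 O, Cc1_graph O w /\ (H10_fun w : _ -> _) = f)
  is left h then u (projT1 (cid h)) else 0.

Lemma appE (u : Hm1 O) (w : H10 O) : Cc1_graph O w -> app u (H10_fun w) = u w.
Proof.
move=> Gw; rewrite /app; case: pselect => [h|[]]; last by exists w.
case: cid => w' /= [Gw' ww']; congr (Hm1_val u _); apply: Cc1_graph_inj => // x.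
by rewrite ww'.
Qed.

Lemma app_lin (u : Hm1 O) a f g : Cc1 O f -> Cc1 O g ->
  app u (fun x => a * f x + g x) = a * app u f + app u g.
Proof.
move=> /Cc1_L2graph[w [Gw <-]] /Cc1_L2graph[w' [Gw' <-]].
rewrite !appE// -Hm1_lin -appE; last exact: Cc1_graph_lin.
by congr (app u); apply/funext.
Qed.

Lemma app0 (u : Hm1 O) : app u (fun=> 0) = 0.
Proof.
have := app_lin u (-1) (Cc1_0 O) (Cc1_0 O); rewrite mulN1r addNr; apply: etrans.
by congr (app u); apply/funext => x; rewrite /= mulr0 addr0.
Qed.

Lemma Cc1Z a f : Cc1 O f -> Cc1 O (fun x => a * f x).
Proof. by move=> Cf; have := Cc1_lin a Cf (Cc1_0 O); under eq_fun do rewrite addr0. Qed.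

Lemma appZ (u : Hm1 O) a f : Cc1 O f -> app u (fun x => a * f x) = a * app u f.
Proof.
move=> Cf; have := app_lin u a Cf (Cc1_0 O); rewrite app0 addr0 => <-.
by congr (app u); apply/funext => x; rewrite addr0.
Qed.

Lemma le_app (u : Hm1 O) f : Cc1 O f -> `|app u f| <= `|u| * gradnorm f.
Proof.
move=> /Cc1_L2graph[w [Gw <-]]; rewrite appE// -H10norm_graph//.
exact: Hm1normP.
Qed.

Lemma Hm1_norm_le (u : Hm1 O) c : 0 <= c ->
  (forall f, Cc1 O f -> `|app u f| <= c * gradnorm f) -> `|u| <= c.
Proof.
move=> c0 uc; apply: ge_sup; first exact: (Hm1norm_has_sup u).1.
move=> _ [w /= w1 <-]; apply/ler_addgt0Pr => e e0.
pose k := `|u| + c + 1; have k0 : 0 < k by rewrite ltr_wpDl// addr_ge0.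
have ek : 0 < e / k by rewrite divr_gt0.
have [w' [Gw' _ ww']] := H10_dense w ek.
have -> : u w = u (w - w') + u w'.
  by rewrite -[w - w']addrC -scaleN1r Hm1_lin mulN1r addrC addrA subrr add0r.
rewrite (le_trans (ler_normD _ _))//.
have h1 : `|u (w - w')| <= `|u| * (e / k).
  exact: le_trans (Hm1normP u _) (ler_wpM2l (normr_ge0 u) ww').
have h2 : `|u w'| <= c * (e / k) + c.
  rewrite -appE//; apply: le_trans (uc _ Gw'.1) _; rewrite -H10norm_graph//.
  rewrite -[X in _ + X]mulr1 -mulrDr ler_wpM2l//.
  have -> : w' = w + (-1) *: (w - w') by rewrite scaleN1r opprB addrC subrK.
  rewrite (le_trans (H10normD _ _))// addrC lerD// H10normZ normrN normr1 mul1r//.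
rewrite (le_trans (lerD h1 h2))// addrA -mulrDl addrC lerD2l.
by rewrite mulrCA ler_piMr ?(ltW e0)// ler_pdivrMr// mul1r lerDl.
Qed.

End sobolev_theory.

Section L2_theory.
Context (R : realType) (d : nat).
Local Notation leb := (lebesgue_rV R d).

Lemma L2_mul_integrable (f g : L2 R d) : leb.-integrable setT (EFin \o (fun x => f x * g x)).
Proof.
apply/Lfun1_integrable; apply: (Lfun2_mul_Lfun1 (f := f) (g := g)); exact: LfunP.
Qed.

Lemma L2_cauchy_schwarz (f g : L2 R d) :
  `|\int[leb]_x (f x * g x)| <= L2norm f * L2norm g.
Proof.
apply: (le_trans (le_normr_Rintegral _ (L2_mul_integrable f g))) => //.
have mL2 (h : L2 R d) : measurable_fun setT (h : _ -> _) by exact: measurable_funPT.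
have H := hoelder leb (mL2 f) (mL2 g) (ltr0n R 2) (ltr0n R 2).
rewrite -lee_fin EFinM /L2norm !finite_norm_fine.
rewrite /Rintegral fineK; last first.
  have /integrable_norm/(integrable_fin_num measurableT) := L2_mul_integrable f g.
  exact.
apply: le_trans (H _); last by rewrite [RHS]splitr !div1r.
by rewrite Lnorm1.
Qed.

End L2_theory.

Section poincare_on_domain.
Context (R : realType).

Lemma poincare_Cc1 d (O : set 'rV[R]_d) : (0 < d)%N -> bounded_set O -> open O ->
  exists2 C : R, 0 < C & forall f, Cc1 O f ->
    intO O (fun x => f x ^+ 2) <= C ^+ 2 * dirichlet O f f.
Proof.
case: d O => // d O _ bO oO; have [B B0 OB] := bounded_set_coord bO.
pose L := B + 1; have L0 : 0 < L by rewrite ltr_wpDl// ltW.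
exists (2 * L); first by rewrite mulr_gt0.
move=> f Cf; have Cf0 := Cc1_C00 Cf.
have C2 : C00 O (fun x => f x ^+ 2).
  by under eq_fun do rewrite expr2; apply: C00Mr => //; exact: Cf0.1.
have Cg i : C00 O (fun x => partial i f x ^+ 2).
  have Cp := Cc1_partial_C00 i Cf.
  by under eq_fun do rewrite expr2; apply: C00Mr => //; exact: Cp.1.
have fL (x : 'rV[R]_d.+1) : L <= `|x ord0 ord0| -> f x = 0.
  move=> Lx; apply: Cf0.2 => Ox; have := OB x ord0 Ox.
  by apply/negP; rewrite -ltNge (lt_le_trans _ Lx)// ltrDl.
have := poincare L0 (Cc1_grad Cf) fL.
have cv h : C00 O h -> (\int[lebesgue_rV R d.+1]_x (h x)%:E = (intO O h)%:E)%E.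
  by move=> Ch; rewrite intO_EFin// -[in RHS](setTI O) C00_setI_integral.
rewrite (cv _ C2) (cv _ (Cg ord0)) -EFinM lee_fin => /le_trans; apply.
rewrite exprMn -natrX; apply: ler_wpM2l.
  by apply: mulr_ge0 => //; exact: sqr_ge0.
rewrite /dirichlet (bigD1 ord0)//= ler_wpDr//.
  by apply: sumr_ge0 => i _; apply: intO_ge0 => x; rewrite -expr2 sqr_ge0.
Qed.

Variables (d : nat) (O : set 'rV[R]_d).
Hypothesis (d0 : (0 < d)%N) (bO : bounded_set O) (oO : open O).

Lemma poincare_H10 : exists2 C : R, 0 < C &
  forall w : H10 O, L2norm (H10_fun w) <= C * H10norm w.
Proof.
have [C C0 HC] := poincare_Cc1 d0 bO oO; exists C => // w.
apply/ler_addgt0Pr => e e0; pose k := 1 + C.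
have k0 : 0 < k by rewrite addr_gt0.
have ek : 0 < e / k by rewrite divr_gt0.
have [w' [Gw' h1 h2]] := H10_dense w ek.
have h3 : L2norm (H10_fun w') <= C * H10norm w'.
  rewrite (H10norm_graph bO oO Gw').
  rewrite -(@ler_pXn2r _ 2)// ?nnegrE ?L2norm_ge0 ?mulr_ge0 ?gradnorm_ge0 ?(ltW C0)//.
  rewrite (L2norm_sqr bO oO (Cc1_C00 Gw'.1)) exprMn gradnorm_sqr.
  exact: HC Gw'.1.
have h4 : H10norm w' <= H10norm w + e / k.
  have -> : w' = w + (-1) *: (w - w') by rewrite scaleN1r opprB addrC subrK.
  by rewrite (le_trans (H10normD _ _))// lerD// H10normZ normrN normr1 mul1r.
have -> : H10_fun w = (H10_fun w - H10_fun w') + H10_fun w' by rewrite subrK.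
rewrite (le_trans (L2normD _ _))//.
have h5 : C * H10norm w' <= C * (H10norm w + e / k) by rewrite ler_wpM2l// ltW.
have h6 : e / k + C * (e / k) = e.
  by rewrite -[X in X + _]mul1r -mulrDl -/k mulrC divfK// gt_eqF.
by lra.
Qed.

Lemma C00_Hm1 f : C00 O f -> exists u : Hm1 O, forall h, Cc1 O h ->
  app u h = intO O (fun x => h x * f x).
Proof.
move=> Cf; have [w0 w0E] := C00_L2 bO oO Cf.
have [C C0 HC] := poincare_H10.
pose F (w : H10 O) : R^o := \int[lebesgue_rV R d]_x (w0 x * H10_fun w x).
have Fu : F \in @Hm1_pred R d O.
  rewrite inE; split.
    move=> a w w'; have I1 := L2_mul_integrable w0 (H10_fun w).
    have I2 := L2_mul_integrable w0 (H10_fun w').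
    transitivity (\int[lebesgue_rV R d]_x
        (a * (w0 x * H10_fun w x) + w0 x * H10_fun w' x)).
      by apply: eq_Rintegral => x _; rewrite H10_fun_lin; ring.
    rewrite RintegralD//; last exact: (integrableZl measurableT a I1).
    by rewrite RintegralZl.
  exists (L2norm w0 * C) => w; rewrite (le_trans (L2_cauchy_schwarz _ _))//.
  by rewrite -mulrA ler_wpM2l ?L2norm_ge0.
exists (MkHm1 Fu) => h Ch; have [w [Gw wh]] := Cc1_L2graph bO oO Ch.
rewrite -wh appE//= /F; have Chf : C00 O (fun x => h x * f x).
  by apply: C00Mr; [exact: Cc1_C00|exact: Cf.1].
apply: EFin_inj; rewrite wh intO_EFin// -(setTI O) C00_setI_integral//.
rewrite /Rintegral fineK; last first.
  by have /(integrable_fin_num measurableT) := L2_mul_integrable w0 (H10_fun w); rewrite wh.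
by apply: eq_integral => x _; rewrite w0E mulrC.
Qed.

End poincare_on_domain.

(** * Convex functions of a measure *)

Section measure_function.
Context (R : realType) (d : nat) (O : set 'rV[R]_d) (psi : R -> R).
Hypothesis (bO : bounded_set O) (oO : open O) (Hpsi : integrand psi).
Local Notation leb := (lebesgue_rV R d).
Local Notation conj := (conjugate psi).
Local Notation M := (slope psi).
Implicit Types (v w : 'rV[R]_d -> R) (eta : 'rV[R]_d -> R).

Let mO : measurable O. Proof. exact: open_measurable_mx. Qed.

Definition intconj v : \bar R := (\int[leb]_(x in O) conj (v x))%E.

Definition admissible v := @conj_domain R d O psi v.

Let M0 : 0 < M. Proof. exact: slope_gt0. Qed.

Let mconj v : continuous v -> measurable_fun O (fun x => conj (v x)).
Proof. by move=> cv; apply: measurable_funTS; exact: conj_measurable. Qed.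

Lemma admissible_intro v (F : 'rV[R]_d -> \bar R) : Cc0 O v ->
  leb.-integrable O F -> (forall x, O x -> (conj (v x) <= F x)%E) -> admissible v.
Proof.
move=> Cv iF vF; split=> //; apply: le_integrable iF => //.
  by apply: mconj; case: Cv.
move=> x Ox; rewrite !gee0_abs ?conj_ge0//; first exact: vF.
by apply: le_trans (vF x Ox); exact: conj_ge0.
Qed.

(** The set where [|v|] exceeds the slope is open and the conjugate is infinite on it; if nonempty
    it has positive measure, against integrability. *)
Lemma admissible_bound v : admissible v -> forall x, `|v x| <= M.
Proof.
move=> [Cv iv] x; rewrite leNgt; apply/negP => vx.
have Cv0 := Cc0_C00 Cv.
have Ox : O x.
  apply: contrapT => Ox; move: vx; rewrite Cv0.2// normr0; apply/negP.
  by rewrite -leNgt ltW.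
pose U := O `&` [set y | M < `|v y|].
have oU : open U.
  by apply: openI => //; apply: open_gt; apply: continuous_abs_fun; exact: Cv0.1.
have mU : measurable U by exact: open_measurable_mx.
have U0 : (0 < leb U)%E by apply: (lebesgue_rV_open_gt0 (x := x)).
have : (\int[leb]_(x in U) conj (v x) < +oo)%E.
  apply: (@le_lt_trans _ _ (\int[leb]_(x in O) conj (v x))%E).
    apply: ge0_subset_integral => //; do ?[by apply: mconj; exact: Cv0.1
      |by move=> y _; exact: conj_ge0|by move=> y []].
  have := integrable_fin_num mO iv; rewrite ge0_fin_numE//.
  by apply: integral_ge0 => y _; exact: conj_ge0.
rewrite (eq_integral (cst +oo%E)); last first.
  by move=> y; rewrite inE => -[_ /= h]; rewrite conj_pinfty.
by rewrite integral_cst// gt0_mulye.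
Qed.

Lemma intconj_ge0 v : (0 <= intconj v)%E.
Proof. by apply: integral_ge0 => x _; exact: conj_ge0. Qed.

Lemma intconj_fin v : admissible v -> intconj v \is a fin_num.
Proof. by move=> [_ iv]; exact: integrable_fin_num. Qed.

Lemma le_intconj v w e : continuous v -> admissible w -> 0 <= e ->
  (forall x, O x -> (conj (v x) <= conj (w x) + e%:E)%E) ->
  (intconj v <= intconj w + (e * volO O)%:E)%E.
Proof.
move=> cv [Cw iw] e0 vw; have cw : continuous w by case: Cw.
rewrite /volO EFinM fineK; last first.
  by rewrite ge0_fin_numE//; exact: leb_finO.
rewrite -integral_cst// -ge0_integralD//; last 2 first.
- by move=> x _; exact: conj_ge0.
- exact: mconj.
apply: ge0_le_integral => //.
- by move=> x _; exact: conj_ge0.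
- exact: mconj.
- by apply: emeasurable_funD => //; exact: mconj.
Qed.

Lemma admissible_scale v theta : 0 <= theta <= 1 -> admissible v ->
  (forall x, (conj (theta * v x) <= conj (v x))%E) /\ admissible (fun x => theta * v x).
Proof.
move=> /andP[t0 t1] Dv; have [Cv iv] := Dv.
have H x : (conj (theta * v x) <= conj (v x))%E.
  have := conj_convex Hpsi (v x) 0 t0 (lexx 0).
  rewrite addr0 mulr0 addr0 conj0// mule0 adde0 => /(_ t1) /le_trans; apply.
  by rewrite -[leRHS]mul1e; apply: lee_wpmul2r; rewrite ?conj_ge0// lee_fin.
split=> //; apply: admissible_intro iv _ => //.
have := Cc0_lin (theta - 1) Cv Cv.
by under eq_fun do rewrite mulrBl mul1r subrK.
Qed.

Lemma admissible_mul v eta : C00 O eta -> (forall x, 0 <= eta x <= 1) ->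
  admissible v ->
  (forall x, (conj (v x * eta x) <= conj (v x) * (eta x)%:E)%E) /\
  admissible (fun x => v x * eta x).
Proof.
move=> Ceta e01 Dv; have [Cv iv] := Dv.
have H x : (conj (v x * eta x) <= conj (v x) * (eta x)%:E)%E.
  have /andP[t0 t1] := e01 x.
  have := conj_convex Hpsi (v x) 0 t0 (lexx 0).
  rewrite addr0 mulr0 addr0 conj0// mule0 adde0 => /(_ t1).
  by rewrite mulrC muleC.
split=> //; apply: admissible_intro iv _ => [|x Ox].
  have [cv kv vO] := Cv.
  apply: (@Cc0_subset _ _ _ bO _ (Defs.support v)) => //.
  - by apply: continuousM_fun => //; exact: Ceta.1.
  - exact: closed_closure.
  - move=> x h; apply: subset_closure => /=; apply: contraNneq h => ->.
    by rewrite mul0r.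
apply: le_trans (H x) _; rewrite -[leRHS]mule1; apply: lee_wpmul2l.
  exact: conj_ge0.
by rewrite lee_fin; case/andP : (e01 x).
Qed.

Lemma admissible0 : admissible (fun=> 0).
Proof.
have C0 : Cc0 O (fun=> 0 : R) by case: (Cc1_0 O).
apply: (admissible_intro C0 (F := fun=> 0%E)); first exact: integrable0.
by move=> x _; rewrite conj0.
Qed.

Lemma intconj0 : intconj (fun=> 0) = 0%E.
Proof. by rewrite /intconj; under eq_integral do rewrite conj0//; rewrite integral0. Qed.

Lemma admissible_small v a : a < M -> Cc0 O v -> (forall x, `|v x| <= a) -> admissible v.
Proof.
move=> aM Cv va; have [Y Y0 HY] := conj_fin Hpsi aM.
apply: (admissible_intro Cv (F := fun=> (a * Y)%:E)); last by move=> x _; exact: HY.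
by apply: (integrableO bO oO (f := fun=> a * Y) (M := `|a * Y|)) => //; exact: measurable_cst.
Qed.

(** * The measure psi(mu) and its total variation *)

Section fixed_measure.
Variable mu : {charge set 'rV[R]_d -> \bar R}.

Let TV := charge_tv mu.

Let TV0 : 0 <= TV. Proof. exact: charge_tv_ge0. Qed.

Lemma admissible_C00 v : admissible v -> C00 O v.
Proof. by move=> [/Cc0_C00]. Qed.

Let J v eta := (\int[leb]_(x in O) (conj (v x) * (eta x)%:E))%E.

Let J_fun_ge0 v eta x : 0 <= eta x -> (0 <= conj (v x) * (eta x)%:E)%E.
Proof. by move=> e0; rewrite mule_ge0 ?conj_ge0// lee_fin. Qed.

Let J_ge0 v eta : (forall x, 0 <= eta x) -> (0 <= J v eta)%E.
Proof. by move=> e0; apply: integral_ge0 => x _; exact: J_fun_ge0. Qed.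

Let mJ v eta : continuous v -> continuous eta ->
  measurable_fun O (fun x => conj (v x) * (eta x)%:E)%E.
Proof.
move=> cv ce; apply: emeasurable_funM; first exact: mconj.
by apply/measurable_EFinP; apply: measurable_funTS; exact: continuous_measurable_rV.
Qed.

Let J_fin v eta : admissible v -> C00 O eta -> (forall x, 0 <= eta x) ->
  J v eta \is a fin_num.
Proof.
move=> [Cv iv] Ce e0; have cv : continuous v by case: Cv.
have [c c0 ec] := C00_bounded bO Ce.
rewrite ge0_fin_numE ?J_ge0//; apply: (@le_lt_trans _ _ (c%:E * intconj v)%E).
  rewrite -ge0_integralZl//; [|exact: mconj|by move=> x _; exact: conj_ge0|by rewrite lee_fin ltW].
  apply: ge0_le_integral => //.
  - by move=> x _; exact: J_fun_ge0.
  - by apply: mJ => //; exact: Ce.1.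
  - by apply: measurable_funeM; exact: mconj.
  - move=> x _; rewrite muleC; apply: lee_wpmul2r; first exact: conj_ge0.
    by rewrite lee_fin (le_trans (ler_norm _)).
by rewrite lte_mul_pinfty// ?lee_fin ?(ltW c0)// -ge0_fin_numE ?intconj_ge0// intconj_fin.
Qed.

Let val v eta : R := charge_int mu (fun x => v x * eta x) - fine (J v eta).

Let vals eta := [set val v eta | v in admissible].

Let Lam eta := sup (vals eta).

Let C00M v eta : C00 O v -> C00 O eta -> C00 O (fun x => v x * eta x).
Proof. by move=> Cv Ce; apply: C00Mr => //; exact: Ce.1. Qed.

Let val_le v eta c : admissible v -> C00 O eta -> (forall x, 0 <= eta x <= c) ->
  val v eta <= TV * (M * c).
Proof.
move=> Dv Ce ec; rewrite lerBlDr (@le_trans _ _ (TV * (M * c)))//; last first.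
  by rewrite lerDl fine_ge0// J_ge0// => x; case/andP : (ec x).
apply: le_trans (ler_norm _) _; apply: le_charge_int.
  exact: (C00M (admissible_C00 Dv) Ce).1.
move=> x; rewrite normrM; have /andP[e0 e1] := ec x.
by rewrite ler_pM// ?admissible_bound// ger0_norm.
Qed.

Let has_sup_vals eta : C00 O eta -> (forall x, 0 <= eta x) -> has_sup (vals eta).
Proof.
move=> Ce e0; split; first by exists (val (fun=> 0) eta), (fun=> 0) => //; exact: admissible0.
have [c c0 ec] := C00_bounded bO Ce; exists (TV * (M * c)) => _ [v Dv <-].
by apply: val_le => // x; rewrite e0 (le_trans (ler_norm _)).
Qed.

Let val_Lam v eta : admissible v -> C00 O eta -> (forall x, 0 <= eta x) -> val v eta <= Lam eta.
Proof. by move=> Dv Ce e0; apply: (sup_upper_bound (has_sup_vals Ce e0)); exists v. Qed.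

Let charge_intD f g : C00 O f -> C00 O g ->
  charge_int mu (fun x => f x + g x) = charge_int mu f + charge_int mu g.
Proof.
move=> Cf Cg; have [Mf _ fM] := C00_bounded bO Cf; have [Mg _ gM] := C00_bounded bO Cg.
have := charge_int_lin mu 1 Cf.1 fM Cg.1 gM; rewrite mul1r => <-.
by congr charge_int; apply/funext => x; rewrite mul1r.
Qed.

Let JD v eta1 eta2 : admissible v -> C00 O eta1 -> C00 O eta2 ->
  (forall x, 0 <= eta1 x) -> (forall x, 0 <= eta2 x) ->
  J v (fun x => eta1 x + eta2 x) = (J v eta1 + J v eta2)%E.
Proof.
move=> [Cv iv] C1 C2 e1 e2; have cv : continuous v by case: Cv.
rewrite /J -ge0_integralD//.
- by apply: eq_integral => x _; rewrite EFinD ge0_muleDr ?lee_fin.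
- by move=> x _; exact: J_fun_ge0.
- by apply: mJ => //; exact: C1.1.
- by move=> x _; exact: J_fun_ge0.
- by apply: mJ => //; exact: C2.1.
Qed.

Let charge_int0 : charge_int mu (fun=> 0) = 0.
Proof.
have c0 : continuous ((fun=> 0) : 'rV[R]_d -> R) by exact: cst_continuous.
have n0 (x : 'rV[R]_d) : `|0 : R| <= 0 by rewrite normr0.
by have := le_charge_int mu c0 n0; rewrite mulr0 normr_le0 => /eqP.
Qed.

Let val0 eta : val (fun=> 0) eta = 0.
Proof.
rewrite /val (_ : J _ _ = 0%E).
  by rewrite subr0; under eq_fun do rewrite mul0r.
by rewrite /J; under eq_integral do rewrite conj0// mul0e; rewrite integral0.
Qed.

Let valD v eta1 eta2 : admissible v -> C00 O eta1 -> C00 O eta2 ->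
  (forall x, 0 <= eta1 x) -> (forall x, 0 <= eta2 x) ->
  val v (fun x => eta1 x + eta2 x) = val v eta1 + val v eta2.
Proof.
move=> Dv C1 C2 e1 e2; have Cv := admissible_C00 Dv.
rewrite /val JD// fineD ?J_fin//.
under eq_fun do rewrite mulrDr.
by rewrite charge_intD; [ring|exact: C00M|exact: C00M].
Qed.

(** Superadditivity of [Lam]: two competitors are averaged with weights [eta1 / (eta1 + eta2)] and
    [eta2 / (eta1 + eta2)], and convexity of the conjugate keeps the penalty below the sum of the
    two. Adding [e] to the denominator keeps the weights continuous where both functions vanish; the
    error in the linear part is [v e], bounded by the slope times [e]. *)
Let val_merge v1 v2 eta1 eta2 e : admissible v1 -> admissible v2 ->
  C00 O eta1 -> C00 O eta2 -> (forall x, 0 <= eta1 x) -> (forall x, 0 <= eta2 x) ->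
  0 < e -> val v1 eta1 + val v2 eta2 <= Lam (fun x => eta1 x + eta2 x) + TV * (M * e).
Proof.
move=> D1 D2 C1 C2 e1 e2 e0.
pose den x := eta1 x + eta2 x + e.
have den0 x : 0 < den x by rewrite ltr_wpDl// addr_ge0.
have cden : continuous den.
  apply: continuousD_fun; last exact: cst_continuous.
  by apply: continuousD_fun; [exact: C1.1|exact: C2.1].
have cinv : continuous (fun x => (den x)^-1).
  by move=> x; apply: (@continuousV _ _ den) => //; [rewrite gt_eqF|exact: cden].
pose q1 x := eta1 x * (den x)^-1; pose q2 x := eta2 x * (den x)^-1.
have Cq1 : C00 O q1 by exact: C00Mr.
have Cq2 : C00 O q2 by exact: C00Mr.
have q10 x : 0 <= q1 x by rewrite divr_ge0// ltW.
have q20 x : 0 <= q2 x by rewrite divr_ge0// ltW.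
have q12 x : q1 x + q2 x <= 1.
  by rewrite -mulrDl ler_pdivrMr// mul1r lerDl ltW.
have q11 x : 0 <= q1 x <= 1 by rewrite q10 (le_trans _ (q12 x))// lerDl.
have q21 x : 0 <= q2 x <= 1 by rewrite q20 (le_trans _ (q12 x))// lerDr.
pose v x := v1 x * q1 x + v2 x * q2 x.
have [_ [Cw1 _]] := admissible_mul Cq1 q11 D1.
have [_ [Cw2 _]] := admissible_mul Cq2 q21 D2.
have Cv : Cc0 O v.
  by have := Cc0_lin 1 Cw1 Cw2; under eq_fun do rewrite mul1r.
have vle x : (conj (v x) <= (q1 x)%:E * conj (v1 x) + (q2 x)%:E * conj (v2 x))%E.
  by rewrite /v [v1 x * _]mulrC [v2 x * _]mulrC; exact: conj_convex.
have Dv : admissible v.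
  apply: (admissible_intro Cv (F := (fun x => conj (v1 x) + conj (v2 x))%E)).
    by apply: integrableD => //; [exact: D1.2|exact: D2.2].
  move=> x _; apply: le_trans (vle x) _; apply: leeD.
    rewrite -[leRHS]mul1e; apply: lee_wpmul2r; rewrite ?conj_ge0// lee_fin.
    by case/andP : (q11 x).
  rewrite -[leRHS]mul1e; apply: lee_wpmul2r; rewrite ?conj_ge0// lee_fin.
  by case/andP : (q21 x).
have C12 : C00 O (fun x => eta1 x + eta2 x) by exact: C00D.
have e12 x : 0 <= eta1 x + eta2 x by rewrite addr_ge0.
have cv1 := (admissible_C00 D1).1; have cv2 := (admissible_C00 D2).1.
have Jle : fine (J v (fun x => eta1 x + eta2 x)) <= fine (J v1 eta1) + fine (J v2 eta2).
  have [F1 F2] := (J_fin D1 C1 e1, J_fin D2 C2 e2).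
  rewrite -fineD//; apply: fine_le; [exact: J_fin|by rewrite fin_numD F1|].
  rewrite /J -ge0_integralD//; last 4 first.
  - by move=> x _; exact: J_fun_ge0.
  - by apply: mJ => //; exact: C1.1.
  - by move=> x _; exact: J_fun_ge0.
  - by apply: mJ => //; exact: C2.1.
  apply: ge0_le_integral => //.
  - by move=> x _; rewrite mule_ge0 ?conj_ge0// lee_fin.
  - by apply: mJ; [case: Cv|exact: C12.1].
  - by apply: emeasurable_funD; apply: mJ => //; [exact: C1.1|exact: C2.1].
  move=> x _; apply: le_trans (lee_wpmul2r _ (vle x)) _; first by rewrite lee_fin.
  have k i : i = eta1 x \/ i = eta2 x ->
      (i / den x) * (eta1 x + eta2 x) <= i.
    move=> hi; have i0 : 0 <= i by case: hi => ->.
    by rewrite mulrAC ler_pdivrMr// ler_wpM2l// lerDl ltW.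
  rewrite ge0_muleDl ?mule_ge0 ?conj_ge0 ?lee_fin//.
  apply: leeD.
    rewrite muleAC muleC; apply: lee_wpmul2l; first exact: conj_ge0.
    by rewrite -EFinM lee_fin k; [|left].
  rewrite muleAC muleC; apply: lee_wpmul2l; first exact: conj_ge0.
  by rewrite -EFinM lee_fin k; [|right].
have := val_Lam Dv C12 e12.
rewrite {1}/val.
have mergeE : charge_int mu (fun x => v1 x * eta1 x) + charge_int mu (fun x => v2 x * eta2 x)
    <= charge_int mu (fun x => v x * (eta1 x + eta2 x)) + TV * (M * e).
  have CL : C00 O (fun x => v1 x * eta1 x + v2 x * eta2 x).
    by apply: C00D; apply: C00M => //; exact: admissible_C00.
  have CR : C00 O (fun x => v x * (eta1 x + eta2 x)) by apply: C00M => //; exact: admissible_C00.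
  rewrite -charge_intD; last 2 first.
  - by apply: C00M => //; exact: admissible_C00.
  - by apply: C00M => //; exact: admissible_C00.
  rewrite -lerBlDl.
  have [ML _ hML] := C00_bounded bO CL; have [MR _ hMR] := C00_bounded bO CR.
  have := charge_int_lin mu (-1) CR.1 hMR CL.1 hML.
  rewrite mulN1r addrC => <-.
  apply: le_trans (ler_norm _) _; apply: le_charge_int.
    apply: continuousD_fun; last exact: CL.1.
    by apply: continuousM_fun; [exact: cst_continuous|exact: CR.1].
  move=> x.
  have dx := den0 x.
  have -> : -1 * (v x * (eta1 x + eta2 x)) + (v1 x * eta1 x + v2 x * eta2 x) =
      v x * e.
    rewrite /v /q1 /q2; have : den x = eta1 x + eta2 x + e by [].
    move: dx; set D := den x => dx hD.
    have D0 : D != 0 by rewrite gt_eqF.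
    by rewrite (_ : e = D - (eta1 x + eta2 x)) ?hD; [field|ring].
  rewrite normrM (ger0_norm (ltW e0)) ler_wpM2r ?(ltW e0)//.
  exact: admissible_bound.
rewrite /val; move: Jle mergeE.
set a := charge_int _ _; set b := charge_int _ _; set c := charge_int _ _.
set p := fine _; set q := fine _; set r := fine _; set l := Lam _; lra.
Qed.

Let LamD : additive_C00 O Lam.
Proof.
move=> eta1 eta2 C1 C2 e1 e2.
have C12 : C00 O (fun x => eta1 x + eta2 x) by exact: C00D.
have e12 x : 0 <= eta1 x + eta2 x by rewrite addr_ge0.
apply/eqP; rewrite eq_le; apply/andP; split.
  apply: ge_sup => [|_ [v Dv <-]]; first exact: (has_sup_vals C12 e12).1.
  by rewrite valD// lerD// val_Lam.
rewrite -lerBrDr; apply: ge_sup => [|_ [v1 D1 <-]]; first exact: (has_sup_vals C1 e1).1.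
rewrite lerBrDr -lerBrDl; apply: ge_sup => [|_ [v2 D2 <-]].
  exact: (has_sup_vals C2 e2).1.
rewrite lerBrDl; apply/ler_addgt0Pr => e e0.
have t0 : 0 < TV * M + 1 by rewrite ltr_wpDl// mulr_ge0// ltW.
have := val_merge D1 D2 C1 C2 e1 e2 (divr_gt0 e0 t0).
move/le_trans; apply; rewrite lerD2l mulrA mulrCA ler_piMr ?(ltW e0)//.
by rewrite ler_pdivrMr// mul1r lerDl.
Qed.

Let LamK eta c : C00 O eta -> (forall x, 0 <= eta x <= c) -> 0 <= Lam eta <= (TV * M) * c.
Proof.
move=> Ce ec; have e0 x : 0 <= eta x by case/andP : (ec x).
apply/andP; split; first by rewrite -(val0 eta); apply: val_Lam => //; exact: admissible0.
apply: ge_sup => [|_ [v Dv <-]]; first exact: (has_sup_vals Ce e0).1.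
by rewrite -mulrA; exact: val_le.
Qed.

Let valE v eta : admissible v -> C00 O eta -> (forall x, 0 <= eta x) ->
  (val v eta)%:E = ((charge_int mu (fun x => v x * eta x))%:E - J v eta)%E.
Proof. by move=> Dv Ce e0; rewrite EFinB fineK// J_fin. Qed.

Lemma measure_fun_ex : exists nu, is_measure_fun O psi mu nu.
Proof.
have [m [mO0 mE]] := riesz_C00_positive bO LamD LamK oO.
have [nu nuE] := charge_of_diff m (mzero : {finite_measure set 'rV[R]_d -> \bar R}).
have nuE' A : measurable A -> nu A = m A by move=> mA; rewrite nuE// sube0.
exists nu; split.
- by move=> A mA AO; rewrite nuE'// mO0.
- by move=> A mA; rewrite nuE'.
move=> eta Ce e0; have [c _ ec] := C00_bounded bO Ce.
rewrite (charge_int_diff nuE Ce.1 ec) mE// [X in _ - X](_ : _ = 0); last first.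
  by rewrite /Rintegral integral_measure_zero.
rewrite subr0 /Lam -ereal_sup_EFin; last 2 first.
- exact: (has_sup_vals Ce e0).2.
- exact: (has_sup_vals Ce e0).1.
congr ereal_sup; rewrite image_comp; apply: eq_imagel => v Dv /=.
exact: valE.
Qed.

Let cutoff_C00 n : C00 O (cutoff O n).
Proof. by split; [exact: continuous_cutoff|move=> x; exact: cutoff_out]. Qed.

Let cutoff01 n x : 0 <= cutoff O n x <= 1.
Proof. by rewrite cutoff_ge0 cutoff_le1. Qed.

Let charge_intB v w e : C00 O v -> C00 O w -> (forall x, `|v x - w x| <= e) ->
  `|charge_int mu v - charge_int mu w| <= TV * e.
Proof.
move=> Cv Cw vwe.
have [Mv _ hv] := C00_bounded bO Cv; have [Mw _ hw] := C00_bounded bO Cw.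
have := charge_int_lin mu (-1) Cw.1 hw Cv.1 hv; rewrite mulN1r addrC => <-.
apply: le_charge_int => [|x]; last by rewrite mulN1r addrC.
apply: continuousD_fun; last exact: Cv.1.
by apply: continuousM_fun; [exact: cst_continuous|exact: Cw.1].
Qed.

Definition Fenchel_sup (D : set ('rV[R]_d -> R)) : \bar R :=
  ereal_sup [set ((charge_int mu v)%:E - intconj v)%E | v in D].

(** As [nu] is nonnegative, its variation is [nu O]. For the upper bound, the sets where a cutoff
    equals 1 exhaust [O], and the cutoff is moved from the weight into the competitor, since
    [conj (v * c) <= conj v * c]. For the lower bound, [v * cutoff] tends uniformly to [v] by
    [Dini]. *)
Lemma tv_measure_fun nu : is_measure_fun O psi mu nu -> tv O nu = Fenchel_sup admissible.
Proof.
move=> [nuO nu0 nuE].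
have neg0 A : measurable A -> charge_negm nu A = 0%E.
  move=> mA; rewrite /charge_negm /charge_neg /= jordan_negE cjordan_negE /crestr0 mem_set//.
  have [_ [mN negN] _ _] := svalP (hahn nu).
  apply/eqP; rewrite oppe_eq0 eq_le /crestr; apply/andP; split.
    by apply: negN; [exact: measurableI|exact: subIsetr].
  by apply: nu0; exact: measurableI.
pose m := charge_posm nu.
have intE f c : continuous f -> (forall x, `|f x| <= c) -> charge_int nu f = \int[m]_x f x.
  move=> cf fc; have muE A : measurable A -> nu A = (m A - (mzero : {finite_measure set 'rV[R]_d -> \bar R}) A)%E.
    by move=> mA; rewrite sube0 charge_decomp// neg0// sube0.
  rewrite (charge_int_diff muE cf fc) [X in _ - X](_ : _ = 0) ?subr0//.
  by rewrite /Rintegral integral_measure_zero.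
have tvE : tv O nu = m O.
  rewrite /tv /charge_variation -[LHS]/(charge_posm nu O + charge_negm nu O)%E.
  by rewrite neg0// adde0.
rewrite tvE; apply/eqP; rewrite eq_le; apply/andP; split.
- have mF n : measurable (O `&` [set x | cutoff O n x = 1]).
    apply: measurableI => //; rewrite -[X in measurable X]setTI.
    have := @continuous_measurable_rV _ _ _ (cutoff_C00 n).1 measurableT _ (measurable_set1 (1 : R)).
    by apply.
  have : (fun n => m (O `&` [set x | cutoff O n x = 1])) @ \oo --> m (\bigcup_n (O `&` [set x | cutoff O n x = 1])).
    apply: nondecreasing_cvg_mu => //; first exact: bigcupT_measurable.
    move=> a b ab; apply/subsetPset => x [Ox /= x1]; split=> //=.
    by apply/eqP; rewrite eq_le cutoff_le1 -x1 cutoff_nd.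
  rewrite (_ : \bigcup_n _ = O); last first.
    apply/seteqP; split=> [x [n _ []]//|x Ox].
    by have [N /(_ N (leqnn N))] := cutoff_eq1 oO Ox; exists N.
  move=> cv; apply: (cvge_le _ cv) => //.
  apply: nearW => n.
  have [c _ hc] := C00_bounded bO (cutoff_C00 n).
  apply: (@le_trans _ _ (charge_int nu (cutoff O n))%:E).
    rewrite (intE _ _ (cutoff_C00 n).1 hc) /Rintegral fineK; last first.
      by apply: integrable_fin_num => //; apply: bounded_continuous_integrable hc; exact: (cutoff_C00 n).1.
    rewrite -[leLHS]mul1e -integral_cst//.
    rewrite integral_mkcond; apply: ge0_le_integral => //.
    - by move=> x _; rewrite patchE; case: ifP.
    - by apply/measurable_restrict => //; exact: measurable_cst.
    - by apply/measurable_EFinP; exact: continuous_measurable_rV (cutoff_C00 n).1.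
    move=> x _; rewrite patchE; case: ifPn => [|_]; last by rewrite lee_fin cutoff_ge0.
    by rewrite inE => -[_ /= ->].
  rewrite nuE//; last by move=> x; exact: cutoff_ge0.
  apply: ge_ereal_sup => _ [v Dv <-].
  have [vc Dvc] := admissible_mul (cutoff_C00 n) (cutoff01 n) Dv.
  have ub := ereal_sup_ubound (ex_intro2 _ _ _ Dvc erefl) : (_ <= Fenchel_sup admissible)%E.
  apply: le_trans ub.
  apply: leeB => //; apply: ge0_le_integral => //.
  - by move=> x _; exact: conj_ge0.
  - by apply: mconj; case: Dvc => -[].
  - by apply: mJ; [case: Dv => -[]|exact: (cutoff_C00 n).1].
- apply: ge_ereal_sup => _ [v Dv <-].
  rewrite -(fineK (intconj_fin Dv)) -EFinB -(@fineK _ (m O)) ?fin_num_measure// lee_fin.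
  apply/ler_addgt0Pr => e e0.
  have t0 : 0 < TV + 1 by rewrite ltr_wpDl.
  have Cv := admissible_C00 Dv.
  have [n hn] : exists n, forall x, `|v x| * (1 - cutoff O n x) < e / (TV + 1).
    apply: (Dini bO); last exact: divr_gt0.
    + move=> n; apply: C00Mr; first exact: C00_abs.
      by apply: continuousB_fun; [exact: cst_continuous|exact: continuous_cutoff].
    + by move=> a b x ab; rewrite ler_wpM2l// lerD2l lerN2 cutoff_nd.
    + move=> x e' e'0; have [Ox|nOx] := pselect (O x).
        have [N hN] := cutoff_eq1 oO Ox; exists N.
        by rewrite hN// subrr mulr0.
      by exists 0%N; rewrite Cv.2// normr0 mul0r.
  have CvM : C00 O (fun x => v x * cutoff O n x) by exact: C00M.
  have h1 : charge_int mu v <= charge_int mu (fun x => v x * cutoff O n x) + e.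
    rewrite -lerBlDl; apply: le_trans (ler_norm _) _.
    apply: (@le_trans _ _ (TV * (e / (TV + 1)))); last first.
      by rewrite mulrCA ler_piMr ?(ltW e0)// ler_pdivrMr// mul1r lerDl.
    apply: charge_intB => // x; apply: le_trans (ltW (hn x)).
    rewrite -{1}[v x]mulr1 -mulrBr normrM (ger0_norm (x := 1 - _))// subr_ge0.
    exact: cutoff_le1.
  have h2 : fine (J v (cutoff O n)) <= fine (intconj v).
    apply: fine_le; [by apply: J_fin => // x; case/andP: (cutoff01 n x)|exact: intconj_fin|].
    apply: ge0_le_integral => //.
    - by move=> x _; rewrite mule_ge0 ?conj_ge0// lee_fin; case/andP: (cutoff01 n x).
    - by apply: mJ; [exact: Cv.1|exact: (cutoff_C00 n).1].
    - by apply: mconj; exact: Cv.1.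
    move=> x _; rewrite -[leRHS]mule1; apply: lee_wpmul2l; first exact: conj_ge0.
    by rewrite lee_fin cutoff_le1.
  have h3 : val v (cutoff O n) <= charge_int nu (cutoff O n).
    rewrite -lee_fin nuE//; last by move=> x; case/andP: (cutoff01 n x).
    rewrite valE//; last by move=> x; case/andP: (cutoff01 n x).
    by apply: ereal_sup_ubound; exists v.
  have h4 : charge_int nu (cutoff O n) <= fine (m O).
    have [c _ hc] := C00_bounded bO (cutoff_C00 n).
    have ic : m.-integrable setT (EFin \o cutoff O n).
      by apply: bounded_continuous_integrable hc; exact: (cutoff_C00 n).1.
    rewrite (intE _ _ (cutoff_C00 n).1 hc) /Rintegral; apply: fine_le.
    - exact: integrable_fin_num.
    - exact: fin_num_measure.
    rewrite -[leRHS]mul1e -integral_cst//.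
    rewrite [leRHS]integral_mkcond; apply: ge0_le_integral => //.
    - by move=> x _; rewrite lee_fin cutoff_ge0.
    - by apply/measurable_EFinP; exact: continuous_measurable_rV (cutoff_C00 n).1.
    - by apply/measurable_restrict => //; exact: measurable_cst.
    move=> x _; rewrite patchE; case: ifPn => [_|]; first by rewrite lee_fin cutoff_le1.
    by rewrite notin_setE => nOx; rewrite cutoff_out.
  move: h1 h2 h3 h4; rewrite /val; lra.
Qed.

(** A competitor may touch the slope, where the conjugate is not controlled under perturbation.
    Scaling by [1 - t] first moves it inside, at no cost in the penalty and at a cost of order [t]
    in the linear part. *)
Lemma Fenchel_sup_Cc1 : Fenchel_sup admissible = Fenchel_sup (@Cc1 R d O `&` admissible).
Proof.
apply/eqP; rewrite eq_le; apply/andP; split; last first.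
  by apply: ereal_sup_le => _ [v [_ Dv] <-]; exists v.
apply: ge_ereal_sup => _ [v Dv <-].
apply/lee_addgt0Pr => e e0.
have Cv := admissible_C00 Dv.
have T0 : 0 < 4 * (TV * M + 1) by rewrite mulr_gt0// ltr_wpDl// mulr_ge0// ltW.
pose t := Num.min (1/2) (e / (4 * (TV * M + 1))).
have t0 : 0 < t by rewrite lt_min divr_gt0//= divr_gt0.
have t1 : t <= 1 / 2 by rewrite ge_min lexx.
have tT : t * (TV * M) <= e / 4.
  have : t <= e / (4 * (TV * M + 1)) by rewrite ge_min lexx orbT.
  rewrite ler_pdivlMr// => h.
  have tt : 0 <= t * (TV * M) by rewrite !mulr_ge0 ?(ltW t0) ?(ltW M0).
  move: h tt t0; lra.
have th01 : 0 <= 1 - t <= 1 by move: t0 t1; lra.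
have [cle [Ctv _]] := admissible_scale th01 Dv.
have CtC := Cc0_C00 Ctv.
(* The scaled function is at most [M - t * M]; half of the margin is left to the C^1
   approximation. *)
have aM : M - t * M / 2 < M by rewrite gtrBl divr_gt0// mulr_gt0.
have [Y Y0 HY] := conj_lipschitz Hpsi aM.
pose Z := 4 * (TV + Y * volO O + 1).
have YV : 0 <= Y * volO O by rewrite mulr_ge0 ?(ltW Y0)// volO_ge0.
have Z0 : 0 < Z by rewrite /Z; move: TV0 YV; lra.
pose r := Num.min (t * M / 2) (e / Z).
have r0 : 0 < r by rewrite lt_min !divr_gt0// mulr_gt0.
have r1 : r <= t * M / 2 by rewrite ge_min lexx.
have rZ : r * (TV + Y * volO O) <= e / 4.
  have : r <= e / Z by rewrite ge_min lexx orbT.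
  rewrite ler_pdivlMr// /Z => h; move: h r0; lra.
have [w Cw wv] := Cc1_dense bO CtC r0.
have wM x : `|w x| <= M - t * M / 2.
  have : `|w x| <= `|w x - (1 - t) * v x| + `|(1 - t) * v x|.
    by rewrite -{1}[w x](subrK ((1 - t) * v x)) ler_normD.
  rewrite normrM (ger0_norm (x := 1 - t)); last by case/andP : th01.
  have := wv x; have : (1 - t) * `|v x| <= (1 - t) * M.
    by rewrite ler_wpM2l ?(admissible_bound Dv)//; case/andP : th01.
  move: r1; lra.
have Dw : admissible w by apply: (admissible_small aM) => //; exact: Cw.1.
have cw : continuous w by case: Cw => -[].
have ile : (intconj w <= intconj v + (Y * r * volO O)%:E)%E.
  apply: le_intconj => //; first by rewrite mulr_ge0// ltW.
  move=> x _; apply: le_trans (HY (w x) ((1 - t) * v x) (wM x)) _.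
  by apply: leeD => //; rewrite lee_fin ler_wpM2l// ltW.
have h1 := charge_intB (Cc1_C00 Cw) CtC wv.
have h2 : charge_int mu (fun x => (1 - t) * v x) = (1 - t) * charge_int mu v.
  have [c _ hc] := C00_bounded bO Cv.
  have z0 (x : 'rV[R]_d) : `|0 : R| <= 0 by rewrite normr0.
  have := charge_int_lin mu (1 - t) Cv.1 hc (@cst_continuous _ _ 0) z0.
  by rewrite charge_int0 addr0 => <-; congr charge_int; apply/funext => x; rewrite addr0.
have h3 : `|charge_int mu v| <= TV * M.
  by apply: le_charge_int; [exact: Cv.1|exact: admissible_bound].
apply: (@le_trans _ _ ((charge_int mu w)%:E - intconj w + e%:E)%E); last first.
  by apply: leeD => //; apply: ereal_sup_ubound; exists w.
move: ile; rewrite -(fineK (intconj_fin Dv)) -(fineK (intconj_fin Dw)).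
rewrite -EFinD -!EFinB -EFinD !lee_fin.
move: h1; rewrite h2 ler_norml => /andP[h1 _].
have h4 : t * charge_int mu v <= t * (TV * M).
  by rewrite ler_wpM2l ?(ltW t0)// (le_trans (ler_norm _)).
move: h1 h4 tT rZ; lra.
Qed.

End fixed_measure.

(** * The dual functional on H^{-1} *)

Definition Phi (u : Hm1 O) : \bar R :=
  ereal_sup [set ((app u v)%:E - intconj v)%E | v in @Cc1 R d O `&` admissible].

Lemma Phi_ge0 u : (0 <= Phi u)%E.
Proof.
apply: ereal_sup_ubound; exists (fun=> 0).
  by split; [exact: Cc1_0|exact: admissible0].
by rewrite intconj0 sube0 (app0 bO oO).
Qed.

Lemma tv_Phi u mu : is_measure_of u mu -> tv O (measure_fun O psi mu) = Phi u.
Proof.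
move=> [_ ext]; have -> : tv O (measure_fun O psi mu) = Fenchel_sup mu admissible.
  rewrite /measure_fun; case: pselect => [h|[]]; last exact: measure_fun_ex.
  by case: cid => nu /= hnu; exact: tv_measure_fun.
rewrite Fenchel_sup_Cc1; congr ereal_sup; apply: eq_imagel => v [Cv _].
have [w [Gw <-]] := Cc1_L2graph bO oO Cv.
by rewrite appE// ext.
Qed.

Lemma is_measure_of_intro (u : Hm1 O) mu : measures_on O mu ->
  (forall f, Cc1 O f -> charge_int mu f = app u f) -> is_measure_of u mu.
Proof.
move=> muO muE; split; [split=> //|]; last first.
  by move=> w Gw; rewrite -appE// muE//; case: Gw.
exists `|u| => // w Gw; rewrite muE; last by case: Gw.
rewrite appE//; apply: le_trans (ler_norm _) _; exact: Hm1normP.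
Qed.

Lemma Phi_lty u : (Phi u < +oo)%E -> exists mu, is_measure_of u mu.
Proof.
move=> Pfin; have Pf : Phi u \is a fin_num by rewrite ge0_fin_numE// Phi_ge0.
(* Any level below the slope would serve: C^1_c functions bounded by it are admissible with a
   uniformly bounded penalty. *)
pose a := M / 2; have a0 : 0 < a by rewrite divr_gt0.
have aM : a < M by rewrite /a ltr_pdivrMr// ltr_pMr// ltr1n.
have [Y Y0 HY] := conj_fin Hpsi aM.
pose P := fine (Phi u) + a * Y * volO O.
have P0 : 0 <= P.
  by rewrite addr_ge0 ?fine_ge0 ?Phi_ge0// !mulr_ge0 ?volO_ge0// ltW.
have bnd f : Cc1 O f -> (forall x, `|f x| <= a) -> app u f <= P.
  move=> Cf fa; have Df : admissible f by apply: (admissible_small aM) => //; exact: Cf.1.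
  have : ((app u f)%:E - intconj f <= Phi u)%E by apply: ereal_sup_ubound; exists f.
  have : (intconj f <= intconj (fun=> 0%R) + (a * Y * volO O)%:E)%E.
    apply: le_intconj => //.
    - by case: Cf => -[].
    - exact: admissible0.
    - by rewrite mulr_ge0// ltW.
    - by move=> x _; rewrite conj0// add0e; exact: HY.
  rewrite intconj0 add0e -(fineK Pf) -(fineK (intconj_fin Df)) -EFinB !lee_fin.
  by rewrite /P; lra.
have [mu [muO muE]] : exists mu, measures_on O mu /\
    forall f, Cc1 O f -> charge_int mu f = app u f.
  apply: (riesz_Cc1 (K := P / a) bO oO); first by rewrite divr_ge0// ltW.
  - by move=> s f g; exact: (app_lin bO oO).
  move=> f c Cf fc; apply/ler_addgt0Pr => e e0.
  have c0 : 0 <= c by apply: le_trans (fc 0).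
  have k0 : 0 < P / a + 1 by rewrite ltr_wpDl// divr_ge0// ltW.
  (* [c] may be 0, so it is enlarged before [f] is rescaled to size [a]. *)
  pose c' := c + e / (P / a + 1).
  have c'0 : 0 < c' by rewrite ltr_wpDl// divr_gt0.
  apply: (@le_trans _ _ (P / a * c')); last first.
    rewrite mulrDr lerD2l mulrCA ler_piMr ?(ltW e0)//.
    by rewrite ler_pdivrMr// mul1r lerDl.
  have key s : `|s| = 1 -> s * app u f <= P / a * c'.
    move=> s1; have : a / c' * (s * app u f) <= P.
      rewrite mulrA -(appZ bO oO)//; apply: bnd => [|x]; first exact: Cc1Z.
      rewrite 2!normrM s1 mulr1 gtr0_norm ?divr_gt0// mulrAC ler_pdivrMr//.
      rewrite ler_wpM2l ?(ltW a0)// (le_trans (fc x))//.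
      by rewrite lerDl divr_ge0// ltW.
    rewrite mulrC -ler_pdivlMr ?divr_gt0// => /le_trans; apply.
    by rewrite invf_div mulrAC mulrA.
  rewrite ler_norml; apply/andP; split.
    by rewrite lerNl -mulN1r key// normrN normr1.
  by rewrite -[leLHS]mul1r key// normr1.
by exists mu; exact: is_measure_of_intro.
Qed.

Lemma phi_Phi : phi psi = Phi.
Proof.
apply/funext => u; rewrite /phi; case: pselect => [h|nh].
  by case: cid => mu /= hmu; exact: tv_Phi.
by apply/esym/eqP; rewrite -leye_eq leNgt; apply/negP => /Phi_lty.
Qed.

End measure_function.

(** * The regularized dual problem *)

Section truncation.
Context (R : realType).
Variables a b : R.
Hypothesis (a0 : 0 <= a) (ab : a < b).

(* [excess s] has derivative [ramp s], which grows from 0 at [|s| = a] to 1 at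
   [|s| = b]; [s - excess s] is a C^1 truncation of [s] to [[-b, b]]. *)
Definition ramp (s : R) : R :=
  (2 * Num.max (s - a) 0 - 2 * Num.max (s - b) 0 +
   2 * Num.max (- s - a) 0 - 2 * Num.max (- s - b) 0) / (2 * (b - a)).

Definition excess (s : R) : R :=
  (pos_sqr (s - a) - pos_sqr (s - b) - pos_sqr (- s - a) + pos_sqr (- s - b)) /
  (2 * (b - a)).

Let ba0 : 0 < 2 * (b - a).
Proof. by rewrite mulr_gt0// subr_gt0. Qed.

Lemma is_derive_excess (s : R) : is_derive s 1 excess (ramp s).
Proof.
have sh c (t : R) := is_derive_pos_sqr_shift c t.
have nsh c (t : R) : is_derive t 1 (fun s : R => pos_sqr (- s - c)) (2 * Num.max (- t - c) 0 * -1).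
  apply: (@is_derive_comp R R (fun s : R => pos_sqr (s - c)) -%R).
pose f1 := fun s : R => pos_sqr (s - a); pose f2 := fun s : R => pos_sqr (s - b).
pose f3 := fun s : R => pos_sqr (- s - a); pose f4 := fun s : R => pos_sqr (- s - b).
have d12 : is_derive s 1 (f1 - f2) (2 * Num.max (s - a) 0 - 2 * Num.max (s - b) 0).
  by apply: is_deriveB; exact: sh.
have d3 : is_derive s 1 f3 (2 * Num.max (- s - a) 0 * -1) by exact: nsh.
have d4 : is_derive s 1 f4 (2 * Num.max (- s - b) 0 * -1) by exact: nsh.
have := is_deriveZ (2 * (b - a))^-1 (is_deriveD (is_deriveB d12 d3) d4).
rewrite (_ : _ \*: _ = excess); last first.
  by apply/funext => t; rewrite /excess [RHS]mulrC.
by move/is_derive_eq; apply; rewrite /ramp [RHS]mulrC; congr (_ * _); ring.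
Qed.

Lemma ramp_continuous : continuous ramp.
Proof.
apply: continuousM_fun; last exact: cst_continuous.
have c1 c : continuous (fun s : R => 2 * Num.max (s - c) 0) by exact: continuous_pos_part.
have c2 c : continuous (fun s : R => 2 * Num.max (- s - c) 0).
  apply: continuousM_fun; first exact: cst_continuous.
  apply: continuous_max_fun; last exact: cst_continuous.
  apply: continuousB_fun; last exact: cst_continuous.
  by apply: continuousN_fun => x; exact: cvg_id.
apply: continuousB_fun; last exact: c2.
by apply: continuousD_fun; [exact: continuousB_fun|exact: c2].
Qed.

Lemma ramp01 s : 0 <= ramp s <= 1.
Proof.
rewrite /ramp; apply/andP; split.
  apply: mulr_ge0; last by rewrite invr_ge0 ltW.
  by case: (leP (s - a) 0) => ?; case: (leP (s - b) 0) => ?; case: (leP (- s - a) 0) => ?;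
     case: (leP (- s - b) 0) => ?; move: a0 ab; lra.
rewrite ler_pdivrMr// mul1r.
by case: (leP (s - a) 0) => ?; case: (leP (s - b) 0) => ?; case: (leP (- s - a) 0) => ?;
   case: (leP (- s - b) 0) => ?; move: a0 ab; lra.
Qed.

Lemma ramp_eq0 s : `|s| <= a -> ramp s = 0.
Proof.
rewrite ler_norml => /andP[s1 s2]; rewrite /ramp !max_r; [by rewrite !mulr0 !subr0 addr0 mul0r|move: a0 ab s1 s2; lra..].
Qed.

Let excessE s : excess s * (2 * (b - a)) =
  pos_sqr (s - a) - pos_sqr (s - b) - pos_sqr (- s - a) + pos_sqr (- s - b).
Proof. by rewrite divfK// gt_eqF. Qed.

Let pos_sqr_ge (x : R) : 0 <= x -> pos_sqr x = x ^+ 2.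
Proof. by move=> x0; rewrite /pos_sqr max_l. Qed.

Let pos_sqr_le (x : R) : x <= 0 -> pos_sqr x = 0.
Proof. by move=> x0; rewrite /pos_sqr max_r// expr0n. Qed.

Let excessN s : excess (- s) = - excess s.
Proof. by rewrite /excess opprK; ring. Qed.

Let excess_pos s : 0 <= s -> [/\ 0 <= excess s, s - b <= excess s & excess s <= s].
Proof.
move=> s0; rewrite -(pmulr_lge0 _ ba0) -(ler_pM2r ba0 (s - b)) -(ler_pM2r ba0 (excess s)) excessE.
rewrite (pos_sqr_le (_ : - s - a <= 0)); last by move: a0 ab s0; lra.
rewrite (pos_sqr_le (_ : - s - b <= 0)); last by move: a0 ab s0; lra.
case: (leP (s - a) 0) => h1.
  rewrite (pos_sqr_le h1) (pos_sqr_le (_ : s - b <= 0)); last by move: a0 ab s0; lra.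
  by split; move: a0 ab s0 h1; nra.
rewrite (pos_sqr_ge (ltW h1)); case: (leP (s - b) 0) => h2.
  by rewrite (pos_sqr_le h2); split; move: a0 ab s0 h1 h2; nra.
by rewrite (pos_sqr_ge (ltW h2)); split; move: a0 ab s0 h1 h2; nra.
Qed.

Lemma truncation_le s : `|s - excess s| <= b /\ `|s - excess s| <= `|s|.
Proof.
wlog s0 : s / 0 <= s => [H|].
  have [/H//|/ltW s0] := leP 0 s.
  by have := H (- s); rewrite oppr_ge0 excessN -opprD !normrN; apply.
have [h0 h1 h2] := excess_pos s0.
by rewrite (ger0_norm s0) ger0_norm ?subr_ge0//; split; lra.
Qed.

Lemma excess0 : excess 0 = 0.
Proof.
have := (truncation_le 0).2; rewrite normr0 normr_le0 sub0r oppr_eq0.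
by move/eqP.
Qed.

End truncation.

(** * The penalized energy and its almost maximizers *)

Section regularization.
Context (R : realType) (d : nat) (O : set 'rV[R]_d) (psi : R -> R).
Hypothesis (d0 : (0 < d)%N) (bO : bounded_set O) (oO : open O) (Hpsi : integrand psi).
Local Notation conj := (conjugate psi).
Local Notation M := (slope psi).
Implicit Types (v w h : 'rV[R]_d -> R) (u : Hm1 O).

Lemma Cc1_comp (h h' : R -> R) w : Cc1 O w -> (forall t : R, is_derive t 1 h (h' t)) ->
  continuous h' -> h 0 = 0 ->
  Cc1 O (fun x => h (w x)) /\
  forall i, partial i (fun x => h (w x)) = fun x => h' (w x) * partial i w x.
Proof.
move=> Cw dh ch' h0.
have C1 := C1_grad_comp (Cc1_grad Cw) dh ch'.
split; last by move=> i; rewrite (C1_grad_partial i C1).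
split; last exact: C1_grad_Ck1 C1.
have [[cw kw wO] _] := Cw.
apply: (@Cc0_subset _ _ _ bO _ (Defs.support w)) => //.
- by case: C1.
- exact: closed_closure.
- by move=> x hx; apply: subset_closure => /=; apply: contraNneq hx => ->; rewrite h0.
Qed.

Section fixed_regularization.
Variables (u : Hm1 O) (lam delta : R) (g : R -> R).
Hypotheses (lam0 : 0 < lam) (de0 : 0 < delta) (hg : is_prox psi delta g).
Local Notation k := (rconj psi delta g).

Definition reg_energy w : R :=
  app u w - intO O (fun x => k (w x)) - lam / 2 * dirichlet O w w.

Definition reg_sup : R := sup [set reg_energy w | w in @Cc1 R d O].

Lemma rconj_C00 w : C00 O w -> C00 O (fun x => k (w x)).
Proof. by move=> Cw; apply: C00_comp => //; [exact: rconj_continuous|exact: (rconj0 Hpsi)]. Qed.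

Lemma prox_C00 w : C00 O w -> C00 O (fun x => g (w x)).
Proof. by move=> Cw; apply: C00_comp => //; [exact: prox_continuous hg|exact: (prox0 Hpsi de0)]. Qed.

Lemma reg_energy_le w : Cc1 O w -> reg_energy w <=
  `|u| * gradnorm O w - lam / 2 * gradnorm O w ^+ 2 - intO O (fun x => k (w x)).
Proof.
move=> Cw; rewrite /reg_energy -gradnorm_sqr.
have := le_app bO oO u Cw; have := ler_norm (app u w); lra.
Qed.

Lemma has_sup_reg_energy : has_sup [set reg_energy w | w in @Cc1 R d O].
Proof.
split; first by exists (reg_energy (cst 0)), (cst 0) => //; exact: Cc1_0.
(* The maximum of [|u| G - lam / 2 * G^2] over [G]. *)
exists (`|u| ^+ 2 / (2 * lam)) => _ [w Cw <-].
apply: le_trans (reg_energy_le Cw) _.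
have k0 : 0 <= intO O (fun x => k (w x)) by apply: intO_ge0 => x; exact: rconj_ge0.
rewrite ler_pdivlMr ?mulr_gt0//.
have := sqr_ge0 (`|u| - lam * gradnorm O w).
have : 0 <= intO O (fun x => k (w x)) * lam by rewrite mulr_ge0// ltW.
move: (gradnorm O w) (intO _ _) => G I; nra.
Qed.

Lemma reg_sup_ub w : Cc1 O w -> reg_energy w <= reg_sup.
Proof. by move=> Cw; apply: (sup_upper_bound has_sup_reg_energy); exists w. Qed.

Lemma reg_sup_ge0 : 0 <= reg_sup.
Proof.
apply: le_trans (reg_sup_ub (Cc1_0 O)).
rewrite /reg_energy (app0 bO oO) sub0r.
have -> : intO O (fun x : 'rV[R]_d => k (cst 0 x)) = 0.
  rewrite (_ : (fun=> _) = (fun x => 0 * (fun=> 0) x)); last first.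
    by apply/funext => x; rewrite mul0r (rconj0 Hpsi).
  by rewrite (intOZ bO oO) ?mul0r//; exact: C00_0.
have -> : dirichlet O (cst 0) (cst 0) = 0.
  have E : (fun x : 'rV[R]_d => -1 * (cst 0 : 'rV[R]_d -> R) x + (cst 0 : 'rV[R]_d -> R) x) = cst 0.
    by apply/funext => x; rewrite /= mulr0 addr0.
  by have := dirichlet_linl bO oO (-1) (Cc1_0 O) (Cc1_0 O) (Cc1_0 O); rewrite E mulN1r addNr.
by rewrite mulr0 subr0 oppr0.
Qed.

Lemma near_maximizer r : 0 < r -> exists2 w, Cc1 O w & reg_sup - r < reg_energy w.
Proof.
move=> r0; have [_ [w Cw <-] wr] := sup_adherent r0 has_sup_reg_energy.
by exists w.
Qed.

(* The Euler-Lagrange residual of [reg_energy] at [w] in the direction [h]. *)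
Let residual w h : R :=
  app u h - intO O (fun x => h x * g (w x)) - lam * dirichlet O w h.

(** Second-order loss per unit of Dirichlet energy: [C^2 / (4 delta)] from [rconj_upper] and the
    Poincare constant [C], and [lam / 2] from the Dirichlet term. *)
Let curvature : R -> R := fun C => C ^+ 2 / (4 * delta) + lam / 2.

Let dirichlet_sqr w h t : Cc1 O w -> Cc1 O h ->
  dirichlet O (fun x => t * h x + w x) (fun x => t * h x + w x) =
  t ^+ 2 * dirichlet O h h + 2 * t * dirichlet O w h + dirichlet O w w.
Proof.
move=> Cw Ch; have Ctw : Cc1 O (fun x => t * h x + w x) by exact: Cc1_lin.
rewrite (dirichlet_linl bO oO _ Ch Cw Ctw) (dirichlet_linr bO oO _ Ch Cw Ch).
rewrite (dirichlet_linr bO oO _ Ch Cw Cw) (dirichletC O h w).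
move: (dirichlet O w w) (dirichlet O w h) (dirichlet O h h) => D1 D2 D3; ring.
Qed.

Let reg_energy_lower w h t C : Cc1 O w -> Cc1 O h ->
  intO O (fun x => h x ^+ 2) <= C ^+ 2 * dirichlet O h h ->
  reg_energy w + t * residual w h - t ^+ 2 * (curvature C * dirichlet O h h) <=
  reg_energy (fun x => t * h x + w x).
Proof.
move=> Cw Ch Ph.
have Ctw : Cc1 O (fun x => t * h x + w x) by exact: Cc1_lin.
have C0w := Cc1_C00 Cw; have C0h := Cc1_C00 Ch.
have Cgh : C00 O (fun x => h x * g (w x)).
  by apply: C00Mr => //; exact: (prox_C00 C0w).1.
have Chh : C00 O (fun x => h x ^+ 2).
  by under eq_fun do rewrite expr2; apply: C00Mr => //; exact: C0h.1.
have Ck := rconj_C00 C0w.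
have Iub : intO O (fun x => k (t * h x + w x)) <=
    intO O (fun x => k (w x)) + t * intO O (fun x => h x * g (w x)) +
    t ^+ 2 / (4 * delta) * intO O (fun x => h x ^+ 2).
  have C1 : C00 O (fun x => t * (h x * g (w x)) + k (w x)) by apply: C00D => //; exact: C00Z.
  rewrite [X in _ <= X + _]addrC -(intO_lin bO oO)// addrC -(intO_lin bO oO)//.
  apply: (le_intO bO oO).
  - by apply: rconj_C00; exact: Cc1_C00.
  - by apply: C00D => //; exact: C00Z.
  move=> x _; rewrite addrC; apply: le_trans (rconj_upper de0 hg (w x) (t * h x)) _.
  by rewrite exprMn; lra.
rewrite /reg_energy (app_lin bO oO)//.
rewrite (dirichlet_sqr t Cw Ch) /residual /curvature.
move: Iub; have : t ^+ 2 / (4 * delta) * intO O (fun x => h x ^+ 2) <=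
    t ^+ 2 / (4 * delta) * (C ^+ 2 * dirichlet O h h).
  by rewrite ler_wpM2l// divr_ge0 ?sqr_ge0// mulr_ge0// ltW.
move: (app u h) (app u w) (dirichlet O w w) (dirichlet O w h) (dirichlet O h h).
move: (intO O (fun x => k (w x))) (intO O (fun x => h x * g (w x))).
move: (intO O (fun x => h x ^+ 2)) (intO O (fun x => k (t * h x + w x))).
move: (4 * delta)^-1 => q I1 I2 I3 I4 a1 a2 D1 D2 D3.
by lra.
Qed.

(* At an almost maximizer [w], [u] is close to [g \o w] plus [lam] times the Laplacian
   of [w]; testing with [w] itself bounds the Dirichlet energy. *)
Lemma near_maximizer_residual e : 0 < e -> exists w, [/\ Cc1 O w,
  forall h, Cc1 O h -> `|app u h - intO O (fun x => h x * g (w x))| <=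
    (e + lam * gradnorm O w) * gradnorm O h &
  intO O (fun x => psi (g (w x))) + lam / 4 * gradnorm O w ^+ 2 <=
    reg_sup + e ^+ 2 / lam].
Proof.
move=> e0; have [C C0 HC] := poincare_Cc1 d0 bO oO.
have A0 : 0 < curvature C.
  by rewrite /curvature ltr_wpDl ?divr_ge0 ?sqr_ge0 ?divr_gt0// mulr_ge0// ltW.
(* Almost maximality makes [r - t * residual + t^2 * curvature * |grad h|^2] nonnegative for all
   [t], so the residual is at most [2 sqrt (r * curvature) |grad h|]; this [r] turns the factor into
   [e]. *)
have [r r0 rC] : exists2 r : R, 0 < r & r * curvature C = (e / 2) ^+ 2.
  exists ((e / 2) ^+ 2 / curvature C); last by rewrite divfK// gt_eqF.
  by rewrite divr_gt0// exprn_gt0// divr_gt0.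
have [w Cw wr] := near_maximizer r0.
have res h : Cc1 O h -> `|residual w h| <= e * gradnorm O h.
  move=> Ch; have D0 := dirichlet_ge0 O h.
  have := @quadratic_ge0 _ r (- residual w h / 2) (curvature C * dirichlet O h h).
  rewrite normrM normrN (ger0_norm (x := 2^-1)) ?invr_ge0//.
  move=> H; have {H} : `|residual w h| / 2 <= Num.sqrt r * Num.sqrt (curvature C * dirichlet O h h).
    apply: H => [t|]; last by rewrite mulr_ge0// ltW.
    have := reg_energy_lower t Cw Ch (HC _ Ch).
    have := reg_sup_ub (Cc1_lin t Ch Cw).
    move: (t ^+ 2 * _) wr => X; rewrite mulr2n -mulrDr -splitr mulrN.
    move: (t * residual w h) (reg_energy w) (reg_energy _) reg_sup => x1 x2 x3 x4.
    by lra.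
  rewrite -sqrtrM ?(ltW r0)// mulrA rC.
  have e20 : 0 <= e / 2 by rewrite divr_ge0// ltW.
  rewrite sqrtrM ?sqr_ge0// sqrtr_sqr (ger0_norm e20).
  by rewrite -/(gradnorm O h); lra.
exists w; split=> // [h Ch|].
  have := res _ Ch; have := dirichlet_cauchy_schwarz bO oO Cw Ch.
  rewrite mulrDl -mulrA => h1 h2.
  have -> : app u h - intO O (fun x => h x * g (w x)) = residual w h + lam * dirichlet O w h.
    by rewrite /residual subrK.
  by rewrite (le_trans (ler_normD _ _))// lerD// normrM (gtr0_norm lam0) ler_wpM2l// ltW.
have C0w := Cc1_C00 Cw.
have := res _ Cw; rewrite ler_norml => /andP[h1 _].
have := reg_sup_ub Cw; rewrite /reg_energy.
have Cwg : C00 O (fun x => w x * g (w x)).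
  by apply: C00Mr => //; exact: (prox_C00 C0w).1.
have Cpsi : C00 O (fun x => psi (g (w x))).
  apply: (C00_comp (h := psi)); [exact: psi_continuous|exact: integrand0 Hpsi|exact: prox_C00].
(* Equality in Fenchel-Young at the maximizer [g (w x)], with the nonnegative term [delta g^2]
   dropped. *)
have : intO O (fun x => psi (g (w x))) + intO O (fun x => k (w x)) <= intO O (fun x => w x * g (w x)).
  rewrite -(intOD bO oO) //; last exact: rconj_C00.
  apply: (le_intO bO oO) => // [|x _].
    by apply: C00D => //; exact: rconj_C00.
  rewrite /rconj; have : 0 <= delta * g (w x) ^+ 2 by rewrite mulr_ge0 ?sqr_ge0// ltW.
  by lra.
move: h1; rewrite /residual -gradnorm_sqr.
move: (gradnorm O w) (intO _ _) (intO _ _) (intO _ _) (app u w) => G I1 I2 I3 a1.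
have : e * G <= e ^+ 2 / lam + lam / 4 * G ^+ 2.
  rewrite -subr_ge0 (_ : _ - _ = (e - lam * G / 2) ^+ 2 / lam).
    by rewrite divr_ge0 ?sqr_ge0// ltW.
  by field; rewrite gt_eqF.
by lra.
Qed.

(** Midpoint convexity of [rconj] and the parallelogram identity for the Dirichlet form. The gain
    [lam / 8] forces two almost maximizers to be close in H^1_0. *)
Lemma reg_energy_mid w h : Cc1 O w -> Cc1 O h ->
  (reg_energy w + reg_energy (fun x => 1 * h x + w x)) / 2 + lam / 8 * dirichlet O h h <=
  reg_energy (fun x => 2^-1 * h x + w x).
Proof.
move=> Cw Ch; rewrite /reg_energy (app_lin bO oO u 1 Ch Cw) (app_lin bO oO u 2^-1 Ch Cw) (dirichlet_sqr 1 Cw Ch) (dirichlet_sqr 2^-1 Cw Ch).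
have C1 : Cc1 O (fun x => 1 * h x + w x) by exact: Cc1_lin.
have Cm : Cc1 O (fun x => 2^-1 * h x + w x) by exact: Cc1_lin.
have : intO O (fun x => k (2^-1 * h x + w x)) <=
    2^-1 * (intO O (fun x => k (w x)) + intO O (fun x => k (1 * h x + w x))).
  have K1 := rconj_C00 (Cc1_C00 Cw); have K2 := rconj_C00 (Cc1_C00 C1).
  rewrite -(intOD bO oO)// -(intOZ bO oO); last exact: C00D.
  apply: (le_intO bO oO).
  - exact: rconj_C00 (Cc1_C00 Cm).
  - by apply: C00Z; exact: C00D.
  move=> x _; have := rconj_mid de0 hg (w x) (1 * h x + w x).
  by rewrite (_ : (w x + _) / 2 = 2^-1 * h x + w x); [lra|field].
move: (dirichlet O w w) (dirichlet O w h) (dirichlet O h h) (app u w) (app u h).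
move: (intO _ _) (intO _ _) (intO _ _) => I1 I2 I3 D1 D2 D3 a1 a2.
by lra.
Qed.

(** A crude bound for the solutions of [lam / 2 * G^2 <= |u| G + 1]; what matters is that [delta]
    does not enter. *)
Definition energy_bound : R := 2 * `|u| / lam + 2 / lam + 1.

(** The threshold -1 covers every almost maximizer with defect at most 1, because [reg_sup] is
    nonnegative. *)
Lemma reg_energy_bounds w : Cc1 O w -> -1 <= reg_energy w ->
  gradnorm O w <= energy_bound /\
  intO O (fun x => k (w x)) <= `|u| * energy_bound + 1.
Proof.
move=> Cw Ew; have := le_trans Ew (reg_energy_le Cw).
have k0 : 0 <= intO O (fun x => k (w x)) by apply: intO_ge0 => x; exact: rconj_ge0.
have := gradnorm_ge0 O w; have := normr_ge0 u; rewrite /energy_bound.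
move: k0; move: (intO _ _) (gradnorm O w) `|u| => I G N I0 N0 G0 H.
have GB : G <= 2 * N / lam + 2 / lam + 1.
  rewrite leNgt; apply/negP => GB.
  have G1 : 1 <= G.
    apply: le_trans (ltW GB); rewrite lerDr addr_ge0// divr_ge0 ?(ltW lam0)//.
    by rewrite mulr_ge0.
  have : lam * (2 * N / lam + 2 / lam + 1) <= lam * G by rewrite ler_pM2l// ltW.
  rewrite (_ : lam * _ = 2 * N + 2 + lam); last by field; rewrite gt_eqF.
  move=> H2; have : (2 * N + 2 + lam) * G <= lam * G * G by rewrite ler_wpM2r.
  by move: H lam0 I0 G1 N0; nra.
split=> //; have : N * G <= N * (2 * N / lam + 2 / lam + 1) by rewrite ler_wpM2l.
have : 0 <= lam / 2 * G ^+ 2 by rewrite mulr_ge0 ?sqr_ge0// divr_ge0// ltW.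
by move: H; lra.
Qed.

(** The gradient of the excess is [ramp] times the sum of the gradients of [h] and [w1]. The first
    is small with [h]. The second is bounded by [X] and counts only where [|h + w1| > a]; there
    [rconj_ge_excess] gives [1 <= 4 delta / (a - M)^2 * k], so that the integral of [k] controls its
    contribution as in Chebyshev's inequality. *)
Lemma dirichlet_excess a b w1 h X : M < a -> a < b -> Cc1 O w1 -> Cc1 O h ->
  (forall i x, `|partial i w1 x| <= X) -> 
  dirichlet O (fun x => excess a b (1 * h x + w1 x)) (fun x => excess a b (1 * h x + w1 x)) <=
  2 * dirichlet O h h +
  d%:R * (2 * X ^+ 2 * (4 * delta / (a - M) ^+ 2)) * intO O (fun x => k (1 * h x + w1 x)).
Proof.
move=> Ma ab Cw1 Ch HX; pose w2 x := 1 * h x + w1 x.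
have M0 := slope_gt0 Hpsi.
have a0 : 0 <= a by rewrite ltW// (lt_trans M0).
have Cw2 : Cc1 O w2 by exact: Cc1_lin.
have [Cq pq] := Cc1_comp Cw2 (is_derive_excess a b) (@ramp_continuous _ a b) (excess0 a0 ab).
rewrite [X in _ + X](_ : _ = \sum_(i < d) (2 * X ^+ 2 * (4 * delta / (a - M) ^+ 2) *
  intO O (fun x => k (w2 x)))); last by rewrite sumr_const card_ord -mulrA mulr_natl.
rewrite /dirichlet mulr_sumr -big_split/=.
apply: ler_sum => i _.
have Cp1 := Cc1_partial_C00 i Cw1; have Cph := Cc1_partial_C00 i Ch.
have Ck2 := rconj_C00 (Cc1_C00 Cw2).
have Chh : C00 O (fun x => partial i h x * partial i h x).
  by apply: C00Mr => //; exact: Cph.1.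
have Ck2' := C00Z (2 * X ^+ 2 * (4 * delta / (a - M) ^+ 2)) Ck2.
rewrite -(intOZ bO oO 2 Chh) -(intOZ bO oO _ Ck2) -(intOD bO oO)//; last exact: C00Z.
apply: (le_intO bO oO).
- by apply: C00Mr; [exact: Cc1_partial_C00|exact: (Cc1_partial_C00 i Cq).1].
- by apply: C00D => //; exact: C00Z.
move=> x _; rewrite pq (partial_lin 1 i Ch Cw1).
have /andP[r0 r1] := ramp01 a0 ab (w2 x).
have k20 : 0 <= k (w2 x) by exact: rconj_ge0.
set c := 4 * delta / (a - M) ^+ 2.
have am0 : 0 < (a - M) ^+ 2 by rewrite exprn_gt0// subr_gt0.
have de4 : 0 < 4 * delta by rewrite mulr_gt0.
have c0 : 0 < c by exact: divr_gt0.
have rk : ramp a b (w2 x) ^+ 2 <= c * k (w2 x).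
  have [wa|aw] := leP `|w2 x| a.
    by rewrite (ramp_eq0 a0 ab wa) expr0n mulr_ge0// ltW.
  apply: (@le_trans _ _ 1); first by rewrite expr_le1.
  have Mw : M <= `|w2 x| by rewrite ltW// (lt_trans Ma).
  have := rconj_ge_excess Hpsi de0 hg Mw; rewrite ler_pdivrMr// => h1.
  rewrite /c mulrAC ler_pdivlMr// mul1r.
  rewrite mulrC (le_trans _ h1)// lerXn2r ?nnegrE ?subr_ge0 ?(ltW Ma)//.
  by rewrite lerD2r ltW.
have pX : partial i w1 x ^+ 2 <= X ^+ 2.
  by rewrite -[leLHS]real_normK ?num_real// lerXn2r ?nnegrE// (le_trans _ (HX i x)).
move: rk pX; rewrite mul1r.
move: (partial i h x) (partial i w1 x) (ramp a b (w2 x)) r0 r1 => p q r r0 r1 rk pX.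
apply: (@le_trans _ _ (2 * p ^+ 2 + 2 * (r ^+ 2 * q ^+ 2))).
  have : (r * (p + q)) ^+ 2 <= 2 * (r * p) ^+ 2 + 2 * (r * q) ^+ 2.
    by have := sqr_ge0 (r * p - r * q); lra.
  have : r ^+ 2 * p ^+ 2 <= p ^+ 2 by rewrite ler_piMl ?sqr_ge0// expr_le1.
  by rewrite !exprMn; lra.
rewrite -expr2 lerD2l -(mulrA _ c) -(mulrA 2) ler_pM2l// [leRHS]mulrC.
by apply: ler_pM => //; exact: sqr_ge0.
Qed.

End fixed_regularization.
End regularization.

(** * Removing the regularization *)

Section approximation.
Context (R : realType) (d : nat) (O : set 'rV[R]_d) (psi : R -> R).
Hypothesis (d0 : (0 < d)%N) (bO : bounded_set O) (oO : open O) (Hpsi : integrand psi).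
Local Notation conj := (conjugate psi).
Local Notation M := (slope psi).
Local Notation leb := (lebesgue_rV R d).
Local Notation Phi := (Phi psi).
Local Notation admissible := (admissible O psi).
Local Notation intconj := (intconj O psi).
Implicit Types (v w h f : 'rV[R]_d -> R) (u : Hm1 O).

Let mO : measurable O. Proof. exact: open_measurable_mx. Qed.

Lemma intconj_le v f e : continuous v -> C00 O f -> (forall x, 0 <= f x) -> 0 <= e ->
  (forall x, (conj (v x) <= (f x + e)%:E)%E) ->
  (intconj v <= (intO O f + e * volO O)%:E)%E.
Proof.
move=> cv Cf f0 e0 vf.
have mconj : measurable_fun O (fun x => conj (v x)).
  by apply: measurable_funTS; exact: conj_measurable.
have mf : measurable_fun O (fun x => (f x)%:E).
  by apply/measurable_EFinP; apply: measurable_funTS; exact: continuous_measurable_rV Cf.1.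
rewrite EFinD (intO_EFin bO oO Cf) /volO EFinM fineK; last first.
  by rewrite ge0_fin_numE//; exact: leb_finO.
rewrite -integral_cst// -ge0_integralD//; last by move=> x _; rewrite lee_fin.
apply: ge0_le_integral => //.
- by move=> x _; exact: conj_ge0.
- by apply: emeasurable_funD.
Qed.

Section fixed_functional.
Variables (u : Hm1 O) (lam eta : R).
Hypotheses (lam0 : 0 < lam) (eta0 : 0 < eta) (Pfin : (Phi u < +oo)%E).
Local Notation N := `|u|.
Local Notation B := (energy_bound u lam).

Let Pf : Phi u \is a fin_num.
Proof. by rewrite ge0_fin_numE// Phi_ge0. Qed.

Let N0 : 0 <= N := normr_ge0 u.

Let B0 : 0 < B.
Proof.
have := divr_ge0 (mulr_ge0 (ler0n R 2) N0) (ltW lam0).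
have : 0 < 2 / lam by rewrite divr_gt0.
by rewrite /energy_bound; lra.
Qed.

Let comparison_arith (s aw aq I J P V n1 n2 D theta r : R) :
  s - r < aw - I - D -> J <= I + V -> theta * (aw - aq) - J <= P ->
  (1 - theta) * (aw - aq) <= n1 -> aq <= n2 -> 0 <= D -> s <= P + V + n2 + n1 + r.
Proof. lra. Qed.

(* Two regularizations [(d1, g1)], [(d2, g2)] whose suprema differ by at most [r] have
   almost maximizers [w1], [w2] that are close in H^1_0 (the energy is uniformly
   concave); [w2] is then truncated at a level slightly above the slope. *)
Let comparison a b theta Y d1 d2 g1 g2 w1 w2 r tau X :
  M < a -> a < b -> 0 <= theta <= 1 -> theta * b < M ->
  (forall delta g, 0 < delta -> is_prox psi delta g ->
    forall x, `|x| <= theta * b -> (conj x <= (rconj psi delta g x + delta * Y ^+ 2)%:E)%E) ->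
  0 < d2 -> d2 <= d1 -> is_prox psi d1 g1 -> is_prox psi d2 g2 ->
  Cc1 O w1 -> Cc1 O w2 ->
  0 < r <= 1 -> reg_sup psi u lam d1 g1 - r < reg_energy psi u lam d1 g1 w1 ->
  reg_sup psi u lam d2 g2 - r < reg_energy psi u lam d2 g2 w2 ->
  reg_sup psi u lam d1 g1 <= reg_sup psi u lam d2 g2 + r ->
  (forall i x, `|partial i w1 x| <= X) -> 0 <= tau ->
  24 * r / lam +
    d%:R * (2 * X ^+ 2 * (4 * d2 / (a - M) ^+ 2)) * (N * B + 1) <= tau ^+ 2 ->
  reg_sup psi u lam d2 g2 <= fine (Phi u) + d2 * Y ^+ 2 * volO O + N * tau +
    (1 - theta) * (N * B + N * tau) + r.
Proof.
move=> Ma ab /andP[t0 t1] tb HY d20 d21 hg1 hg2 Cw1 Cw2 /andP[r0 r1] E1 E2 S12 HX tau0 Htau.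
have d10 : 0 < d1 by exact: lt_le_trans d21.
have M0 := slope_gt0 Hpsi; have a0 : 0 <= a by rewrite ltW// (lt_trans M0).
pose h x := -1 * w1 x + w2 x.
have Ch : Cc1 O h by exact: Cc1_lin.
have hw : (fun x => 1 * h x + w1 x) = w2 by apply/funext => x; rewrite /h; ring.
have S20 := reg_sup_ge0 bO oO Hpsi u lam0 d20 hg2.
have [GB IK] : gradnorm O w2 <= B /\ intO O (fun x => rconj psi d2 g2 (w2 x)) <= N * B + 1.
  apply: (reg_energy_bounds bO oO Hpsi lam0 d20 hg2 Cw2); move: E2 S20 r1.
  by move: (reg_energy psi u lam d2 g2 w2) (reg_sup psi u lam d2 g2) => e s; lra.
have K2 := rconj_C00 Hpsi d20 hg2 (Cc1_C00 Cw2).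
have E12 : reg_energy psi u lam d2 g2 w2 <= reg_energy psi u lam d1 g1 w2.
  rewrite /reg_energy lerD2r lerD2l lerN2; apply: (le_intO bO oO) => // [|x _].
    exact: (rconj_C00 Hpsi d10 hg1 (Cc1_C00 Cw2)).
  exact: (rconj_antimono g1 (w2 x) d20 d21 hg2).
(* By [E12], [E2] and [S12], [w2] is within [2 r] of the supremum for [d1], and [w1] is within [r].
   The midpoint cannot exceed that supremum, so [lam / 8] times the Dirichlet energy of [h] is at
   most [3 r / 2]. *)
have Dhh : dirichlet O h h <= 12 * r / lam.
  have := reg_energy_mid bO oO Hpsi u lam d10 hg1 Cw1 Ch; rewrite hw.
  have Cm : Cc1 O (fun x => 2^-1 * h x + w1 x) by exact: Cc1_lin.
  have := reg_sup_ub bO oO Hpsi u lam0 d10 hg1 Cm.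
  rewrite ler_pdivlMr//; move: E1 E2 S12 E12.
  move: (reg_energy psi u lam d1 g1 (fun x => 2^-1 * h x + w1 x)) => e1.
  move: (reg_energy psi u lam d1 g1 w1) (reg_energy psi u lam d1 g1 w2) => e2 e3.
  move: (reg_energy psi u lam d2 g2 w2) => e4.
  move: (dirichlet O h h) (reg_sup psi u lam d1 g1) (reg_sup psi u lam d2 g2) => D s1 s2.
  by lra.
have := dirichlet_excess bO oO Hpsi d20 hg2 Ma ab Cw1 Ch HX.
pose q x := excess a b (w2 x).
rewrite (_ : (fun x => excess a b _) = q); last first.
  by apply/funext => x; rewrite /q -[in RHS]hw.
rewrite (_ : (fun x => rconj _ _ _ _) = (fun x => rconj psi d2 g2 (w2 x))); last first.
  by apply/funext => x; rewrite -[in RHS]hw.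
move=> Dq.
have [Cq _] := Cc1_comp bO Cw2 (is_derive_excess a b) (@ramp_continuous _ a b) (excess0 a0 ab).
have Gq : gradnorm O q <= tau.
  rewrite -[tau]ger0_norm// -sqrtr_sqr ler_wsqrtr// (le_trans Dq)// (le_trans _ Htau)//.
  apply: lerD; first by rewrite (_ : 24 * r / lam = 2 * (12 * r / lam)) ?ler_pM2l//; ring.
  apply: ler_wpM2l => //; rewrite mulr_ge0// mulr_ge0//; first by rewrite mulr_ge0// sqr_ge0.
  by rewrite divr_ge0 ?sqr_ge0// mulr_ge0// ltW.
have Aq : `|app u q| <= N * tau by exact: le_trans (le_app bO oO u Cq) (ler_wpM2l N0 Gq).
have Aw : `|app u w2| <= N * B by exact: le_trans (le_app bO oO u Cw2) (ler_wpM2l N0 GB).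
(* [T] is [w2] truncated to [[-b, b]]; the factor [theta] then brings it strictly below the slope,
   where it is admissible. *)
pose T x := -1 * q x + w2 x.
have CT : Cc1 O T by exact: Cc1_lin.
pose v x := theta * T x.
have Cv : Cc1 O v by exact: Cc1Z.
have TE x : T x = w2 x - q x by rewrite /T mulN1r addrC.
have vb x : `|v x| <= theta * b.
  by rewrite normrM ger0_norm// ler_wpM2l// TE; exact: (truncation_le a0 ab (w2 x)).1.
have Dv : admissible v by apply: (admissible_small bO oO Hpsi tb) => //; exact: Cv.1.
have vle : (intconj v <= (intO O (fun x => rconj psi d2 g2 (w2 x)) + d2 * Y ^+ 2 * volO O)%:E)%E.
  apply: intconj_le => //.
  - by case: Cv => -[].
  - by move=> x; exact: rconj_ge0.
  - by rewrite mulr_ge0 ?sqr_ge0// ltW.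
  move=> x; apply: le_trans (HY _ _ d20 hg2 _ (vb x)) _; rewrite lee_fin lerD2r.
  apply: (rconj_mono Hpsi d20 hg2); rewrite normrM ger0_norm//.
  apply: le_trans (_ : `|T x| <= _); first by rewrite ler_piMl.
  by rewrite TE; exact: (truncation_le a0 ab (w2 x)).2.
have vPhi : app u v - fine (intconj v) <= fine (Phi u).
  rewrite -lee_fin EFinB (fineK Pf) (fineK (intconj_fin oO Dv)).
  by apply: ereal_sup_ubound; exists v.
have app_v : app u v = theta * (app u w2 - app u q).
  by rewrite (appZ bO oO _ _ CT) (app_lin bO oO u (-1) Cq Cw2) mulN1r [- _ + _]addrC.
move: vle; rewrite -(fineK (intconj_fin oO Dv)) lee_fin => vle.
have D20 : 0 <= lam / 2 * dirichlet O w2 w2 by rewrite mulr_ge0 ?dirichlet_ge0// divr_ge0// ltW.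
have h1 : (1 - theta) * (app u w2 - app u q) <= (1 - theta) * (N * B + N * tau).
  rewrite ler_wpM2l ?subr_ge0// (le_trans (ler_norm _))// (le_trans (ler_normB _ _))//.
  by rewrite lerD.
have h2 := le_trans (ler_norm _) Aq.
rewrite app_v in vPhi.
exact: (comparison_arith E2 vle vPhi h1 h2 D20).
Qed.

Let small e c : 0 < e -> 0 <= c -> exists2 x : R, 0 < x & forall y, y <= x -> y * c <= e.
Proof.
move=> e0 c0; have c1 : 0 < c + 1 by rewrite ltr_wpDl.
exists (e / (c + 1)) => [|y yx]; first exact: divr_gt0.
apply: le_trans (ler_wpM2r c0 yx) _.
by rewrite mulrAC ler_pdivrMr// ler_wpM2l ?(ltW e0)// lerDl.
Qed.

(** The order of choices matters. [d1] is taken within [r] of the infimum of all the suprema, so no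
    other regularization is lower by more than [r]. Its almost maximizer [w1], and with it the
    gradient bound [X], is fixed before [d2], which can then be made small in terms of [X]. *)
Lemma reg_sup_le : exists delta g, [/\ 0 < delta, is_prox psi delta g &
  reg_sup psi u lam delta g <= fine (Phi u) + eta].
Proof.
have M0 := slope_gt0 Hpsi.
have e4 : 0 < eta / 4 by rewrite divr_gt0.
have NB0 : 0 <= N * B by rewrite mulr_ge0// ltW.
have [tau tau0 Htau] := small e4 N0.
have Nt0 : 0 <= N * tau by rewrite mulr_ge0// ltW.
have c0 : 0 <= 3 * (N * B + N * tau) by rewrite mulr_ge0// addr_ge0.
have [rho0 rho00 Hrho] := small e4 c0.
have [rho [rho_gt0 rho4 rhoS]] : exists rho : R, [/\ 0 < rho, rho <= 1 / 4 &
    rho * (3 * (N * B + N * tau)) <= eta / 4].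
  exists (Num.min (1 / 4) rho0); rewrite lt_min rho00 divr_gt0//= ge_min lexx.
  by split=> //; apply: Hrho; rewrite ge_min lexx orbT.
(* [theta * b = M * (1 - rho - 6 rho^2)] stays below the slope although [b] is above it, and
   [1 - theta = 3 rho] is small. *)
pose a := M * (1 + rho); pose b := M * (1 + 2 * rho); pose theta := 1 - 3 * rho.
have Ma : M < a by rewrite /a mulrDr mulr1 ltrDl mulr_gt0.
have ab : a < b by rewrite /a /b ltr_pM2l// ltrD2l ltr_pMl// ltr1n.
have th01 : 0 <= theta <= 1 by rewrite /theta; move: rho_gt0 rho4; lra.
have tb : theta * b < M.
  rewrite /theta /b mulrCA -[ltRHS]mulr1 ltr_pM2l//.
  rewrite -subr_gt0 (_ : _ - _ = rho + 6 * rho ^+ 2); last by ring.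
  by rewrite ltr_wpDr// mulr_ge0// sqr_ge0.
have [Y Y0 HY] := conj_le_rconj Hpsi tb.
have t20 : 0 < tau ^+ 2 / 2 by rewrite divr_gt0// exprn_gt0.
have l0 : 0 <= 24 / lam by rewrite divr_ge0// ltW.
have [r0 r00 Hr] := small t20 l0.
pose r := Num.min (Num.min 1 (eta / 4)) r0.
have r_gt0 : 0 < r by rewrite !lt_min ltr01 e4.
have r1 : r <= 1 by rewrite !ge_min lexx.
have r4 : r <= eta / 4 by rewrite !ge_min lexx orbT.
have rl : r * (24 / lam) <= tau ^+ 2 / 2 by apply: Hr; rewrite ge_min lexx orbT.
pose A := [set x | exists delta g, [/\ 0 < delta, is_prox psi delta g &
  x = reg_sup psi u lam delta g]].
have hA : has_inf A.
  split; last by exists 0 => _ [delta [g [de0 hg ->]]]; exact: (reg_sup_ge0 bO oO Hpsi).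
  have [g hg] := prox_exists Hpsi (@ltr01 R).
  by exists (reg_sup psi u lam 1 g), 1, g.
have [_ [d1 [g1 [d10 hg1 ->]]] S1] := inf_adherent r_gt0 hA.
have [w1 Cw1 E1] := near_maximizer bO oO Hpsi u lam0 d10 hg1 r_gt0.
have [X HX] : exists X, forall i x, `|partial i w1 x| <= X.
  have /choice[b' hb'] : forall i, exists c, 0 <= c /\ forall x, `|partial i w1 x| <= c.
    move=> i; have [c c_gt0 hc] := C00_bounded bO (Cc1_partial_C00 i Cw1).
    by exists c; split=> //; exact: ltW.
  exists (\sum_i b' i) => i x; have [b0 hbx] := hb' i; apply: le_trans (hbx x) _.
  rewrite (bigD1 i)//= lerDl sumr_ge0// => j _.
  by have [] := hb' j.
have X2 : 0 <= X ^+ 2 by exact: sqr_ge0.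
pose Z := d%:R * (2 * X ^+ 2 * (4 / (a - M) ^+ 2)) * (N * B + 1).
have Z0 : 0 <= Z.
  rewrite mulr_ge0 ?addr_ge0// mulr_ge0// mulr_ge0 ?divr_ge0 ?sqr_ge0//.
  by rewrite mulr_ge0.
have YV0 : 0 <= Y ^+ 2 * volO O by rewrite mulr_ge0 ?sqr_ge0// volO_ge0.
have [x1 x10 Hx1] := small e4 YV0; have [x2 x20 Hx2] := small t20 Z0.
pose d2 := Num.min d1 (Num.min x1 x2).
have d20 : 0 < d2 by rewrite !lt_min d10 x10.
have d21 : d2 <= d1 by rewrite ge_min lexx.
have d2V : d2 * (Y ^+ 2 * volO O) <= eta / 4 by apply: Hx1; rewrite !ge_min lexx ?orbT.
have d2Z : d2 * Z <= tau ^+ 2 / 2 by apply: Hx2; rewrite !ge_min lexx ?orbT.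
have [g2 hg2] := prox_exists Hpsi d20.
have [w2 Cw2 E2] := near_maximizer bO oO Hpsi u lam0 d20 hg2 r_gt0.
have S12 : reg_sup psi u lam d1 g1 <= reg_sup psi u lam d2 g2 + r.
  apply: le_trans (ltW S1) _; rewrite lerD2r.
  by apply: (inf_lbound hA.2); exists d2, g2.
have r01 : 0 < r <= 1 by rewrite r_gt0.
have tauS : 24 * r / lam +
    d%:R * (2 * X ^+ 2 * (4 * d2 / (a - M) ^+ 2)) * (N * B + 1) <= tau ^+ 2.
  rewrite [leRHS]splitr; apply: lerD; first by rewrite (_ : _ / lam = r * (24 / lam))//; ring.
  rewrite (_ : d%:R * _ * _ = d2 * Z)// /Z.
  move: (N * B + 1) (X ^+ 2) ((a - M) ^+ 2)^-1 (d%:R : R) => p1 p2 p3 p4; ring.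
exists d2, g2; split=> //.
have := comparison Ma ab th01 tb HY d20 d21 hg1 hg2 Cw1 Cw2 r01 E1 E2 S12 HX (ltW tau0) tauS.
have thS : (1 - theta) * (N * B + N * tau) <= eta / 4.
  by apply: le_trans rhoS; rewrite /theta le_eqVlt; apply/orP; left; apply/eqP; ring.
have tauN : N * tau <= eta / 4 by rewrite mulrC Htau.
move=> /le_trans; apply; rewrite -!addrA lerD2l.
rewrite (_ : eta = eta / 4 + (eta / 4 + (eta / 4 + eta / 4))); last by field.
by rewrite -mulrA; apply: lerD => //; apply: lerD => //; apply: lerD.
Qed.

End fixed_functional.
End approximation.

(** * Approximation by continuous densities and affine minorants *)

Section relaxation.
Context (R : realType) (d : nat) (O : set 'rV[R]_d) (psi : R -> R).
Hypothesis (d0 : (0 < d)%N) (bO : bounded_set O) (oO : open O) (Hpsi : integrand psi).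
Local Notation Phi := (Phi psi).
Local Notation admissible := (admissible O psi).
Local Notation intconj := (intconj O psi).
Implicit Types (v w h f : 'rV[R]_d -> R) (u : Hm1 O).

Let mO : measurable O. Proof. exact: open_measurable_mx. Qed.

Lemma C00_L2_in_Hm1 f u : C00 O f ->
  (forall h, Cc1 O h -> app u h = intO O (fun x => h x * f x)) -> L2_in_Hm1 u.
Proof.
move=> Cf uf; have [w wE] := C00_L2 bO oO Cf.
have [mu [dmu muO muE]] := density_charge bO oO Cf.
exists w, mu; split; first by rewrite wE.
by apply: is_measure_of_intro => // h Ch; rewrite uf// muE//; exact: Cc1_C00.
Qed.

(** The Fenchel-Young inequality, integrated for each competitor [v]. *)
Lemma Phi_le_int f u : C00 O f ->
  (forall h, Cc1 O h -> app u h = intO O (fun x => h x * f x)) ->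
  (Phi u <= (intO O (fun x => psi (f x)))%:E)%E.
Proof.
move=> Cf uf; apply: ge_ereal_sup => _ [v [Cv Dv] <-].
have Cvf : C00 O (fun x => v x * f x) by apply: C00Mr; [exact: Cc1_C00|exact: Cf.1].
have Cpsi : C00 O (fun x => psi (f x)).
  by apply: (C00_comp (h := psi)) => //; [exact: psi_continuous|exact: integrand0 Hpsi].
rewrite leeBlDr ?(intconj_fin oO Dv)// uf// !(intO_EFin bO oO)//.
have [_ iv] := Dv.
rewrite /intconj -integralD//; last exact: (C00_integrableO bO oO Cpsi).
apply: le_integral => //.
- exact: (C00_integrableO bO oO Cvf).
- by apply: integrableD => //; exact: (C00_integrableO bO oO Cpsi).
move=> x _; apply: le_trans (leeD (lexx _) (le_conj psi (v x) (f x))).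
by rewrite -EFinD lee_fin addrC subrK.
Qed.

Lemma app_add u1 u2 a b v : Cc1 O v ->
  app (a *: u1 + b *: u2) v = a * app u1 v + b * app u2 v.
Proof.
by move=> /(Cc1_L2graph bO oO)[w [Gw <-]]; rewrite !appE.
Qed.

Lemma L2_approximation u e eta : 0 < e -> 0 < eta -> (Phi u < +oo)%E ->
  exists uf, [/\ L2_in_Hm1 uf, `|u - uf| < e & (Phi uf <= Phi u + eta%:E)%E].
Proof.
move=> e0 eta0 Pfin.
have P0 := Phi_ge0 bO oO Hpsi u.
have Pf : Phi u \is a fin_num by rewrite ge0_fin_numE.
have [P P00 PE] : exists2 P : R, 0 <= P & Phi u = P%:E.
  by exists (fine (Phi u)); rewrite ?fine_ge0// fineK.
(* The energy estimate [lam / 4 * G^2 <= P + eta] gives [(lam G)^2 <= 4 lam (P + eta)]: it is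
   [lam G] that becomes small, even if [G] grows as [lam] tends to 0. *)
have [lam [lam0 Hlam]] : exists lam : R, 0 < lam /\ 4 * lam * (P + eta) <= (e / 4) ^+ 2.
  have c0 : 0 < 4 * (P + eta) by rewrite mulr_gt0// ltr_wpDl.
  exists ((e / 4) ^+ 2 / (4 * (P + eta))).
  split; first by rewrite divr_gt0// exprn_gt0// divr_gt0.
  by rewrite -mulrA mulrCA divfK// gt_eqF.
have eta2 : 0 < eta / 2 by rewrite divr_gt0.
have [delta [g [de0 hg HS]]] := reg_sup_le bO oO Hpsi lam0 eta2 Pfin; rewrite PE /= in HS.
(* The tolerance is chosen after [lam], because it enters the energy estimate through
   [s^2 / lam]. *)
have [s [s0 se sl]] : exists s : R, [/\ 0 < s, s <= e / 4 & s ^+ 2 / lam <= eta / 2].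
  pose s1 := Num.sqrt (lam * (eta / 2)).
  have s10 : 0 < s1 by rewrite sqrtr_gt0 mulr_gt0.
  exists (Num.min (e / 4) s1); split.
  - by rewrite lt_min s10 divr_gt0.
  - by rewrite ge_min lexx.
  have s1E : s1 ^+ 2 = lam * (eta / 2).
    by rewrite sqr_sqrtr// mulr_ge0 ?(ltW lam0)// (ltW eta2).
  rewrite ler_pdivrMr// [leRHS]mulrC -s1E.
  have m0 : 0 <= Num.min (e / 4) s1 by rewrite le_min (ltW s10) andbT divr_ge0// ltW.
  by rewrite lerXn2r ?nnegrE ?(ltW s10)// ge_min lexx orbT.
have [w [Cw wres wen]] := near_maximizer_residual d0 bO oO Hpsi u lam0 de0 hg s0.
have Cf : C00 O (fun x => g (w x)) := prox_C00 Hpsi de0 hg (Cc1_C00 Cw).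
have [uf ufE] := C00_Hm1 d0 bO oO Cf.
have psi0 : 0 <= intO O (fun x => psi (g (w x))).
  by apply: intO_ge0 => x; exact: (integrand_ge0 Hpsi).
have G0 := gradnorm_ge0 O w.
have lG : lam * gradnorm O w <= e / 4.
  have lG0 : 0 <= lam * gradnorm O w by rewrite mulr_ge0// ltW.
  have e40 : 0 <= e / 4 by rewrite divr_ge0// ltW.
  rewrite -ler_sqr ?nnegrE//; apply: le_trans Hlam; rewrite exprMn.
  have h1 : lam / 4 * gradnorm O w ^+ 2 <= P + eta by move: wen HS sl psi0; lra.
  have l4 : 0 <= 4 * lam by rewrite mulr_ge0// ltW.
  by have := ler_wpM2l l4 h1; move: (gradnorm O w ^+ 2) => G; lra.
exists uf; split; first exact: C00_L2_in_Hm1 Cf ufE.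
- apply: (@le_lt_trans _ _ (s + lam * gradnorm O w)); last by lra.
  apply: (Hm1_norm_le bO oO) => [|h Ch]; first by rewrite addr_ge0 ?(ltW s0)// mulr_ge0// ltW.
  have := wres h Ch; rewrite -ufE//.
  by have := app_add u uf 1 (-1) Ch; rewrite scale1r scaleN1r mul1r mulN1r => ->.
- apply: le_trans (Phi_le_int Cf ufE) _; rewrite PE -EFinD lee_fin.
  have : 0 <= lam / 4 * gradnorm O w ^+ 2 by rewrite mulr_ge0 ?sqr_ge0// divr_ge0// ltW.
  by move: wen HS sl; lra.
Qed.

Lemma lsc_le_Phi (beta : Hm1 O -> \bar R) : lower_semicontinuous beta ->
  (forall u, L2_in_Hm1 u -> (beta u <= Phi u)%E) -> forall u, (beta u <= Phi u)%E.
Proof.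
move=> lbeta betaL u; rewrite leNgt; apply/negP => Plt.
have Pfin : (Phi u < +oo)%E by apply: lt_le_trans Plt _; rewrite leey.
have Pf : Phi u \is a fin_num by rewrite ge0_fin_numE// Phi_ge0.
have [eta eta0 Pe] : exists2 eta : R, 0 < eta & (Phi u + eta%:E < beta u)%E.
  move: Plt; rewrite -(fineK Pf); case: (beta u) => [b| |] //.
    rewrite lte_fin => h; exists ((b - fine (Phi u)) / 2); first by rewrite divr_gt0// subr_gt0.
    by rewrite -EFinD lte_fin; lra.
  by move=> _; exists 1 => //; rewrite -EFinD ltey.
move: Pe; rewrite -(fineK Pf) -EFinD => Pe.
have [V uV HV] := lbeta u _ Pe.
have /nbhs_ballP[e /= e0 eV] : nbhs u V by [].
have [uf [Luf ufe ufP]] := L2_approximation e0 eta0 Pfin.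
have Vuf : V uf by apply: eV; rewrite -ball_normE.
have := HV uf Vuf; rewrite EFinD (fineK Pf) ltNge => /negP; apply.
exact: le_trans (betaL uf Luf) ufP.
Qed.

Lemma minorant v : Cc1 O v -> admissible v ->
  exists beta : Hm1 O -> \bar R, [/\ [/\ forall u, (0 <= beta u)%E, econvex beta,
    lower_semicontinuous beta & forall u, (beta u <= Phi u)%E] &
    forall u, ((app u v)%:E - intconj v <= beta u)%E].
Proof.
move=> Cv Dv; pose c := fine (intconj v).
have cE : intconj v = c%:E by rewrite fineK// intconj_fin.
pose beta u := (Num.max (app u v - c) 0)%:E.
exists beta; split=> [|u]; last by rewrite cE -EFinB lee_fin le_max lexx.
split.
- by move=> u; rewrite lee_fin le_max lexx orbT.
- move=> u1 u2 t /andP[t0 t1]; rewrite /beta -!EFinM -EFinD lee_fin app_add// ge_max.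
  have h (x : R) : x <= Num.max x 0 by rewrite le_max lexx.
  have h0 (x : R) : 0 <= Num.max x 0 by rewrite le_max lexx orbT.
  have t2 : 0 <= 1 - t by rewrite subr_ge0.
  have := ler_wpM2l t0 (h (app u1 v - c)); have := ler_wpM2l t2 (h (app u2 v - c)).
  have := mulr_ge0 t0 (h0 (app u1 v - c)); have := mulr_ge0 t2 (h0 (app u2 v - c)).
  by move=> *; apply/andP; split; lra.
- move=> u a; rewrite lte_fin lt_max => /orP[h|a0]; last first.
    exists setT; first exact: filterT.
    by move=> w _; rewrite lte_fin lt_max a0 orbT.
  have G0 : 0 < gradnorm O v + 1 by rewrite ltr_wpDl// gradnorm_ge0.
  pose e := (app u v - c - a) / (gradnorm O v + 1).
  have e0 : 0 < e by rewrite divr_gt0// subr_gt0.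
  exists (ball u e); first exact: nbhsx_ballx.
  move=> w; rewrite -ball_normE /= => uw.
  rewrite lte_fin lt_max; apply/orP; left.
  have := app_add u w 1 (-1) Cv; rewrite scale1r scaleN1r mul1r mulN1r => E.
  have := le_app bO oO (u - w) Cv; rewrite E => h1.
  have h2 : `|u - w| * gradnorm O v <= e * gradnorm O v.
    by rewrite ler_wpM2r ?gradnorm_ge0// ltW.
  have h3 : e * gradnorm O v + e = app u v - c - a.
    by rewrite -[X in _ + X]mulr1 -mulrDr divfK// gt_eqF.
  have := le_trans (ler_norm _) (le_trans h1 h2).
  by move: e0 h3; lra.
- move=> u; have P0 := Phi_ge0 bO oO Hpsi u.
  have : ((app u v)%:E - intconj v <= Phi u)%E by apply: ereal_sup_ubound; exists v.
  by rewrite cE -EFinB /beta; case: (leP (app u v - c) 0).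
Qed.

End relaxation.

Theorem corollary3p9 (R : realType) (d : nat) (O : set 'rV[R]_d) (psi : R -> R)
    (d_gt0 : (0 < d)%N) (hO : bounded_smooth_domain O)
    (psi_ge0 : forall x, 0 <= psi x)
    (psi_convex : convex_function setT (psi : convex_lmodType R^o -> R^o))
    (psi_lsc : lower_semicontinuous (fun x : R => (psi x)%:E))
    (psi0 : psi 0 = 0) (psi_even : forall x, psi x = psi (- x))
    (psi_growth : exists2 C : R, 0 < C & forall x, psi x <= C * (1 + `|x|))
    (psi_nontrivial : exists2 y : R, 0 < y & 0 < psi y) :
  phi psi = (fun u : Hm1 O => ereal_sup
    [set beta u | beta in [set beta : Hm1 O -> \bar R |
      [/\ forall w, (0 <= beta w)%E, econvex beta, lower_semicontinuous beta &
          forall w, L2_in_Hm1 w -> (beta w <= phi psi w)%E]]]).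
Proof.
have [oO _ _ bO _] := hO.
have Hpsi : integrand psi.
  split=> // x y t /andP[t0 t1].
  by have := psi_convex (Itv01 t0 t1) x y (in_setT _) (in_setT _).
rewrite (phi_Phi bO oO Hpsi); apply/funext => u; apply/eqP; rewrite eq_le; apply/andP; split.
  apply: ge_ereal_sup => _ [v [Cv Dv] <-].
  have [beta [[b0 bc bl bP] bv]] := minorant bO oO Hpsi Cv Dv.
  by apply: le_trans (bv u) _; apply: ereal_sup_ubound; exists beta.
apply: ge_ereal_sup => _ [beta [_ _ bl bP] <-].
exact: (lsc_le_Phi d_gt0 bO oO Hpsi bl bP).
Qed.
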